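(* Let $f=(f_1,\dots,f_n)$ be an $n$-tuple of formal power series in the set $\mathcal M_{rad}\cap\mathcal M^{||}$. Let $\mathcal H,\mathcal H'$ be Hilbert spaces, let $T=(T_1,\dots,T_n)\in\mathbb B_f(\mathcal H)$ and $T'=(T_1',\dots,T_n')\in\mathbb B_f(\mathcal H')$, and let $V=(V_1,\dots,V_n)\in\mathbb B_f(\mathcal K)$ and $V'=(V_1',\dots,V_n')\in\mathbb B_f(\mathcal K')$ be dilations of $T$ and $T'$, respectively. If $X:\mathcal H\to\mathcal H'$ is a bounded operator satisfying the intertwining relations $XT_i=T_i'X$ for any $i=1,\dots,n$, then there exists a bounded operator $Y:\mathcal K\to\mathcal K'$ with the following properties: (i) $YV_i=V_i'Y$ for any $i=1,\dots,n$; (ii) $Y^*|_{\mathcal H'}=X^*$ and $\|X\|=\|Y\|$.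
   Context: Words and series. $\mathbb F_n^+$ is the free semigroup of words in the letters $1,\dots,n$, with empty word $\varnothing$; $|\alpha|$ is the length of $\alpha$. For an $n$-tuple $Y=(Y_1,\dots,Y_n)$ of elements of a unital algebra, $Y_\alpha:=Y_{i_1}\cdots Y_{i_k}$ if $\alpha=i_1\cdots i_k$, and $Y_\varnothing:=1$. Power series are formal power series $\psi=\sum_\alpha a_\alpha Z_\alpha$ with complex coefficients in noncommuting indeterminates $Z_1,\dots,Z_n$. For $Y\in B(\mathcal H)^n$ put $\psi(Y):=\sum_{k\ge0}\sum_{|\alpha|=k}a_\alpha Y_\alpha$ (series over $k$); $\mathcal C_\psi(\mathcal H)$ (resp. $\mathcal C_\psi^{SOT}(\mathcal H)$) is the set of $Y$ for which this converges in norm (resp. in the strong operator topology, SOT). $\mathcal C_\psi^{rad}(\mathcal H)$ is the set of $Y$ for which there is $\delta\in(0,1)$ with $rY\in\mathcal C_\psi(\mathcal H)$ for $r\in(\delta,1)$ and $\text{SOT-}\lim_{r\to1}\psi(rY)$ exists; then $\psi(Y)$ denotes this limit. For an $n$-tuple $f=(f_1,\dots,f_n)$ of power series these conditions are required for every $f_i$; $f(Y)=(f_1(Y),\dots,f_n(Y))$ is also regarded as a row operator $\mathcal H^{(n)}\to\mathcal H$, where $\mathcal H^{(n)}$ is the direct sum of $n$ copies of $\mathcal H$. $[B(\mathcal H)^n]_r:=\{X\in B(\mathcal H)^n:\|\sum_iX_iX_i^*\|^{1/2}<r\}$. A free holomorphic function on $[B(\mathcal H)^n]_\gamma$ is (the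 evaluation map of) a power series with $\limsup_k(\sum_{|\alpha|=k}|a_\alpha|^2)^{1/2k}\le1/\gamma$. Model property. $\mathbb H^2(f)$ denotes the Hilbert space with orthonormal basis $\{f_\alpha\}_{\alpha\in\mathbb F_n^+}$ ($f_\varnothing=1$), whose elements are the series $\sum_\alpha c_\alpha f_\alpha$, $\sum|c_\alpha|^2<\infty$. $f$ has the model property ($f\in\mathcal M$) if one of the following holds. ($\mathcal A$) $f$ is an $n$-tuple of noncommutative polynomials and there is an $n$-tuple $q$ of polynomials with $f\circ q=q\circ f=\mathrm{id}$. ($\mathcal S$) $f(0)=0$, each $f_i$ has nonzero radius of convergence, the matrix of linear coefficients of $f$ is invertible ($\det J_f(0)\ne0$; then elements of $\mathbb H^2(f)$ are formal power series), $Z_1,\dots,Z_n\in\mathbb H^2(f)$, each $M_{Z_i}\psi:=Z_i\psi$ is a bounded operator on $\mathbb H^2(f)$, and $M_{f_j}=f_j(M_{Z_1},\dots,M_{Z_n})$, where $M_{f_j}\psi:=f_j\psi$ and $(M_{Z_1},\dots,M_{Z_n})$ is in $\mathcal C_f^{SOT}(\mathbb H^2(f))$ or $\mathcal C_f^{rad}(\mathbb H^2(f))$. ($\mathcal F$) for some $\gamma>0$, $f$ is an $n$-tuple of free holomorphic functions on $[B(\mathcal H)^n]_\gamma$ ($\mathcal H$ infinite dimensional) with range in $[B(\mathcal H)^n]_1$, there is no nonzero free holomorphic $G$ on $[B(\mathcal H)^n]_1$ with $G\circ f=0$ (then $\mathbb H^2(f)=\{G\circ f: G=\sum c_\alpha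 Z_\alpha,\ \sum|c_\alpha|^2<\infty\}$), the coordinate functions lie in $\mathbb H^2(f)$, and the boundedness of $M_{Z_i}$ and $M_{f_j}=f_j(M_{Z_1},\dots,M_{Z_n})$ hold as in ($\mathcal S$). The universal model of $\mathbb B_f$ is $M_Z=(M_{Z_1},\dots,M_{Z_n})$. Writing $Z_i=\sum_\alpha a_\alpha^{(i)}f_\alpha$ in $\mathbb H^2(f)$, the inverse of $f$ under composition is $g=(g_1,\dots,g_n)$, $g_i:=\sum_\alpha a^{(i)}_\alpha Z_\alpha$ (so $g\circ f=\mathrm{id}$). Domain. $\mathbb B_f(\mathcal H)$ is the set of $X\in B(\mathcal H)^n$ with $X\in\mathcal C_f^{SOT}(\mathcal H)$ or $X\in\mathcal C_f^{rad}(\mathcal H)$, $\|f(X)\|\le1$ and $g(f(X))=X$, meaning that either $X_i=\sum_k\sum_{|\alpha|=k}a_\alpha^{(i)}[f(X)]_\alpha$ (SOT convergence) for all $i$, or $X_i=\text{SOT-}\lim_{r\to1}\sum_k\sum_{|\alpha|=k}a_\alpha^{(i)}r^{|\alpha|}[f(X)]_\alpha$ for all $i$. Classes. $f\in\mathcal M^{||}$ means $f\in\mathcal M$ and either the series $f_i(M_Z)$ converge in norm, or $f_i(rM_Z)$ converges in norm for $r<1$ close to $1$ and $f_i(M_Z)=\lim_{r\to1}f_i(rM_Z)$ in norm. $f\in\mathcal M_{rad}$ (radial approximation property) means that there is $\delta\in(0,1)$ such that $rf=(rf_1,\dots,rf_n)\in\mathcal M$ for every $r\in(\delta,1]$. Dilations.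 $C^*(M_{Z_1},\dots,M_{Z_n})$ is the $C^*$-algebra generated by $M_{Z_1},\dots,M_{Z_n}$ and the identity. A dilation of $T\in\mathbb B_f(\mathcal H)$ is an $n$-tuple $V=(V_1,\dots,V_n)$ of operators on a Hilbert space $\mathcal K\supseteq\mathcal H$ such that: (i) $V\in\mathbb B_f(\mathcal K)$; (ii) there is a unital $*$-representation $\pi:C^*(M_{Z_1},\dots,M_{Z_n})\to B(\mathcal K)$ with $\pi(M_{Z_i})=V_i$ for all $i$; (iii) $V_i^*|_{\mathcal H}=T_i^*$ for all $i$. *)

(* Defs.v *)
From HB Require Import structures.
From mathcomp Require Import all_boot all_order all_algebra.
From mathcomp Require Import complex.
From mathcomp Require Import boolp classical_sets reals ereal topology.
From mathcomp Require Import normedtype sequences exp.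
From mathcomp Require Import ring lra.

Set Implicit Arguments.
Unset Strict Implicit.
Unset Printing Implicit Defensive.

Import Order.TTheory GRing.Theory Num.Theory.
Import numFieldNormedType.Exports.

Local Open Scope classical_set_scope.
Local Open Scope complex_scope.
Local Open Scope ring_scope.

(* The inner product is linear in its first argument; the norm of a normed
   module over R[i] takes its values in R[i]. *)
HB.mixin Record isHilbert (R : realType) V & CompleteNormedModule R[i] V := {
  hdot : {dot V for (@Num.conj R[i])} ;
  hdotxx : forall x : V, hdot x x = `|x| ^+ 2
}.

#[short(type="hilbertType")]
HB.structure Definition Hilbert (R : realType) :=
  {V of CompleteNormedModule R[i] V & isHilbert R V}.

Definition rnorm (R : realType) (V : normedModType R[i]) (x : V) : R :=
  complex.Re `|x|.

Section HilbertTheory.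
Context {R : realType}.
Implicit Types V : normedModType R[i].
Implicit Types H : hilbertType R.

Lemma rnormE V (x : V) : `|x| = (rnorm x)%:C.
Proof. by rewrite /rnorm RRe_real. Qed.

Lemma rnorm_ge0 V (x : V) : 0 <= rnorm x.
Proof. by rewrite -ler0c -rnormE. Qed.

Lemma rnormD V (x y : V) : rnorm (x + y) <= rnorm x + rnorm y.
Proof. by rewrite -lecR rmorphD /= -!rnormE ler_normD. Qed.

Lemma rnormZ V (a : R[i]) (x : V) : rnorm (a *: x) = complex.Re `|a| * rnorm x.
Proof.
by apply: complexI; rewrite rmorphM /= RRe_real// -!rnormE normrZ.
Qed.

Lemma rnorm0 V : rnorm (0 : V) = 0.
Proof. by rewrite /rnorm normr0. Qed.

Lemma hdotC H (x y : H) : hdot x y = (hdot y x)^*.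
Proof. by rewrite hermC /= expr0 mul1r. Qed.

Lemma cauchy_schwarz H (x y : H) : `|hdot x y| <= `|x| * `|y|.
Proof.
have [->|y0] := eqVneq y 0; first by rewrite linear0r normr0 normr0 mulr0.
have n0 : 0 < `|y| by rewrite normr_gt0.
have := dnorm_ge0 (hdot : {dot H for _}) (`|y| ^+ 2 *: x - hdot x y *: y).
rewrite dnormB !dnormZ /= !hdotxx.
rewrite linearZl_LR linearZr_LR /= [_^* * _]mulrC -normCK.
rewrite conj_Creal ?realM ?realX ?normr_real// ger0_norm ?exprn_ge0//.
set a := `|hdot x y| ^+ 2; set b := `|y| ^+ 2; set c := `|x| ^+ 2 => le0.
have b0 : 0 < b by rewrite exprn_gt0.
rewrite -(@ler_pXn2r _ 2) ?nnegrE ?mulr_ge0// exprMn -/a -/b -/c.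
rewrite -subr_ge0 -(pmulr_rge0 _ b0); apply: le_trans le0 _.
by rewrite le_eqVlt; apply/orP; left; apply/eqP; ring.
Qed.

Lemma hdot_eq0 H (x : H) : hdot x x = 0 -> x = 0.
Proof. by move/eqP; rewrite hdotxx sqrf_eq0 normr_eq0 => /eqP. Qed.

Lemma hdot_inj H (y z : H) : (forall x, hdot x y = hdot x z) -> y = z.
Proof.
move=> yz; apply/eqP; rewrite -subr_eq0; apply/eqP/hdot_eq0.
by rewrite linearBr /= yz subrr.
Qed.

Lemma rnorm_sqr H (x : H) : (rnorm x ^+ 2)%:C = hdot x x.
Proof. by rewrite rmorphXn /= -rnormE hdotxx. Qed.

Lemma parallelogram H (x y : H) :
  rnorm (x + y) ^+ 2 + rnorm (x - y) ^+ 2 =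
  2 * (rnorm x ^+ 2 + rnorm y ^+ 2).
Proof.
apply: complexI; rewrite rmorphM !rmorphD /= !rnorm_sqr dnormD dnormB.
by rewrite [1%:C]rmorph1; ring.
Qed.

Lemma riesz H (phi : H -> R[i]) (M : R) : scalar phi ->
  (forall x, `|phi x| <= M%:C * `|x|) -> exists y, forall x, phi x = hdot x y.
Proof.
move=> phiL phiM.
have phi0 : phi 0 = 0.
  by have := phiL 1 0 0; rewrite scaler0 mul1r addr0 => /eqP; rewrite -subr_eq0 opprD addNKr oppr_eq0 => /eqP.
have phiD x y : phi (x + y) = phi x + phi y.
  by have := phiL 1 x y; rewrite scale1r mul1r.
have phiZ a x : phi (a *: x) = a * phi x.
  by have := phiL a x 0; rewrite !addr0 phi0 addr0.
have phiN x : phi (- x) = - phi x by rewrite -scaleN1r phiZ mulN1r.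
have [phi_eq0|/existsNP[x0 /eqP phix0]] := pselect (forall x, phi x = 0).
  by exists 0 => x; rewrite phi_eq0 linear0r.
pose S : set R := [set rnorm x | x in [set x | phi x = 1]].
have S0 : S !=set0.
  by exists (rnorm ((phi x0)^-1 *: x0)), ((phi x0)^-1 *: x0); rewrite //= phiZ mulVf.
have Slb : has_lbound S by exists 0 => _ [x _ <-]; exact: rnorm_ge0.
pose d := inf S.
have d_le x : phi x = 1 -> d <= rnorm x.
  by move=> x1; apply: (ge_inf Slb); exists x.
have d0 : 0 <= d by apply: lb_le_inf => // _ [x _ <-]; exact: rnorm_ge0.
have /choice[u uP] (k : nat) : exists x, phi x = 1 /\ rnorm x < d + k.+1%:R^-1.
  have e0 : 0 < k.+1%:R^-1 :> R by rewrite invr_gt0 ltr0n.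
  have [_ [x x1 <-] xd] := inf_adherent e0 (conj S0 Slb : has_inf S).
  by exists x.
have uv x y (e : R) : phi x = 1 -> phi y = 1 -> 0 <= e ->
    rnorm x <= d + e -> rnorm y <= d + e ->
    rnorm (x - y) ^+ 2 <= 4 * e * (2 * d + e).
  move=> x1 y1 e0 xd yd.
  have dxy : d <= rnorm (2^-1 *: (x + y)).
    by apply: d_le; rewrite phiZ phiD x1 y1 mulVf.
  have : 2 * d <= rnorm (x + y).
    move: dxy; rewrite rnormZ.
    have -> : complex.Re `|2^-1 : R[i]| = 2^-1.
      have -> : (2^-1 : R[i]) = (2^-1)%:C by rewrite fmorphV rmorph_nat.
      by rewrite normc_def /= expr0n addr0 sqrtr_sqr ger0_norm.
    by rewrite ler_pdivlMl.
  have := parallelogram x y; have := rnorm_ge0 x; have := rnorm_ge0 y.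
  by nra.
have gt0C (e : R[i]) : 0 < e -> 0 < complex.Re e /\ (complex.Re e)%:C = e.
  by move=> e0; have eE := RRe_real (gtr0_real e0); rewrite -ltcR eE.
have inv0 (e : R) : 0 < e -> \forall k \near \oo, k.+1%:R^-1 < e.
  by move=> e0; apply: near_infty_natSinv_lt (PosNum e0).
have /cauchy_cvgP/cvg_ex[z uz] : cauchy (u @ \oo).
  apply/cauchy_ballP => e /gt0C[]; set r := complex.Re e => r0 <-.
  have c0 : 0 < 4 * (2 * d + 1) by lra.
  have [k _ kP] := inv0 _ (divr_gt0 (exprn_gt0 2 r0) c0).
  pose A := [set x | phi x = 1 /\ rnorm x <= d + k.+1%:R^-1].
  have FA : (u @ \oo) A.
    exists k => // j /= kj; have [uj1 /ltW ujd] := uP j; split=> //.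
    apply: le_trans ujd _; rewrite lerD2l lef_pV2 ?posrE ?ltr0n//.
    by rewrite ler_nat.
  exists (A, A) => //= -[x y] /= [[x1 xd] [y1 yd]].
  rewrite -ball_normE /= rnormE ltcR -(@ltr_pXn2r _ 2) ?nnegrE ?rnorm_ge0//;
    last exact: ltW.
  have e0 : 0 <= k.+1%:R^-1 :> R by [].
  apply: le_lt_trans (uv _ _ _ x1 y1 e0 xd yd) _.
  have := kP k (leqnn k); rewrite ltr_pdivlMr//= => /le_lt_trans; apply.
  have e1 : k.+1%:R^-1 <= 1 :> R by rewrite invf_le1 ?ltr0n// ler1n.
  set t := k.+1%:R^-1 in e0 e1 *.
  by have := mulr_ge0 e0 (etrans (subr_ge0 _ _) e1 : 0 <= 1 - t); lra.
have near_z (e : R) : 0 < e -> exists k, rnorm (z - u k) < e /\ k.+1%:R^-1 < e.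
  move=> e0.
  have e0C : 0 < e%:C by rewrite ltcR.
  have [k1 _ k1P] := (cvgrPdist_lt _ _).1 uz _ e0C.
  have [k2 _ k2P] := inv0 _ e0.
  exists (maxn k1 k2); split; last by apply: k2P; rewrite /= leq_maxr.
  by rewrite -ltcR -rnormE; apply: k1P; rewrite /= leq_maxl.
have z1 : phi z = 1.
  apply/eqP; rewrite -subr_eq0 -normr_le0; apply/ler_addgt0Pr => e /gt0C[r0 <-].
  have M0 : 0 < `|M| + 1 by rewrite ltr_wpDl.
  have [k [zk _]] := near_z _ (divr_gt0 r0 M0).
  have [uk1 _] := uP k.
  rewrite add0r -uk1 -phiN -phiD (le_trans (phiM _))// rnormE -rmorphM lecR.
  move: zk; rewrite ltr_pdivlMr//; have := rnorm_ge0 (z - u k).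
  by have := ler_norm M; nra.
have zd : rnorm z = d.
  apply/le_anti; rewrite d_le// andbT; apply/ler_addgt0Pr => e e0.
  have [k [zk ke]] := near_z _ (divr_gt0 e0 (ltr0n R 2)).
  have [_ uk] := uP k; have := rnormD (z - u k) (u k).
  rewrite subrK; set t := k.+1%:R^-1 in ke uk; lra.
have ker_z w : phi w = 0 -> hdot w z = 0.
  move=> w0; have [->|wN0] := eqVneq w 0; first by rewrite linear0l.
  have ww : 0 < hdot w w by rewrite dnorm_gt0.
  pose t := - (hdot z w / hdot w w).
  have : d <= rnorm (z + t *: w) by apply: d_le; rewrite phiD phiZ w0 mulr0 addr0.
  rewrite -zd -(@ler_pXn2r _ 2) ?nnegrE ?rnorm_ge0// -lecR !rnorm_sqr.
  rewrite dnormD dnormZ linearZr_LR /=.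
  have cR : hdot w w \is Num.real by rewrite gtr0_real.
  set b := hdot z w; set c := hdot w w in ww cR t *.
  have tb : t^* * b = - (`|b| ^+ 2 / c).
    by rewrite /t rmorphN rmorphM /= fmorphV /= (conj_Creal cR) normCK -/b; ring.
  have t2 : `|t| ^+ 2 * c = `|b| ^+ 2 / c.
    rewrite /t normrN normrM normfV (gtr0_norm ww) exprMn exprVn -/b.
    by rewrite -mulrA [c ^+ 2]expr2 invfM divfK// gt_eqF.
  have q0 : 0 <= `|b| ^+ 2 / c by rewrite divr_ge0 ?exprn_ge0// ltW.
  rewrite tb t2 rmorphN /= (conj_Creal (ger0_real q0)) -addrA lerDl.
  rewrite addrA subrr add0r oppr_ge0 => qle0.
  have /eqP : `|b| ^+ 2 / c = 0 by apply/le_anti; rewrite qle0.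
  rewrite mulf_eq0 invr_eq0 (gt_eqF ww) orbF sqrf_eq0 normr_eq0 => /eqP b0.
  by rewrite hdotC -/b b0 rmorph0.
have zN0 : z != 0.
  by apply/eqP => zE; move: z1; rewrite zE phi0 => /esym/eqP; rewrite oner_eq0.
have zz : 0 < hdot z z by rewrite dnorm_gt0.
exists ((hdot z z)^-1 *: z) => x.
have /eqP : hdot (x - phi x *: z) z = 0.
  by apply: ker_z; rewrite phiD phiN phiZ z1 mulr1 subrr.
rewrite linearBl linearZl_LR /= subr_eq0 linearZr_LR /= fmorphV /= => /eqP ->.
by rewrite (conj_Creal (gtr0_real zz)) mulrCA mulVf ?mulr1// gt_eqF.
Qed.

End HilbertTheory.

Section BoundedOperators.
Context {R : realType}.
Implicit Types H K L : hilbertType R.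

Record bop H K := Bop {
  bop_fun :> H -> K ;
  bop_linear : linear bop_fun ;
  bop_bounded : exists M : R, forall x, rnorm (bop_fun x) <= M * rnorm x
}.

HB.instance Definition _ H K (A : bop H K) :=
  GRing.isLinear.Build R[i] H K *:%R (bop_fun A) (bop_linear A).

Lemma bop_ext H K (A B : bop H K) : A =1 B -> A = B.
Proof.
case: A B => [A lA bA] [B lB bB] /= /funext AB; rewrite AB in lA bA *.
by congr Bop; apply: Prop_irrelevance.
Qed.

Lemma bop_bounded_ge0 H K (A : bop H K) :
  exists2 M : R, 0 <= M & forall x, rnorm (A x) <= M * rnorm x.
Proof.
have [M AM] := bop_bounded A; exists `|M| => // x.
by rewrite (le_trans (AM x))// ler_wpM2r ?rnorm_ge0 ?ler_norm.
Qed.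

Fact bid_linear H : linear (@id H). Proof. by []. Qed.
Fact bid_bounded H : exists M : R, forall x : H, rnorm x <= M * rnorm x.
Proof. by exists 1 => x; rewrite mul1r. Qed.
Definition bid H : bop H H := Bop (@bid_linear H) (@bid_bounded H).

Fact bzero_linear H K : linear (fun _ : H => 0 : K).
Proof. by move=> a x y; rewrite scaler0 addr0. Qed.
Fact bzero_bounded H K :
  exists M : R, forall x : H, rnorm (0 : K) <= M * rnorm x.
Proof. by exists 0 => x; rewrite rnorm0 mul0r. Qed.
Definition bzero H K : bop H K :=
  Bop (@bzero_linear H K) (@bzero_bounded H K).

Fact badd_linear H K (A B : bop H K) : linear (fun x => A x + B x).
Proof. by move=> a x y; rewrite !linearP scalerDr addrACA. Qed.
Fact badd_bounded H K (A B : bop H K) :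
  exists M : R, forall x, rnorm (A x + B x) <= M * rnorm x.
Proof.
have [[M AM] [N BN]] := (bop_bounded A, bop_bounded B).
by exists (M + N) => x; rewrite mulrDl (le_trans (rnormD _ _)) ?lerD.
Qed.
Definition badd H K (A B : bop H K) : bop H K :=
  Bop (badd_linear A B) (badd_bounded A B).

Fact bscale_linear H K (a : R[i]) (A : bop H K) : linear (fun x => a *: A x).
Proof.
by move=> b x y; rewrite linearP scalerDr !scalerA (mulrC a b).
Qed.
Fact bscale_bounded H K (a : R[i]) (A : bop H K) :
  exists M : R, forall x, rnorm (a *: A x) <= M * rnorm x.
Proof.
have [M AM] := bop_bounded A; exists (complex.Re `|a| * M) => x.
rewrite rnormZ -mulrA ler_wpM2l//.
exact: (@rnorm_ge0 R R[i]^o a).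
Qed.
Definition bscale H K (a : R[i]) (A : bop H K) : bop H K :=
  Bop (bscale_linear a A) (bscale_bounded a A).

Fact bcomp_linear H K L (A : bop K L) (B : bop H K) :
  linear (fun x => A (B x)).
Proof. by move=> a x y /=; rewrite !linearP. Qed.
Fact bcomp_bounded H K L (A : bop K L) (B : bop H K) :
  exists M : R, forall x, rnorm (A (B x)) <= M * rnorm x.
Proof.
have [[M M0 AM] [N BN]] := (bop_bounded_ge0 A, bop_bounded B).
exists (M * N) => x; apply: le_trans (AM _) _.
by rewrite -mulrA ler_wpM2l.
Qed.
Definition bcomp H K L (A : bop K L) (B : bop H K) : bop H L :=
  Bop (bcomp_linear A B) (bcomp_bounded A B).

Definition is_adjoint H K (A : bop H K) (B : bop K H) : Prop :=
  forall x y, hdot (A x) y = hdot x (B y).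

Lemma adjoint_exists H K (A : bop H K) : exists B, is_adjoint A B.
Proof.
have [M M0 AM] := bop_bounded_ge0 A.
have AMc x : `|A x| <= M%:C * `|x| by rewrite !rnormE -rmorphM lecR.
have /choice[B AB] (y : K) : exists z, forall x, hdot (A x) y = hdot x z.
  apply: (@riesz _ _ _ (M * rnorm y)) => [a x1 x2|x].
    by rewrite linearP linearDl linearZl_LR.
  rewrite (le_trans (cauchy_schwarz _ _))// rmorphM /= -rnormE mulrAC.
  by rewrite ler_wpM2r.
have Blin : linear B.
  move=> a y1 y2; apply: hdot_inj => x.
  by rewrite -AB !linearDr !linearZr_LR /= !AB.
have Bbnd : exists N : R, forall y, rnorm (B y) <= N * rnorm y.
  exists M => y; have [->|By0] := eqVneq (B y) 0.
    by rewrite rnorm0 mulr_ge0 ?rnorm_ge0.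
  have : hdot (B y) (B y) <= M%:C * `|B y| * `|y|.
    have BB0 : 0 <= hdot (B y) (B y) by [].
    rewrite -(ger0_norm BB0) -AB (le_trans (cauchy_schwarz _ _))//.
    by rewrite ler_wpM2r.
  rewrite hdotxx expr2 mulrAC ler_pM2r ?normr_gt0//.
  by rewrite !rnormE -rmorphM lecR.
by exists (Bop Blin Bbnd) => x y; rewrite AB.
Qed.

Definition adj H K (A : bop H K) : bop K H := sval (cid (adjoint_exists A)).

Lemma adjP H K (A : bop H K) x y : hdot (A x) y = hdot x (adj A y).
Proof. by rewrite /adj; case: cid. Qed.

Definition opnorm H K (A : H -> K) : R :=
  sup [set rnorm (A x) | x in [set x : H | rnorm x <= 1]].

End BoundedOperators.

Section Series.
Context {R : realType} {n : nat}.

Definition word := seq 'I_n.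

(* The formal power series with coefficient [a alpha] at [Z_alpha]. *)
Definition fps := word -> R[i].

Implicit Types (a p q c s : fps) (f g : 'I_n -> fps).

Definition pone : fps := fun w => (w == [::])%:R.
Definition pvar (i : 'I_n) : fps := fun w => (w == [:: i])%:R.
Definition pmul p q : fps :=
  fun w => \sum_(i < (size w).+1) p (take i w) * q (drop i w).
Definition pword f (w : word) : fps :=
  foldr (fun i s => pmul (f i) s) pone w.

Definition is_poly a := exists N, forall w : word, (N <= size w)%N -> a w = 0.

Definition wsum (V : nmodType) (N : nat) (F : word -> V) : V :=
  \sum_(k < N) \sum_(w : k.-tuple 'I_n) F w.

(* [s] is the formal series [sum_alpha c_alpha f_alpha], coefficient by
   coefficient. The partial sums at each word are eventually constant when [c]
   is a polynomial and when every [f i] has constant term zero, the only two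
   cases in which this is used. *)
Definition formal_sum f c s :=
  forall w, \forall N \near \oo, wsum N (fun u => c u * pword f u w) = s w.

Definition sqnorm a (k : nat) : R :=
  \sum_(w : k.-tuple 'I_n) complex.Re `|a w| ^+ 2.

Definition square_summable a :=
  exists M : R, forall N, \sum_(k < N) sqnorm a k <= M.

(* The reciprocal of the radius of convergence. *)
Definition inv_radius a : \bar R :=
  limn_esup (fun k => (sqnorm a k `^ ((2 * k)%:R^-1))%:E).

Definition free_holomorphic (gamma : R) a := (inv_radius a <= (gamma^-1)%:E)%E.

Definition jacobian0 f : 'M[R[i]]_n := \matrix_(i, j) f i [:: j].

Definition pscale (r : R) f : 'I_n -> fps := fun i w => r%:C * f i w.

End Series.
Arguments word n : clear implicits.
Arguments fps R n : clear implicits.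

Section Evaluation.
Context {R : realType} {n : nat}.
Implicit Types (H : hilbertType R) (a : fps R n) (f : 'I_n -> fps R n).

Definition opword H (Y : 'I_n -> bop H H) (w : word n) (x : H) : H :=
  foldr (fun i => Y i) x w.

Definition psum H a (Y : 'I_n -> bop H H) (N : nat) (x : H) : H :=
  wsum N (fun w => a w *: opword Y w x).

Definition norm_eval H a (Y : 'I_n -> bop H H) (B : bop H H) :=
  opnorm (fun x => psum a Y N x - B x) @[N --> \oo] --> (0 : R).

Definition sot_eval H a (Y : 'I_n -> bop H H) (B : bop H H) :=
  forall x, psum a Y N x @[N --> \oo] --> B x.

Definition scale_tuple H (r : R) (Y : 'I_n -> bop H H) : 'I_n -> bop H H :=
  fun i => bscale r%:C (Y i).

Definition rad_eval H a (Y : 'I_n -> bop H H) (B : bop H H) :=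
  exists (delta : R) (P : R -> bop H H), [/\ 0 < delta < 1,
    forall r, delta < r < 1 -> norm_eval a (scale_tuple r Y) (P r) &
    forall x, P r x @[r --> (1 : R)^'-] --> B x].

(* [Y] is in [C_f^SOT] or in [C_f^rad], and [W] is [f(Y)]. By Abel's theorem the
   two readings of [f(Y)] agree when both apply. *)
Definition tuple_eval H f (Y W : 'I_n -> bop H H) :=
  (forall i, sot_eval (f i) Y (W i)) \/ (forall i, rad_eval (f i) Y (W i)).

Definition row_norm H (W : 'I_n -> bop H H) : R :=
  sup [set rnorm (\sum_i W i (x i)) |
       x in [set x : 'I_n -> H | Num.sqrt (\sum_i rnorm (x i) ^+ 2) <= 1]].

Definition opball H (r : R) (X : 'I_n -> bop H H) :=
  Num.sqrt (opnorm (fun x => \sum_i X i (adj (X i) x))) < r.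

Definition infinite_dim H :=
  forall (m : nat) (v : 'I_m -> H),
  exists x, forall c : 'I_m -> R[i], x <> \sum_j c j *: v j.

Definition orthonormal_basis H (e : word n -> H) :=
  (forall u v, hdot (e u) (e v) = (u == v)%:R) /\
  (forall x, wsum N (fun w => hdot x (e w) *: e w) @[N --> \oo] --> x).

Definition coord H (e : word n -> H) (x : H) : fps R n :=
  fun w => hdot x (e w).

End Evaluation.

Section ModelProperty.
Context {R : realType} {n : nat}.
Implicit Types (f g : 'I_n -> fps R n) (c d p s : fps R n).
Implicit Types (E H K : hilbertType R).

(* Polynomial automorphisms, formal power series vanishing at 0, and free
   holomorphic functions on the ball of radius [gamma]. *)
Variant model_case := PolyAut | Formal | Holo of R.

Definition admissible (k : model_case) f : Prop :=
  match k with
  | PolyAut => (forall i, is_poly (f i)) /\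
      exists q : 'I_n -> fps R n, (forall i, is_poly (q i)) /\
        forall i, formal_sum q (f i) (pvar i) /\ formal_sum f (q i) (pvar i)
  | Formal => [/\ forall i, f i [::] = 0,
      forall i, (inv_radius (f i) < +oo)%E & \det (jacobian0 f) != 0]
  | Holo gamma => [/\ 0 < gamma, forall i, free_holomorphic gamma (f i),
      forall E (X : 'I_n -> bop E E), infinite_dim E -> opball gamma X ->
        exists2 W, forall i, norm_eval (f i) X (W i) & opball 1 W &
      forall G : fps R n, free_holomorphic 1 G ->
        (forall E (X W : 'I_n -> bop E E), infinite_dim E -> opball gamma X ->
           (forall i, norm_eval (f i) X (W i)) -> norm_eval G W (bzero E E)) ->
        forall w, G w = 0]
  end.

(* [p = sum_alpha c_alpha f_alpha] in H^2(f). Under [PolyAut], H^2(f) is the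
   completion of the span of the f_alpha, which is the space of polynomials;
   only this dense subspace is described. *)
Definition H2_sum (k : model_case) f c p : Prop :=
  match k with
  | PolyAut => is_poly c /\ formal_sum f c p
  | Formal => square_summable c /\ formal_sum f c p
  | Holo gamma => square_summable c /\
      forall E (X W : 'I_n -> bop E E), infinite_dim E -> opball gamma X ->
        (forall i, norm_eval (f i) X (W i)) ->
        exists2 P, norm_eval p X P & norm_eval c W P
  end.

(* [p * (sum_alpha c_alpha f_alpha) = sum_alpha d_alpha f_alpha] in H^2(f). *)
Definition H2_mul (k : model_case) f p c d : Prop :=
  match k with
  | PolyAut | Formal => exists2 s, H2_sum k f c s & H2_sum k f d (pmul p s)
  | Holo gamma =>
      forall E (X W : 'I_n -> bop E E), infinite_dim E -> opball gamma X ->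
        (forall i, norm_eval (f i) X (W i)) ->
        exists P B, [/\ norm_eval p X P, norm_eval c W B &
                        norm_eval d W (bcomp P B)]
  end.

(* The Hilbert space H^2(f) is [E], with [e w] in the role of [f_w]. A bounded
   operator is multiplication by [p] under [PolyAut] when it is so on the dense
   subspace of polynomials. *)
Definition mul_op E (k : model_case) f (e : word n -> E) p (A : bop E E) :=
  forall x, (if k is PolyAut then is_poly (coord e x) else True) ->
    H2_mul k f p (coord e x) (coord e (A x)).

Definition universal_model E f (e : word n -> E) (MZ : 'I_n -> bop E E) :=
  orthonormal_basis e /\
  exists k, [/\ admissible k f, forall i, mul_op k f e (pvar i) (MZ i) &
    if k is PolyAut then True else
      (exists g, forall i, H2_sum k f (g i) (pvar i)) /\
      exists2 W, tuple_eval f MZ W & forall j, mul_op k f e (f j) (W j)].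

Definition model_property f :=
  exists E (e : word n -> E) (MZ : 'I_n -> bop E E), universal_model f e MZ.

Definition norm_model_property f :=
  exists E (e : word n -> E) (MZ W : 'I_n -> bop E E),
  [/\ universal_model f e MZ, tuple_eval f MZ W &
    (forall i, norm_eval (f i) MZ (W i)) \/
    (exists (delta : R) (P : 'I_n -> R -> bop E E), [/\ 0 < delta < 1,
       forall i r, delta < r < 1 -> norm_eval (f i) (scale_tuple r MZ) (P i r) &
       forall i, opnorm (fun x => P i r x - W i x) @[r --> (1 : R)^'-]
         --> (0 : R)])].

Definition radial_approximation f :=
  exists2 delta : R, 0 < delta < 1 &
    forall r, delta < r <= 1 -> model_property (pscale r f).

Definition inverse_series f g :=
  exists2 k, admissible k f & forall i, H2_sum k f (g i) (pvar i).

Definition in_domain H f (X : 'I_n -> bop H H) :=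
  exists g W, [/\ inverse_series f g, tuple_eval f X W, row_norm W <= 1 &
                  tuple_eval g W X].

End ModelProperty.

Section Dilations.
Context {R : realType} {n : nat}.
Implicit Types (f : 'I_n -> fps R n) (E H K : hilbertType R).

Inductive cstar_generated E (M : 'I_n -> bop E E) : bop E E -> Prop :=
| Cstar_gen i : cstar_generated M (M i)
| Cstar_id : cstar_generated M (bid E)
| Cstar_add A B : cstar_generated M A -> cstar_generated M B ->
    cstar_generated M (badd A B)
| Cstar_scale (z : R[i]) A : cstar_generated M A ->
    cstar_generated M (bscale z A)
| Cstar_comp A B : cstar_generated M A -> cstar_generated M B ->
    cstar_generated M (bcomp A B)
| Cstar_adj A : cstar_generated M A -> cstar_generated M (adj A)
| Cstar_lim (u : nat -> bop E E) (A : bop E E) : (forall k, cstar_generated M (u k)) ->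
    opnorm (fun x => u k x - A x) @[k --> \oo] --> (0 : R) ->
    cstar_generated M A.

(* Only the values of [pi] on [C] matter. *)
Record unital_star_rep E K (C : bop E E -> Prop) (pi : bop E E -> bop K K) :
    Prop := {
  rep_id : pi (bid E) = bid K ;
  rep_add A B : C A -> C B -> pi (badd A B) = badd (pi A) (pi B) ;
  rep_scale (z : R[i]) A : C A -> pi (bscale z A) = bscale z (pi A) ;
  rep_comp A B : C A -> C B -> pi (bcomp A B) = bcomp (pi A) (pi B) ;
  rep_adj A : C A -> pi (adj A) = adj (pi A)
}.

(* [J] is the inclusion of [H] in [K]. *)
Record is_dilation H K f (J : bop H K) (T : 'I_n -> bop H H)
    (V : 'I_n -> bop K K) : Prop := {
  dilation_incl : forall x, `|J x| = `|x| ;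
  dilation_domain : in_domain f V ;
  dilation_rep : exists E (e : word n -> E) (MZ : 'I_n -> bop E E)
      (pi : bop E E -> bop K K),
    [/\ universal_model f e MZ, unital_star_rep (cstar_generated MZ) pi &
        forall i, pi (MZ i) = V i] ;
  dilation_adj : forall i x, adj (V i) (J x) = J (adj (T i) x)
}.

End Dilations.

(* Main.v *)
Require Import Defs.
From HB Require Import structures.
From mathcomp Require Import all_boot all_order all_algebra.
From mathcomp Require Import complex.
From mathcomp Require Import boolp classical_sets reals ereal topology.
From mathcomp Require Import normedtype sequences exp.
From mathcomp Require Import ring lra.

Set Implicit Arguments.
Unset Strict Implicit.
Unset Printing Implicit Defensive.

Import Order.TTheory GRing.Theory Num.Theory.
Import numFieldNormedType.Exports.

(** The theorem reduces to a commutant lifting theorem for row isometries.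

    Let [V] be a dilation of [T], with representation [pi] of the C*-algebra of
    the universal model [M_Z]. In the orthonormal basis [f_w] of the model,
    [f_j(M_Z)] is the left creation operator [f_w -> f_(j w)] ([model_shift]), so
    [f(M_Z)] is a row isometry. The norm convergence of [f_j(M_Z)], possibly
    through radial means, puts it in the C*-algebra and lets [pi], which is
    contractive ([star_rep_contractive]), be applied term by term. Hence
    [W = f(V)] is a row isometry too, and [V = g(W)] because [V] is in the domain
    ([dilation_row_isometry]). The same holds for [V'] and [W'].

    The subspace [H] is coinvariant under [V], hence under [W], whose compression
    to [H] is [A = f(T)]; likewise [A' = f(T')] for [W']. Since [X T_i = T'_i X],
    also [X A_i = A'_i X], and the operator [X J^*] from [K] to [H']
    intertwines [W] and [A']. It suffices to lift it to an operator [Y] from [K]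
    to [K'] of the same norm with [Y W_i = W'_i Y] and [J'^* Y = X J^*]: the
    relation [Y V_i = V'_i Y] follows on applying [g].

    The lifting ([commutant_lifting]) iterates a matrix completion step
    ([lifting_step]): a contraction [Y_m] with the right compression yields a
    contraction [Y_(m+1)] with the right compression and
    [Y_(m+1) W_i = W'_i Y_m]. The conditions are convex and the relations linear, so
    that the averages of [Y_0, ..., Y_N] have the right compression and intertwine up
    to an error of order [1/N]; a weak limit point of the averages is the desired
    operator.

    Two ambiguities have to be removed. The value of a power series at operators
    is either a strong limit of partial sums or a strong limit of radial means;
    by Abel's theorem both are instances of [abel_eval], which determines the
    value and is preserved by intertwining operators. Moreover [f] may satisfy
    several of the three conditions that define H^2(f), and the models and
    inverse series attached to [V] and [V'] may come from different ones. The
    inverse series is nevertheless unique ([inverse_series_unique]), and it gives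
    the matrix of [M_Z] in the basis [f_w], so that all models are unitarily
    equivalent ([model_rep_transfer]). *)

Local Open Scope classical_set_scope.
Local Open Scope complex_scope.
Local Open Scope ring_scope.
Local Notation coord := Defs.coord.

(** * Real-valued norms and limits *)

Section RealNorm.
Context {R : realType}.
Implicit Types V : normedModType R[i].

Lemma rnorm_eq0 V (x : V) : rnorm x = 0 -> x = 0.
Proof. by move=> x0; apply/eqP; rewrite -normr_eq0 rnormE x0. Qed.

Lemma rnormN V (x : V) : rnorm (- x) = rnorm x.
Proof. by rewrite /rnorm normrN. Qed.

Lemma rnorm_dist V (x y : V) : rnorm (x - y) = rnorm (y - x).
Proof. by rewrite /rnorm distrC. Qed.

Lemma rnormB V (x y : V) : rnorm (x - y) <= rnorm x + rnorm y.
Proof. by rewrite -(rnormN y) rnormD. Qed.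

Lemma rnorm_triangle V (y x z : V) :
  rnorm (x - z) <= rnorm (x - y) + rnorm (y - z).
Proof. by rewrite -[x in leLHS](subrK y) -addrA rnormD. Qed.

Lemma rnorm_sum V (I : Type) (s : seq I) (P : pred I) (F : I -> V) :
  rnorm (\sum_(i <- s | P i) F i) <= \sum_(i <- s | P i) rnorm (F i).
Proof.
elim/big_rec2: _ => [|i a b _ le]; first by rewrite rnorm0.
by rewrite (le_trans (rnormD _ _))// lerD2l.
Qed.

Lemma Re_normC (a : R) : complex.Re `|a%:C| = `|a|.
Proof. by rewrite normc_def /= expr0n addr0 sqrtr_sqr. Qed.

Lemma rnormZr V (a : R) (x : V) : rnorm (a%:C *: x) = `|a| * rnorm x.
Proof. by rewrite rnormZ Re_normC. Qed.

Lemma rnorm_small V (x : V) : (forall e : R, 0 < e -> rnorm x <= e) -> x = 0.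
Proof.
move=> xe; apply: rnorm_eq0; apply/le_anti; rewrite rnorm_ge0 andbT.
by apply/ler_addgt0Pr => e /xe; rewrite add0r.
Qed.

Lemma gt0C (e : R[i]) : 0 < e -> exists2 r : R, 0 < r & e = r%:C.
Proof.
move=> e0; have eE := RRe_real (gtr0_real e0).
by exists (complex.Re e); rewrite ?eE// -ltcR eE.
Qed.

Lemma rcvgP (T : Type) (F : set_system T) {FF : Filter F} V (u : T -> V) l :
  u @ F --> l <->
  forall e : R, 0 < e -> \forall x \near F, rnorm (l - u x) < e.
Proof.
split=> [/cvgrPdist_lt ul e e0|ul].
  have := ul e%:C; rewrite ltcR => /(_ e0); apply: filterS => x.
  by rewrite rnormE ltcR.
apply/cvgrPdist_lt => _ /gt0C[e e0 ->].
by apply: filterS (ul e e0) => x; rewrite rnormE ltcR.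
Qed.

Lemma rnorm_cvg_le (T : Type) (F : set_system T) {FF : ProperFilter F} V
    (u : T -> V) l (M : R) :
  u @ F --> l -> (\forall x \near F, rnorm (u x) <= M) -> rnorm l <= M.
Proof.
move=> /rcvgP ul uM; apply/ler_addgt0Pr => e e0.
have [x [ux xM]] := @filter_ex _ F _ _ (filterI (ul e e0) uM).
by have := rnormD (l - u x) (u x); rewrite subrK; lra.
Qed.

Lemma cauchy_rcvg (V : completeNormedModType R[i]) (u : nat -> V) :
  (forall e : R, 0 < e -> exists N, forall m k, (N <= m)%N -> (N <= k)%N ->
     rnorm (u m - u k) < e) ->
  exists l : V, u @ \oo --> l.
Proof.
move=> uC; suff /cauchy_cvgP/cvg_ex[l ul] : cauchy (u @ \oo) by exists l.
apply/cauchy_ballP => _ /gt0C[e e0 ->]; have [N NP] := uC e e0.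
exists ([set u k | k in [set k | (N <= k)%N]],
        [set u k | k in [set k | (N <= k)%N]]).
  by split; exists N => // k /= Nk; exists k.
move=> [_ _] [[m /= Nm <-] [k /= Nk <-]].
by rewrite -ball_normE /= rnormE ltcR NP.
Qed.

Lemma geometric_rcvg (V : completeNormedModType R[i]) (u : nat -> V) (C q : R) :
  0 <= q < 1 -> (forall k, rnorm (u k.+1 - u k) <= C * q ^+ k) ->
  exists l : V, u @ \oo --> l.
Proof.
move=> /andP[q0 q1] uq.
have C0 : 0 <= C by have := uq 0; rewrite expr0 mulr1; exact/le_trans/rnorm_ge0.
have tail m k : rnorm (u (m + k)%N - u m) <= C / (1 - q) * (q ^+ m - q ^+ (m + k)).
  elim: k => [|k IH]; first by rewrite addn0 !subrr rnorm0 mulr0.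
  rewrite addnS; have := rnorm_triangle (u (m + k)%N) (u (m + k).+1) (u m).
  move=> /le_trans; apply; rewrite (le_trans (lerD (uq _) IH))//.
  rewrite [q ^+ (m + k).+1]exprS le_eqVlt; apply/orP; left; apply/eqP; field.
  by rewrite subr_eq0 eq_sym lt_eqF.
apply: cauchy_rcvg => e e0.
have q1' : 0 < 1 - q by rewrite subr_gt0.
have D0 : 0 <= C / (1 - q) by rewrite divr_ge0// ltW.
have : geometric (2 * (C / (1 - q))) q @ \oo --> (0 : R).
  by apply: cvg_geometric; rewrite ger0_norm.
move=> /cvgrPdist_lt/(_ e e0)[N _ NP]; exists N => m k Nm Nk.
have tailN m' : (N <= m')%N -> rnorm (u m' - u N) <= C / (1 - q) * q ^+ N.
  move=> Nm'; rewrite -(subnKC Nm'); apply: le_trans (tail _ _) _.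
  by rewrite ler_wpM2l// gerBl exprn_ge0.
have := NP N (leqnn N); rewrite /= sub0r normrN ger0_norm; last first.
  by apply: mulr_ge0; [apply: mulr_ge0|apply: exprn_ge0].
apply: le_lt_trans; apply: le_trans (rnorm_triangle (u N) _ _) _.
by rewrite [X in _ + X <= _]rnorm_dist -mulrA mulr_natl mulr2n lerD ?tailN.
Qed.

Lemma rcvg_unique (T : Type) (F : set_system T) {FF : ProperFilter F} V
    (u : T -> V) (x y : V) : u @ F --> x -> u @ F --> y -> x = y.
Proof.
move=> ux uy; apply/eqP; rewrite -subr_eq0; apply/eqP.
have : (fun t => u t - u t) @ F --> x - y by apply: cvgB.
under eq_fun do rewrite subrr.
by move=> c; apply: rnorm_eq0; apply/le_anti; rewrite rnorm_ge0 andbT;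
  apply: rnorm_cvg_le c _; apply: nearW => t; rewrite rnorm0.
Qed.

End RealNorm.

(** * Bounded operators *)

Section Operators.
Context {R : realType}.
Implicit Types H K L : hilbertType R.

Lemma rnorm2E H (x : H) : rnorm x ^+ 2 = complex.Re (hdot x x).
Proof. by rewrite -rnorm_sqr. Qed.

Lemma Re_hdot_le H (x y : H) : complex.Re (hdot x y) <= rnorm x * rnorm y.
Proof.
rewrite -lecR rmorphM /= -!rnormE; apply: le_trans (cauchy_schwarz x y).
rewrite normc_def lecR; case: (hdot x y) => a b /=.
by rewrite (le_trans (ler_norm a))// -sqrtr_sqr ler_sqrt ?addr_ge0 ?sqr_ge0// lerDl sqr_ge0.
Qed.

Lemma rnorm_sub_sqr H (x y : H) :
  rnorm (x - y) ^+ 2 =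
  rnorm x ^+ 2 + rnorm y ^+ 2 - 2 * complex.Re (hdot x y).
Proof.
rewrite !rnorm2E linearBl !linearBr /= (hdotC y x).
by case: (hdot x y) (hdot x x) (hdot y y) => [a b] [c d] [h k] /=; ring.
Qed.

Lemma Re_hdotZr H (r : R) (x y : H) :
  complex.Re (hdot x (r%:C *: y)) = r * complex.Re (hdot x y).
Proof. by rewrite linearZr_LR /=; case: (hdot x y) => a b /=; ring. Qed.

Lemma hdot_injl H (y z : H) : (forall x, hdot y x = hdot z x) -> y = z.
Proof. by move=> yz; apply: hdot_inj => x; rewrite hdotC yz -hdotC. Qed.

Lemma adjPr H K (A : bop H K) x y : hdot (adj A x) y = hdot x (A y).
Proof. by rewrite hdotC -adjP -hdotC. Qed.

Lemma adj_unique H K (A : bop H K) (B : bop K H) :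
  is_adjoint A B -> adj A = B.
Proof.
by move=> AB; apply: bop_ext => y; apply: hdot_inj => x; rewrite -adjP AB.
Qed.

(** By polarization an isometry preserves inner products. *)
Lemma isometryP H K (J : bop H K) :
  (forall x, `|J x| = `|x|) -> forall x, adj J (J x) = x.
Proof.
move=> Jn; have Jq x : hdot (J x) (J x) = hdot x x by rewrite !hdotxx Jn.
have JJ x y : hdot (J x) (J y) = hdot x y.
  have ReJ u v : complex.Re (hdot (J u) (J v)) = complex.Re (hdot u v).
    have := Jq (u + v); rewrite [J (u + v)]linearD !linearDl !linearDr /= !Jq.
    rewrite (hdotC (J v) (J u)) (hdotC v u) => /(congr1 (@complex.Re R)).
    case: (hdot (J u) (J v)) (hdot u v) (hdot u u) (hdot v v).
    by move=> ? ? [? ?] [? ?] [? ?] /=; lra.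
  have := ReJ x y; have := ReJ ('i%C *: x) y; rewrite [J ('i%C *: x)]linearZ !linearZl_LR /=.
  case: (hdot (J x) (J y)) (hdot x y) => a b [c d] /=.
  by move=> h1 h2; congr (_ +i* _)%C; lra.
by move=> x; apply: hdot_inj => y; rewrite -adjP JJ.
Qed.

Lemma bop0 H K (A : bop H K) : A 0 = 0.
Proof. exact: linear0. Qed.

Lemma bopD H K (A : bop H K) x y : A (x + y) = A x + A y.
Proof. exact: linearD. Qed.

Lemma bopB H K (A : bop H K) x y : A (x - y) = A x - A y.
Proof. exact: linearB. Qed.

Lemma bopZ H K (A : bop H K) a x : A (a *: x) = a *: A x.
Proof. exact: linearZ. Qed.

Lemma bop_sum H K (A : bop H K) (I : Type) (s : seq I) (P : pred I) (F : I -> H) :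
  A (\sum_(i <- s | P i) F i) = \sum_(i <- s | P i) A (F i).
Proof. exact: linear_sum. Qed.

Lemma bop_cvg (T : Type) (F : set_system T) {FF : Filter F} H K (A : bop H K)
    (u : T -> H) x : u @ F --> x -> (fun t => A (u t)) @ F --> A x.
Proof.
have [M M0 AM] := bop_bounded_ge0 A.
move=> /rcvgP ux; apply/rcvgP => e e0.
have M1 : 0 < M + 1 by rewrite ltr_wpDl.
apply: filterS (ux _ (divr_gt0 e0 M1)) => t; rewrite ltr_pdivlMr// => xt.
rewrite -linearB; apply: le_lt_trans (AM _) _; apply: le_lt_trans xt.
by rewrite mulrC ler_wpM2l ?rnorm_ge0// lerDl.
Qed.

Definition bounded_by H K (M : R) (A : H -> K) :=
  forall x, rnorm (A x) <= M * rnorm x.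

Definition homogeneous H K (A : H -> K) :=
  forall (a : R[i]) x, A (a *: x) = a *: A x.

Lemma opnorm_le H K (A : H -> K) (M : R) :
  0 <= M -> bounded_by M A -> opnorm A <= M.
Proof.
move=> M0 AM; apply: ge_sup => [|_ [x /= x1 <-]].
  by exists (rnorm (A 0)), 0 => //=; rewrite rnorm0.
by rewrite (le_trans (AM x))// ler_piMr.
Qed.

Lemma opnorm_bound H K (A : H -> K) (M : R) :
  homogeneous A -> bounded_by M A -> bounded_by (opnorm A) A.
Proof.
move=> Ah AM x.
have [->|x0] := eqVneq x 0.
  by rewrite rnorm0 mulr0 -[0 in leLHS](scale0r 0) Ah scale0r rnorm0.
have rx : 0 < rnorm x.
  by rewrite lt_neqAle rnorm_ge0 andbT eq_sym; apply/eqP => /rnorm_eq0/eqP; rewrite (negbTE x0).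
rewrite -ler_pdivrMr//; apply: ub_le_sup.
  exists `|M| => _ [y /= y1 <-]; apply: le_trans (AM y) _.
  rewrite (le_trans (ler_wpM2r (rnorm_ge0 _) (ler_norm M)))//.
  by rewrite ler_piMr.
exists ((rnorm x)^-1%:C *: x) => /=.
  by rewrite rnormZr ger0_norm ?invr_ge0 ?rnorm_ge0// mulVf ?gt_eqF.
by rewrite Ah rnormZr ger0_norm ?invr_ge0 ?rnorm_ge0// mulrC.
Qed.

Lemma opnorm_ge0 H K (A : H -> K) (M : R) : bounded_by M A -> 0 <= opnorm A.
Proof.
move=> AM; apply: (@le_trans _ _ (rnorm (A 0))); first exact: rnorm_ge0.
apply: ub_le_sup; last by exists 0 => //=; rewrite rnorm0.
exists `|M| => _ [y /= y1 <-]; apply: le_trans (AM y) _.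
rewrite (le_trans (ler_wpM2r (rnorm_ge0 _) (ler_norm M)))//.
by rewrite ler_piMr.
Qed.

Lemma bop_homogeneous H K (A : bop H K) : homogeneous A.
Proof. by move=> a x; rewrite linearZ. Qed.

Lemma bop_opnorm H K (A : bop H K) : bounded_by (opnorm A) A.
Proof.
by have [M AM] := bop_bounded A; apply: (@opnorm_bound _ _ _ M) => //; exact: bop_homogeneous.
Qed.

Lemma bop_opnorm_ge0 H K (A : bop H K) : 0 <= opnorm A.
Proof. by have [M AM] := bop_bounded A; exact: opnorm_ge0 AM. Qed.

Lemma adj_bounded H K (A : bop H K) (M : R) :
  0 <= M -> bounded_by M A -> bounded_by M (adj A).
Proof.
move=> M0 AM y; have [->|y0] := eqVneq (adj A y) 0.
  by rewrite rnorm0 mulr_ge0 ?rnorm_ge0.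
have r0 : 0 < rnorm (adj A y).
  by rewrite lt_neqAle rnorm_ge0 andbT eq_sym; apply/eqP => /rnorm_eq0/eqP; rewrite (negbTE y0).
rewrite -(ler_pM2r r0) -expr2 rnorm2E -adjP mulrAC.
by rewrite (le_trans (Re_hdot_le _ _))// ler_wpM2r ?rnorm_ge0.
Qed.

Definition bsub H K (A B : bop H K) : bop H K := badd A (bscale (-1) B).

Lemma bsubE H K (A B : bop H K) x : bsub A B x = A x - B x.
Proof. by rewrite /= scaleN1r. Qed.

(** Uniform estimates on vectors add up, and pass through representations, more
    directly than operator norms, which are suprema. *)
Lemma opnorm_cvgP (T : Type) (F : set_system T) {FF : Filter F} H K
    (u : T -> bop H K) (B : bop H K) :
  opnorm (fun x => u t x - B x) @[t --> F] --> (0 : R) <->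
  forall e : R, 0 < e -> \forall t \near F, bounded_by e (fun x => u t x - B x).
Proof.
have uE t : (fun x => u t x - B x) = bsub (u t) B by apply/funext => x; rewrite bsubE.
split=> [/cvgrPdist_le h e e0|h]; last apply/cvgrPdist_le => e e0.
  apply: filterS (h e e0) => t; rewrite sub0r normrN => le x.
  rewrite uE in le; rewrite -bsubE; apply: le_trans (bop_opnorm _ x) _.
  by rewrite ler_wpM2r ?rnorm_ge0// (le_trans (ler_norm _)).
apply: filterS (h e e0) => t le; rewrite sub0r normrN uE ger0_norm ?bop_opnorm_ge0//.
by apply: opnorm_le; [exact: ltW|move=> x; rewrite bsubE].
Qed.

Lemma bsum_linear H K (I : Type) (s : seq I) (F : I -> bop H K) :
  linear (fun x => \sum_(i <- s) F i x).
Proof.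
move=> a x y; rewrite scaler_sumr -big_split /=; apply: eq_bigr => i _.
by rewrite linearP.
Qed.
Lemma bsum_bounded H K (I : Type) (s : seq I) (F : I -> bop H K) :
  exists M, bounded_by M (fun x => \sum_(i <- s) F i x).
Proof.
exists (\sum_(i <- s) opnorm (F i)) => x; rewrite mulr_suml.
by rewrite (le_trans (rnorm_sum _ _ _))//; apply: ler_sum => i _; exact: bop_opnorm.
Qed.
Definition bsum H K (I : Type) (s : seq I) (F : I -> bop H K) : bop H K :=
  Bop (bsum_linear s F) (bsum_bounded s F).

End Operators.
Arguments bop_cvg {R T F FF H K} A {u x} _.
Arguments bop_opnorm {R H K} A x.

(** * Geometric series of operators *)

Section Neumann.
Context {R : realType} {H : hilbertType R}.
Implicit Types (T G : bop H H) (c : R).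

Definition bpow T (k : nat) : bop H H := iter k (bcomp T) (bid H).

Definition neumann_sum T (N : nat) : bop H H := bsum (index_iota 0 N) (bpow T).

Lemma neumann_sumS T N x : neumann_sum T N.+1 x = neumann_sum T N x + bpow T N x.
Proof. by rewrite /= big_nat_recr. Qed.

Lemma bpowSr T k x : bpow T k.+1 x = bpow T k (T x).
Proof.
elim: k => [//|k IH].
by rewrite -[LHS]/(T (bpow T k.+1 x)) -[RHS]/(T (bpow T k (T x))) IH.
Qed.

Lemma bpow_bounded T c k : 0 <= c -> bounded_by c T ->
  bounded_by (c ^+ k) (bpow T k).
Proof.
move=> c0 Tc; elim: k => [|k IH] x /=; first by rewrite mul1r.
by rewrite (le_trans (Tc _))// exprS -mulrA ler_wpM2l.
Qed.

(** The remainder after [N] terms of the geometric series is [T ^ N G], which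
    gives the convergence in operator norm that a C*-algebra is closed under. *)
Lemma neumann T c : 0 <= c < 1 -> bounded_by c T ->
  exists G, [/\ forall x, G (x - T x) = x, forall x, G x - T (G x) = x &
    forall e : R, 0 < e ->
      \forall N \near \oo, bounded_by e (fun x => neumann_sum T N x - G x)].
Proof.
move=> /andP[c0 c1] Tc; set u := neumann_sum T.
have d0 : 0 < 1 - c by rewrite subr_gt0.
have /choice[G uG] (x : H) : exists y : H, u N x @[N --> \oo] --> y.
  apply: (@geometric_rcvg _ _ _ (rnorm x) c); first by rewrite c0.
  move=> k; rewrite /u neumann_sumS addrC addKr mulrC; exact: bpow_bounded.
have Glin : linear G.
  move=> a x y; apply: (rcvg_unique (uG _)).
  under eq_fun do rewrite linearP.
  by apply: cvgD (uG y); apply: cvgZl_tmp (uG x).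
have uM N x : rnorm (u N x) <= (1 - c)^-1 * rnorm x.
  have : rnorm (u N x) <= (1 - c ^+ N) / (1 - c) * rnorm x.
    elim: N => [|N IH].
      by rewrite /u/= big_geq// rnorm0 subrr !mul0r.
    rewrite /u neumann_sumS (le_trans (rnormD _ _))//.
    have := lerD IH (bpow_bounded N c0 Tc x); move=> /le_trans; apply.
    rewrite -mulrDl ler_wpM2r ?rnorm_ge0// le_eqVlt; apply/orP; left.
    by apply/eqP; rewrite exprS; field; rewrite gt_eqF.
  move=> /le_trans; apply; rewrite ler_wpM2r ?rnorm_ge0//.
  by rewrite ler_piMl ?invr_ge0 ?(ltW d0)// lerBlDr lerDl exprn_ge0.
have GM : bounded_by (1 - c)^-1 G.
  by move=> x; apply: rnorm_cvg_le (uG x) _; apply: nearW => N.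
have Gbnd : exists M : R, forall x, rnorm (G x) <= M * rnorm x by exists (1 - c)^-1.
pose Gb := Bop Glin Gbnd; exists Gb.
have uS x : u N.+1 x @[N --> \oo] --> G x.
  by have := uG x; rewrite -(cvg_shiftS (fun N => u N x)).
have uSS N x : u N.+1 x = u N x + bpow T N x := neumann_sumS T N x.
have uT N x : u N (T x) = u N.+1 x - x.
  elim: N => [|N IH]; first by rewrite /u /= !big_nat1 big_geq//= subrr.
  by rewrite !uSS IH -bpowSr uSS addrAC.
have TuS N x : T (u N x) = u N.+1 x - x.
  elim: N => [|N IH]; first by rewrite /u /= !big_nat1 big_geq// linear0 subrr.
  have -> : T (u N.+1 x) = T (u N x) + bpow T N.+1 x by rewrite uSS linearD.
  by rewrite IH (uSS N.+1) addrAC.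
have GT x : G (T x) = G x - x.
  apply: (rcvg_unique (uG _)); under eq_fun do rewrite uT.
  by apply: cvgB; [exact: uS|exact: cvg_cst].
have TG x : T (G x) = G x - x.
  apply: rcvg_unique (bop_cvg T (uG x)) _.
  under eq_fun do rewrite TuS.
  by apply: cvgB; [exact: uS|exact: cvg_cst].
have GD x y : G (x + y) = G x + G y by have := Glin 1 x y; rewrite !scale1r.
split.
- by move=> x; rewrite (linearB Gb) /= GT subKr.
- by move=> x /=; rewrite TG subKr.
move=> e e0.
have rem N x : u N x - G x = - bpow T N (G x).
  elim: N => [|N IH]; first by rewrite /u /= big_geq// sub0r.
  have -> : bpow T N.+1 (G x) = bpow T N (G x) - bpow T N x.
    by rewrite bpowSr TG linearB.
  by rewrite /u neumann_sumS -/u addrAC IH opprB addrC.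
have : geometric ((1 - c)^-1) c @ \oo --> (0 : R).
  by apply: cvg_geometric; rewrite ger0_norm.
move=> /cvgrPdist_lt/(_ e e0); apply: filterS => N.
rewrite /= sub0r normrN ger0_norm; last first.
  by rewrite mulr_ge0 ?exprn_ge0// invr_ge0 ltW.
move=> lt x /=; rewrite rem rnormN (le_trans (bpow_bounded N c0 Tc _))//.
rewrite (le_trans (ler_wpM2l (exprn_ge0 N c0) (GM x)))//.
by rewrite mulrA ler_wpM2r ?rnorm_ge0// mulrC ltW.
Qed.

End Neumann.

(** * Representations are contractive *)

Section StarRepresentation.
Context {R : realType} {n : nat} {E K : hilbertType R}.
Variables (MZ : 'I_n -> bop E E) (pi : bop E E -> bop K K).
Local Notation C := (cstar_generated MZ).
Hypothesis piP : unital_star_rep C pi.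

Lemma cstar_sub A B : C A -> C B -> C (bsub A B).
Proof. by move=> CA CB; apply: Cstar_add => //; apply: Cstar_scale. Qed.

Lemma rep_sub A B : C A -> C B -> pi (bsub A B) = bsub (pi A) (pi B).
Proof.
by move=> CA CB; rewrite (rep_add piP)// ?(rep_scale piP)//; apply: Cstar_scale.
Qed.

Lemma cstar_zero : C (bzero E E).
Proof.
have -> : bzero E E = bscale 0 (bid E) by apply: bop_ext => x /=; rewrite scale0r.
by apply: Cstar_scale; apply: Cstar_id.
Qed.

Lemma rep_zero : pi (bzero E E) = bzero K K.
Proof.
have -> : bzero E E = bscale 0 (bid E) by apply: bop_ext => x /=; rewrite scale0r.
rewrite (rep_scale piP); last exact: Cstar_id.
by rewrite (rep_id piP); apply: bop_ext => x /=; rewrite scale0r.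
Qed.

Lemma cstar_sum (I : Type) (s : seq I) (F : I -> bop E E) :
  (forall i, C (F i)) -> C (bsum s F).
Proof.
move=> CF; elim: s => [|i s IH].
  have -> : bsum [::] F = bzero E E by apply: bop_ext => x /=; rewrite big_nil.
  exact: cstar_zero.
have -> : bsum (i :: s) F = badd (F i) (bsum s F).
  by apply: bop_ext => x /=; rewrite big_cons.
exact: Cstar_add.
Qed.

Lemma rep_sum (I : Type) (s : seq I) (F : I -> bop E E) :
  (forall i, C (F i)) -> pi (bsum s F) = bsum s (fun i => pi (F i)).
Proof.
move=> CF; elim: s => [|i s IH].
  have -> : bsum [::] F = bzero E E by apply: bop_ext => x /=; rewrite big_nil.
  by rewrite rep_zero; apply: bop_ext => x /=; rewrite big_nil.
have -> : bsum (i :: s) F = badd (F i) (bsum s F).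
  by apply: bop_ext => x /=; rewrite big_cons.
rewrite (rep_add piP)//; last exact: cstar_sum.
by rewrite IH; apply: bop_ext => x /=; rewrite big_cons.
Qed.

(** If [b = ||pi A||] exceeded [||A||], then [b ^ 2 - A^* A] would have an
    inverse in the C*-algebra, so that [b ^ 2 - pi(A)^* pi(A)] would be bounded
    below; but [b ^ 2] is the norm of the positive operator [pi(A)^* pi(A)] and
    hence lies in its approximate point spectrum. *)
Lemma star_rep_contractive A : C A -> bounded_by (opnorm A) (pi A).
Proof.
move=> CA; set a := opnorm A; set b := opnorm (pi A).
have a0 : 0 <= a := bop_opnorm_ge0 A.
suff ba : b <= a.
  move=> x; apply: le_trans (bop_opnorm (pi A) x) _.
  by rewrite ler_wpM2r ?rnorm_ge0.
rewrite leNgt; apply/negP => ab.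
have b0 : 0 < b := le_lt_trans a0 ab.
pose m := b ^+ 2; have m0 : 0 < m by rewrite exprn_gt0.
pose T := bcomp (adj A) A; have CT : C T by apply: Cstar_comp => //; apply: Cstar_adj.
pose S := bscale (m^-1)%:C T; have CS : C S by apply: Cstar_scale.
have S_bnd : bounded_by (a ^+ 2 / m) S.
  move=> x; rewrite /= rnormZr ger0_norm ?invr_ge0 ?(ltW m0)//.
  rewrite [_ / m]mulrC -mulrA ler_wpM2l ?invr_ge0 ?(ltW m0)//.
  rewrite (le_trans (adj_bounded a0 (bop_opnorm A) _))//.
  by rewrite expr2 -mulrA ler_wpM2l// bop_opnorm.
have c01 : 0 <= a ^+ 2 / m < 1.
  rewrite divr_ge0 ?exprn_ge0//; last exact: ltW.
  by rewrite ltr_pdivrMr// mul1r ltr_pXn2r// nnegrE (ltW b0).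
have [G [GS _ Glim]] := neumann c01 S_bnd.
have CG : C G.
  apply: (@Cstar_lim _ _ _ _ (neumann_sum S)); last exact/opnorm_cvgP.
  move=> k; apply: cstar_sum => j.
  by elim: j => [|j IH]; [exact: Cstar_id|exact: Cstar_comp].
have piS : pi S = bscale (m^-1)%:C (bcomp (adj (pi A)) (pi A)).
  rewrite (rep_scale piP)// (rep_comp piP)//; last exact: Cstar_adj.
  by rewrite (rep_adj piP).
have piG k : pi G (k - pi S k) = k.
  have : pi (bcomp G (bsub (bid E) S)) = pi (bid E).
    by congr pi; apply: bop_ext => x; rewrite /= scaleN1r; exact: GS.
  have CI : C (bid E) by exact: Cstar_id.
  rewrite (rep_comp piP)//; last exact: cstar_sub.
  by rewrite rep_sub// (rep_id piP) => /(congr1 (fun B : bop K K => B k)); rewrite /= scaleN1r.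
(* The summand 1 keeps [g] invertible when [pi G = 0]. *)
pose g := opnorm (pi G) ^+ 2 + 1.
have g1 : 1 <= g by rewrite lerDr sqr_ge0.
have g0 : 0 < g := lt_le_trans ltr01 g1.
have key k : rnorm (pi A k) ^+ 2 <= m * (1 - g^-1) * rnorm k ^+ 2.
  set y := pi A k; set P := adj (pi A) y.
  have Py : rnorm P ^+ 2 <= m * rnorm y ^+ 2.
    rewrite -exprMn ler_pXn2r ?nnegrE ?rnorm_ge0 ?mulr_ge0 ?rnorm_ge0 ?(ltW b0)//.
    by apply: adj_bounded; [exact: ltW|exact: bop_opnorm].
  have kP : complex.Re (hdot k P) = rnorm y ^+ 2 by rewrite -adjP rnorm2E.
  have d2 : rnorm (k - pi S k) ^+ 2 <= rnorm k ^+ 2 - m^-1 * rnorm y ^+ 2.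
    rewrite piS /= -/y -/P rnorm_sub_sqr Re_hdotZr kP.
    rewrite rnormZr ger0_norm ?invr_ge0 ?(ltW m0)// exprMn.
    have := ler_wpM2l (sqr_ge0 m^-1) Py.
    rewrite [in X in _ <= X -> _]mulrA expr2 -[_ * _ * m]mulrA mulVf ?gt_eqF// mulr1 -expr2.
    by lra.
  have kg : rnorm k ^+ 2 <= g * rnorm (k - pi S k) ^+ 2.
    rewrite -[in leLHS](piG k).
    rewrite (@le_trans _ _ ((opnorm (pi G) * rnorm (k - pi S k)) ^+ 2))//.
      by rewrite ler_pXn2r ?nnegrE ?rnorm_ge0 ?mulr_ge0 ?rnorm_ge0 ?bop_opnorm_ge0 ?bop_opnorm.
    by rewrite exprMn ler_wpM2r ?sqr_ge0// lerDl.
  have := le_trans kg (ler_wpM2l (ltW g0) d2).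
  set Kk := rnorm k ^+ 2; set Y := rnorm y ^+ 2 => le.
  have : m / g * Kk <= m / g * (g * (Kk - m^-1 * Y)).
    by rewrite ler_wpM2l// divr_ge0 ?(ltW m0) ?(ltW g0).
  have -> : m / g * (g * (Kk - m^-1 * Y)) = m * Kk - Y.
    by field; rewrite !gt_eqF.
  by have -> : m * (1 - g^-1) * Kk = m * Kk - m / g * Kk; [ring|lra].
have q0 : 0 <= m * (1 - g^-1).
  by rewrite mulr_ge0 ?(ltW m0)// subr_ge0 invf_le1.
have bq : b <= Num.sqrt (m * (1 - g^-1)).
  apply: opnorm_le; first exact: sqrtr_ge0.
  move=> k; rewrite -(@ler_pXn2r _ 2) ?nnegrE ?rnorm_ge0 ?mulr_ge0 ?sqrtr_ge0 ?rnorm_ge0//.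
  by rewrite exprMn sqr_sqrtr.
have : b ^+ 2 <= m * (1 - g^-1).
  by rewrite -(sqr_sqrtr q0) ler_pXn2r ?nnegrE ?sqrtr_ge0// ltW.
rewrite -/m -[leLHS]mulr1 ler_pM2l// leNgt => /negP; apply.
by rewrite ltrBlDr ltrDl invr_gt0.
Qed.

Lemma star_rep_dist A B (d : R) : 0 <= d -> C A -> C B ->
  bounded_by d (fun x => A x - B x) -> bounded_by d (fun x => pi A x - pi B x).
Proof.
move=> d0 CA CB AB x.
have := star_rep_contractive (cstar_sub CA CB) x; rewrite rep_sub// bsubE => /le_trans; apply.
rewrite ler_wpM2r ?rnorm_ge0//; apply: opnorm_le => // y.
by rewrite bsubE.
Qed.

End StarRepresentation.

(** * Abel means *)

Section Abel.
Context {R : realType}.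

Lemma rcvg_bounded (V : normedModType R[i]) (u : nat -> V) (l : V) :
  u @ \oo --> l -> exists2 C : R, 0 <= C & forall k, rnorm (u k) <= C.
Proof.
move=> /rcvgP/(_ 1 ltr01)[N _ uN].
have s0 : 0 <= \sum_(j < N) rnorm (u j) by apply: sumr_ge0 => j _; exact: rnorm_ge0.
have l0 := rnorm_ge0 l.
exists (1 + rnorm l + \sum_(j < N) rnorm (u j)); first by lra.
move=> k; have [Nk|kN] := leqP N k.
  have := uN k Nk; rewrite /= => lt.
  by have := rnormB l (l - u k); rewrite subKr; lra.
rewrite (bigD1 (Ordinal kN))//= in s0 *.
have : 0 <= \sum_(j < N | j != Ordinal kN) rnorm (u j).
  by apply: sumr_ge0 => j _; exact: rnorm_ge0.
by lra.
Qed.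

(** Abel's theorem. Summation by parts writes the Abel means as averages of the
    partial sums, with weights that leave any initial segment as [r] tends
    to [1]. *)
Lemma abel_theorem (V : completeNormedModType R[i]) (s : nat -> V) (l : V) :
  (\sum_(k < N) s k) @[N --> \oo] --> l ->
  exists L : R -> V,
    (forall r, 0 < r < 1 ->
       (\sum_(k < N) (r%:C ^+ k) *: s k) @[N --> \oo] --> L r) /\
    L r @[r --> (1 : R)^'-] --> l.
Proof.
set S := fun N => \sum_(k < N) s k => Sl.
have SS N : S N.+1 = S N + s N by rewrite /S big_ord_recr.
pose D N := S N - l.
have Dl : D @ \oo --> (0 : V) by rewrite -(subrr l); apply: cvgB Sl (cvg_cst l).
have [C C0 DC] := rcvg_bounded Dl.
have sC k : rnorm (s k) <= 2 * C.
  have -> : s k = D k.+1 - D k by rewrite /D opprB addrA subrK SS addrAC subrr add0r.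
  by rewrite (le_trans (rnormB _ _))// mulr_natl mulr2n lerD.
pose T r N := \sum_(k < N) (r%:C ^+ k) *: s k.
have TS r N : T r N.+1 = T r N + r%:C ^+ N *: s N by rewrite /T big_ord_recr.
have rX (r : R) k : 0 < r -> `|r ^+ k| = r ^+ k by move=> r0; rewrite ger0_norm// exprn_ge0// ltW.
have XC (r : R) k : r%:C ^+ k = (r ^+ k)%:C by rewrite rmorphXn.
have /choice[L LP] (r : R) : exists Lr : V, 0 < r < 1 -> T r N @[N --> \oo] --> Lr.
  have [/andP[r0 r1]|_] := boolP (0 < r < 1); last by exists 0.
  have [Lr TL] : exists Lr : V, T r N @[N --> \oo] --> Lr.
    apply: (@geometric_rcvg _ _ _ (2 * C) r); first by rewrite r1 ltW.
    move=> k; rewrite TS addrC addKr XC rnormZr rX// mulrC.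
    by rewrite ler_wpM2r// exprn_ge0// ltW.
  by exists Lr.
exists L; split=> //.
have parts r N : T r N - l =
    r%:C ^+ N *: D N + (1 - r)%:C *: \sum_(k < N) r%:C ^+ k *: D k.+1.
  elim: N => [|N IH].
    by rewrite /T !big_ord0 scaler0 addr0 expr0 scale1r /D /S big_ord0.
  rewrite TS addrAC IH big_ord_recr /= [(1 - r)%:C *: (_ + _ *: _)]scalerDr.
  have -> : s N = D N.+1 - D N by rewrite /D opprB addrA subrK SS addrAC subrr add0r.
  rewrite [_ *: (D N.+1 - _)]scalerBr addrAC [_ *: D N + _]addrC subrK exprSr scalerA.
  rewrite [RHS]addrCA -scalerDl addrC; congr (_ + _ *: _).
  by rewrite rmorphB rmorph1; ring.
apply/rcvgP => e e0.
have e3 : 0 < e / 4 by rewrite divr_gt0.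
have [m _ mP] := (rcvgP _ _).1 Dl _ e3.
pose B := \sum_(k < m) rnorm (D k.+1).
have B0 : 0 <= B by apply: sumr_ge0 => k _; exact: rnorm_ge0.
have sumB (r : R) j : 0 < r < 1 -> rnorm (\sum_(k < m + j) r%:C ^+ k *: D k.+1) <=
    B + e / 4 * \sum_(k < m + j) r ^+ k.
  move=> /andP[r0 r1]; apply: le_trans (rnorm_sum _ _ _) _.
  elim: j => [|j IH].
    rewrite addn0 ler_wpDr//.
      by rewrite mulr_ge0 ?(ltW e3)// sumr_ge0// => k _; rewrite exprn_ge0 ?(ltW r0).
    apply: ler_sum => k _; rewrite XC rnormZr rX// ler_piMl ?rnorm_ge0//.
    by rewrite exprn_ile1 ?(ltW r0) ?(ltW r1).
  rewrite addnS !big_ord_recr /= mulrDr addrA lerD//.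
  rewrite XC rnormZr rX// mulrC ler_wpM2r ?exprn_ge0 ?(ltW r0)//.
  have := mP (m + j).+1; rewrite /= sub0r rnormN => h; apply/ltW/h.
  by rewrite -addnS leq_addr.
have geo (r : R) N : (1 - r) * \sum_(k < N) r ^+ k = 1 - r ^+ N.
  by rewrite -[RHS]opprB subrX1 -mulNr opprB.
have LB (r : R) : 0 < r < 1 -> rnorm (L r - l) <= e / 4 + (1 - r) * B + e / 4.
  move=> r01; have /andP[r0 r1] := r01.
  have TL : (T r N - l) @[N --> \oo] --> L r - l by apply: cvgB (LP r r01) (cvg_cst l).
  apply: (rnorm_cvg_le TL); exists m => // N /= mN.
  rewrite parts -(subnKC mN); set j := (N - m)%N.
  rewrite (le_trans (rnormD _ _))// -addrA lerD//.
    rewrite XC rnormZr rX//.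
    have := mP (m + j)%N; rewrite /= sub0r rnormN => /(_ (leq_addr _ _)) h.
    by rewrite (le_trans _ (ltW h))// ler_piMl ?rnorm_ge0// exprn_ile1 ?(ltW r0) ?(ltW r1).
  have r1' : 0 <= 1 - r by rewrite subr_ge0 ltW.
  rewrite rnormZr ger0_norm// (le_trans (ler_wpM2l r1' (sumB r j r01)))//.
  rewrite mulrDr lerD2l mulrCA geo ler_piMr ?(ltW e3)//.
  by rewrite gerBl exprn_ge0 ?(ltW r0).
have B1 : 0 < B + 1 by rewrite ltr_wpDl.
have r0 : (0 : R) < 1 by [].
near=> r.
have r01 : 0 < r < 1.
  by apply/andP; split; near: r; [exact: nbhs_left_gt|exact: nbhs_left_lt].
have rB : 1 - r < e / 4 / (B + 1).
  by near: r; apply: nbhs_left_ltBl; rewrite divr_gt0.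
rewrite rnorm_dist; apply: le_lt_trans (LB r r01) _.
move: rB; rewrite ltr_pdivlMr//; move: r01 => /andP[_ r1].
have : 0 <= 1 - r by rewrite subr_ge0 ltW.
by nra.
Unshelve. all: by end_near.
Qed.

End Abel.

(** * Power series evaluated at operators *)

Section Evaluation.
Context {R : realType} {n : nat}.
Implicit Types (H K : hilbertType R) (a : fps R n).

Lemma opword_linear H (Y : 'I_n -> bop H H) w : linear (opword Y w).
Proof. by move=> a x y; elim: w => //= i w ->; rewrite linearP. Qed.

Lemma opword_bounded H (Y : 'I_n -> bop H H) w :
  exists M : R, forall x, rnorm (opword Y w x) <= M * rnorm x.
Proof.
elim: w => [|i w [M IH]] /=; first by exists 1 => x; rewrite mul1r.
have [N N0 YN] := bop_bounded_ge0 (Y i).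
by exists (N * M) => x; rewrite (le_trans (YN _))// -mulrA ler_wpM2l.
Qed.

Definition bopword H (Y : 'I_n -> bop H H) w : bop H H :=
  Bop (opword_linear Y w) (opword_bounded Y w).

Definition bpsum H a (Y : 'I_n -> bop H H) N : bop H H :=
  bsum (index_enum 'I_N) (fun k : 'I_N =>
    bsum (index_enum (k.-tuple 'I_n : finType))
      (fun w => bscale (a w) (bopword Y w))).

Lemma opword_cat H (Y : 'I_n -> bop H H) u v x :
  opword Y (u ++ v) x = opword Y u (opword Y v x).
Proof. by rewrite /opword foldr_cat. Qed.

Lemma opword_scale H (Y : 'I_n -> bop H H) (r : R) w x :
  opword (scale_tuple r Y) w x = r%:C ^+ size w *: opword Y w x.
Proof.
elim: w => [|i w IH]; first by rewrite expr0 scale1r.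
by rewrite [LHS]/= -/(opword _ w x) IH linearZ scalerA -exprS.
Qed.

Lemma psum_scale H a (Y : 'I_n -> bop H H) (r : R) N x :
  psum a (scale_tuple r Y) N x = \sum_(k < N) r%:C ^+ k *:
    \sum_(w : k.-tuple 'I_n) a w *: opword Y w x.
Proof.
apply: eq_bigr => k _; rewrite scaler_sumr; apply: eq_bigr => w _.
by rewrite opword_scale size_tuple !scalerA mulrC.
Qed.

Lemma opword_intertwine H K (Z : bop H K) (A : 'I_n -> bop H H) (B : 'I_n -> bop K K) w x :
  (forall i x, Z (A i x) = B i (Z x)) ->
  Z (opword A w x) = opword B w (Z x).
Proof. by move=> AB; elim: w => //= i w IH; rewrite AB IH. Qed.

Lemma psum_intertwine H K (Z : bop H K) (A : 'I_n -> bop H H) (B : 'I_n -> bop K K) a N x :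
  (forall i x, Z (A i x) = B i (Z x)) -> Z (psum a A N x) = psum a B N (Z x).
Proof.
move=> AB; rewrite /psum /wsum linear_sum; apply: eq_bigr => k _.
rewrite linear_sum; apply: eq_bigr => w _.
by rewrite linearZ -(opword_intertwine _ _ AB).
Qed.

Lemma norm_evalP H a (Y : 'I_n -> bop H H) B :
  norm_eval a Y B <-> forall e : R, 0 < e ->
    \forall N \near \oo, bounded_by e (fun x => psum a Y N x - B x).
Proof. exact: (opnorm_cvgP (bpsum a Y) B). Qed.

Lemma norm_eval_sot H a (Y : 'I_n -> bop H H) B :
  norm_eval a Y B -> sot_eval a Y B.
Proof.
move=> /norm_evalP YB x; apply/rcvgP => e e0.
have x1 : 0 < rnorm x + 1 by rewrite ltr_wpDl ?rnorm_ge0.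
apply: filterS (YB _ (divr_gt0 e0 x1)) => N /(_ x); rewrite rnorm_dist => /le_lt_trans; apply.
by rewrite mulrAC ltr_pdivrMr// ltr_pM2l// ltrDl.
Qed.

Lemma norm_eval_unique H a (Y : 'I_n -> bop H H) B B' :
  norm_eval a Y B -> norm_eval a Y B' -> B = B'.
Proof.
move=> /norm_eval_sot YB /norm_eval_sot YB'; apply: bop_ext => x.
exact: rcvg_unique (YB x) (YB' x).
Qed.

(** The common consequence of both readings of [a(Y)]: the Abel means of the
    evaluated series exist near [1] and converge strongly to [B]. *)
Definition abel_eval H a (Y : 'I_n -> bop H H) (B : H -> H) :=
  exists (delta : R) (L : R -> H -> H), [/\ delta < 1,
    forall r, delta < r < 1 -> forall x,
      psum a (scale_tuple r Y) N x @[N --> \oo] --> L r x &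
    forall x, L r x @[r --> (1 : R)^'-] --> B x].

Lemma sot_abel H a (Y : 'I_n -> bop H H) B : sot_eval a Y B -> abel_eval a Y B.
Proof.
move=> YB; have /choice[L LP] (x : H) :=
  @abel_theorem _ _ (fun k => \sum_(w : k.-tuple 'I_n) a w *: opword Y w x) _ (YB x).
exists 0, (fun r x => L x r); split=> [//|r r01 x|x]; last exact: (LP x).2.
by have := (LP x).1 r r01; under eq_fun do rewrite -psum_scale.
Qed.

Lemma rad_abel H a (Y : 'I_n -> bop H H) B : rad_eval a Y B -> abel_eval a Y B.
Proof.
move=> [delta [P [/andP[_ d1] YP PB]]]; exists delta, (fun r => P r); split=> //.
by move=> r rd x; apply: norm_eval_sot (YP r rd) x.
Qed.

Lemma tuple_eval_abel H (f : 'I_n -> fps R n) (Y W : 'I_n -> bop H H) :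
  tuple_eval f Y W -> forall i, abel_eval (f i) Y (W i).
Proof. by case=> YW i; [exact: sot_abel|exact: rad_abel]. Qed.

(** Bounded operators commute with Abel means. For the identity this says that
    the value of a series is unique; for the adjoint of the inclusion of a
    coinvariant subspace it compresses [f(V)] to [f(T)], whichever reading of
    the value is used on either side. *)
Lemma abel_intertwine H K (Z : bop H K) a (A : 'I_n -> bop H H) (B : 'I_n -> bop K K) C D :
  (forall i x, Z (A i x) = B i (Z x)) -> abel_eval a A C -> abel_eval a B D ->
  forall x, Z (C x) = D (Z x).
Proof.
move=> AB [d [L [d1 AL LC]]] [d' [L' [d'1 BL' LD]]] x.
apply/eqP; rewrite -subr_eq0; apply/eqP.
have ZL r : d < r < 1 -> d' < r < 1 -> Z (L r x) = L' r (Z x).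
  move=> rd rd'; apply: rcvg_unique (bop_cvg Z (AL r rd x)) _.
  have AB' i y : Z (scale_tuple r A i y) = scale_tuple r B i (Z y).
    by rewrite /= [LHS]linearZ /= AB.
  by under eq_fun do rewrite (psum_intertwine _ _ _ AB'); exact: BL'.
apply: rnorm_eq0; apply/le_anti; rewrite rnorm_ge0 andbT.
apply: (rnorm_cvg_le (cvgB (bop_cvg Z (LC x)) (LD (Z x)))).
near=> r.
have r1 : r < 1 by near: r; exact: nbhs_left_lt.
have dr : d < r by near: r; exact: nbhs_left_gt.
have d'r : d' < r by near: r; exact: nbhs_left_gt.
by rewrite -[X in rnorm X]/(Z (L r x) - L' r (Z x)) ZL ?dr ?d'r// subrr rnorm0.
Unshelve. all: by end_near.
Qed.

Lemma abel_unique H a (A : 'I_n -> bop H H) (C D : bop H H) :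
  abel_eval a A C -> abel_eval a A D -> C = D.
Proof.
move=> AC AD; apply: bop_ext => x.
by have := abel_intertwine (Z := bid H) (B := A) (fun _ _ => erefl) AC AD x.
Qed.

End Evaluation.

(** * Weak limits of bounded sequences of operators *)

Section UltraLimit.
Context {R : realType}.
Implicit Types H K : hilbertType R.

Lemma ultra_bounded_cvg (G : set_system nat) (GU : UltraFilter G)
    (u : nat -> R) (C : R) : (forall k, `|u k| <= C) ->
  exists l : R, u @ G --> l.
Proof.
move=> uC.
have GP : ProperFilter (u @ G) by apply: fmap_proper_filter.
have uI : (u @ G) `[- C, C]%classic.
  by apply: (@filterE _ G) => k /=; rewrite in_itv /= -ler_norml uC.
have [l [_ lcl]] := segment_compact GP uI.
exists l => V nV; have [//|GnV] := in_ultra_setVsetC (u @^-1` V) GU.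
by have [w [nVw Vw]] := lcl (~` V) V GnV nV; case: nVw.
Qed.

Lemma hdot_Re_inj H (x y : H) :
  (forall z, complex.Re (hdot z x) = complex.Re (hdot z y)) -> x = y.
Proof.
move=> /(_ (x - y)) xy; apply/eqP; rewrite -subr_eq0; apply/eqP/rnorm_eq0/eqP.
by rewrite -sqrf_eq0 rnorm2E linearBr raddfB /= xy subrr.
Qed.

(** The weak operator limit of a norm-bounded sequence along an ultrafilter:
    bounded sets are weakly compact. Real parts suffice, since they determine
    the inner product. *)
Lemma weak_ultralimit H K (G : set_system nat) (GU : UltraFilter G)
    (Z : nat -> bop H K) (M : R) :
  (forall N, bounded_by M (Z N)) ->
  exists Y : bop H K,
    forall x y, complex.Re (hdot y (Z N x)) @[N --> G] --> complex.Re (hdot y (Y x)).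
Proof.
move=> ZM.
have hM x y N : `|complex.Re (hdot y (Z N x))| <= rnorm y * (M * rnorm x).
  have le y' : complex.Re (hdot y' (Z N x)) <= rnorm y' * (M * rnorm x).
    by rewrite (le_trans (Re_hdot_le _ _))// ler_wpM2l ?rnorm_ge0 ?ZM.
  rewrite ler_norml le andbT lerNl -(rnormN y); apply: le_trans (le _).
  by rewrite linearNl raddfN.
have /choice[rho rhoP] (p : H * K) : exists l : R,
    complex.Re (hdot p.2 (Z N p.1)) @[N --> G] --> l.
  by apply: ultra_bounded_cvg => N; exact: hM.
have lim x y (l : R) : complex.Re (hdot y (Z N x)) @[N --> G] --> l -> rho (x, y) = l.
  by move=> h; apply: (cvg_unique _ (rhoP (x, y)) h).
have rhoD x y1 y2 : rho (x, y1 + y2) = rho (x, y1) + rho (x, y2).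
  apply: lim; under eq_fun do rewrite linearDl raddfD.
  exact: cvgD (rhoP (x, y1)) (rhoP (x, y2)).
have rhoZ x (a : R) y : rho (x, a%:C *: y) = a * rho (x, y).
  apply: lim; have ReZ (w : R[i]) : complex.Re (a%:C * w) = a * complex.Re w.
    by case: w => u v /=; ring.
  under eq_fun do rewrite linearZl_LR ReZ.
  exact: cvgM (cvg_cst a) (rhoP (x, y)).
pose phi x y : R[i] := (rho (x, y) +i* - rho (x, 'i%C *: y))%C.
have aE (a : R[i]) : a = (complex.Re a)%:C + (complex.Im a)%:C * 'i%C.
  by case: a => a b; apply/eqP; rewrite eq_complex /=; apply/andP; split; apply/eqP; ring.
have phiL x : scalar (phi x).
  move=> a y1 y2; rewrite /phi.
  have rhoC y (b : R[i]) : rho (x, b *: y) =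
      complex.Re b * rho (x, y) + complex.Im b * rho (x, 'i%C *: y).
    by rewrite [in LHS](aE b) scalerDl rhoD -scalerA !rhoZ.
  rewrite scalerDr !rhoD scalerA (rhoC _ a) (rhoC _ ('i%C * a)).
  by case: a => a b /=; apply/eqP; rewrite eq_complex /=; apply/andP; split; apply/eqP; ring.
have rho_le x y : `|rho (x, y)| <= rnorm y * (M * rnorm x).
  apply/ler_addgt0Pr => e e0.
  have [N /= rN] := @filter_ex _ G _ _ ((cvgrPdist_lt _ _).1 (rhoP (x, y)) e e0).
  have := ler_normD (rho (x, y) - complex.Re (hdot y (Z N x)))
    (complex.Re (hdot y (Z N x))).
  by rewrite subrK; have := hM x y N; move: rN; lra.
have /choice[Y YP] (x : H) : exists z : K, forall y, phi x y = hdot y z.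
  apply: (@riesz _ _ _ (2 * (`|M| * rnorm x))); first exact: phiL.
  move=> y; rewrite /phi rnormE -rmorphM normc_def lecR /=.
  have iy : rnorm ('i%C *: y) = rnorm y.
    by rewrite rnormZ normc_def /= expr0n expr1n add0r sqrtr1 mul1r.
  have := rho_le x y; have := rho_le x ('i%C *: y); rewrite iy.
  set p := rho (x, y); set q := rho _ => qM pM.
  have sq : Num.sqrt (p ^+ 2 + (- q) ^+ 2) <= `|p| + `|q|.
    rewrite -[leRHS]ger0_norm ?addr_ge0// -sqrtr_sqr ler_sqrt ?sqr_ge0// sqrrD.
    rewrite sqrrN !real_normK ?num_real//.
    by have := mulr_ge0 (normr_ge0 p) (normr_ge0 q); lra.
  apply: le_trans sq _.
  have : rnorm y * (M * rnorm x) <= rnorm y * (`|M| * rnorm x).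
    by rewrite ler_wpM2l ?rnorm_ge0// ler_wpM2r ?rnorm_ge0// ler_norm.
  by move: (rnorm y * (M * rnorm x)) qM pM => t; lra.
have YRe x y : complex.Re (hdot y (Y x)) = rho (x, y) by rewrite -YP.
have Ylin : linear Y.
  move=> a x1 x2; apply: hdot_Re_inj => y; rewrite YRe linearDr linearZr_LR /=.
  rewrite raddfD /= !YRe.
  have -> : complex.Re (a^* * hdot y (Y x1)) = complex.Re (hdot (a^* *: y) (Y x1)).
    by rewrite linearZl_LR.
  rewrite YRe; apply: lim.
  under eq_fun do rewrite linearP linearDr linearZr_LR raddfD /= -linearZl_LR.
  exact: cvgD (rhoP (x1, a^* *: y)) (rhoP (x2, y)).
have Ybnd : exists C : R, forall x, rnorm (Y x) <= C * rnorm x.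
  exists M => x; have [/rnorm_eq0 Y0|y0] := eqVneq (rnorm (Y x)) 0.
    by rewrite Y0 rnorm0 (le_trans _ (ZM 0 x))// rnorm_ge0.
  have {}y0 : 0 < rnorm (Y x) by rewrite lt_neqAle eq_sym y0 rnorm_ge0.
  rewrite -(ler_pM2l y0) -expr2 rnorm2E YRe.
  by rewrite (le_trans (ler_norm _))// rho_le.
exists (Bop Ylin Ybnd) => x y /=; rewrite YRe; exact: (rhoP (x, y)).
Qed.

End UltraLimit.

(** * Commutant lifting for row isometries *)

Section RowIsometry.
Context {R : realType} {n : nat}.
Implicit Types H K : hilbertType R.

Definition row_isometry K (W : 'I_n -> bop K K) :=
  forall i j x, adj (W i) (W j x) = (i == j)%:R *: x.

Lemma row_isometry_rnorm K (W : 'I_n -> bop K K) (v : 'I_n -> K) :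
  row_isometry W -> rnorm (\sum_i W i (v i)) ^+ 2 = \sum_i rnorm (v i) ^+ 2.
Proof.
move=> Wiso; rewrite rnorm2E linear_sumlz raddf_sum; apply: eq_bigr => i _.
rewrite linear_sumr (bigD1 i)//= big1 ?addr0 => [|j ji].
  by rewrite adjP Wiso eqxx scale1r rnorm2E.
by rewrite adjP Wiso eq_sym (negbTE ji) scale0r linear0r.
Qed.

Lemma row_isometry1 K (W : 'I_n -> bop K K) i x :
  row_isometry W -> rnorm (W i x) = rnorm x.
Proof.
move=> Wiso; apply/eqP; rewrite -(@eqrXn2 _ 2) ?rnorm_ge0//.
by rewrite rnorm2E adjP Wiso eqxx scale1r -rnorm2E.
Qed.

End RowIsometry.

Section Lifting.
Context {R : realType} {n : nat} {K K' H' : hilbertType R}.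
Variables (W : 'I_n -> bop K K) (W' : 'I_n -> bop K' K').
Variables (A' : 'I_n -> bop H' H') (J' : bop H' K').
Hypotheses (Wiso : row_isometry W) (W'iso : row_isometry W').
Hypothesis J'iso : forall x, adj J' (J' x) = x.
Hypothesis J'W' : forall i y, adj J' (W' i y) = A' i (adj J' y).
Implicit Types (X : bop K H') (Y : bop K K').

Let Q : bop K K := bsum (index_enum 'I_n) (fun i => bcomp (W i) (adj (W i))).

Let QE x : Q x = \sum_i W i (adj (W i) x). Proof. by []. Qed.

Let QW i x : Q (W i x) = W i x.
Proof.
rewrite QE (bigD1 i)//= big1 ?addr0 => [|j ji].
  by rewrite Wiso eqxx scale1r.
by rewrite Wiso (negbTE ji) scale0r bop0.
Qed.

Let QQ x : Q (Q x) = Q x.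
Proof. by rewrite [in LHS](QE x) bop_sum QE; apply: eq_bigr => i _; exact: QW. Qed.

Let Qadj x y : hdot (Q x) y = hdot x (Q y).
Proof.
rewrite !QE linear_sumlz linear_sumr; apply: eq_bigr => i _.
by rewrite /= adjP adjPr.
Qed.

Let Qle x : rnorm (Q x) <= rnorm x.
Proof.
have [/rnorm_eq0 ->|q0] := eqVneq (rnorm (Q x)) 0; first by rewrite rnorm0 rnorm_ge0.
have {}q0 : 0 < rnorm (Q x) by rewrite lt_neqAle eq_sym q0 rnorm_ge0.
rewrite -(ler_pM2l q0) -expr2 rnorm2E Qadj QQ -Qadj.
exact: Re_hdot_le.
Qed.

(** One step towards an intertwining operator. The operator [Y1] is prescribed
    on the range of [W] and after compression to [H'], a matrix completion
    problem. A completion is obtained by projecting onto the range of [W],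
    orthogonally for the inner product of [Delta = 1 - X^* X], before applying
    the prescribed values: the defect [Delta] is exactly what is left of the
    norm once the component in [H'] has been subtracted. *)
Lemma lifting_step X Y (c : R) : 0 <= c < 1 -> bounded_by c X ->
  (forall i x, X (W i x) = A' i (X x)) ->
  bounded_by 1 Y -> (forall k, adj J' (Y k) = X k) ->
  exists Y1 : bop K K', [/\ bounded_by 1 Y1, forall k, adj J' (Y1 k) = X k &
    forall i k, Y1 (W i k) = W' i (Y k)].
Proof.
move=> /andP[c0 c1] Xc XW Y1 JY.
pose N : bop K K := bcomp Q (bcomp (adj X) (bcomp X Q)).
have NE x : N x = Q (adj X (X (Q x))) by [].
have Nc : bounded_by (c ^+ 2) N.
  move=> x; rewrite [N x]/= (le_trans (Qle _))//.
  rewrite (le_trans (adj_bounded c0 Xc _))// expr2 -mulrA ler_wpM2l//.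
  by rewrite (le_trans (Xc _))// ler_wpM2l// Qle.
have c2 : 0 <= c ^+ 2 < 1 by rewrite sqr_ge0 expr_lt1.
have [G [GN NG _]] := neumann c2 Nc.
pose Dl : bop K K := bsub (bid K) (bcomp (adj X) X).
have DlE k : Dl k = k - adj X (X k) by rewrite /Dl bsubE.
(* [z k] is the [Delta]-orthogonal projection of [k] onto the range of [W]. *)
pose z : bop K K := bcomp G (bcomp Q Dl).
have zN k : z k - N (z k) = Q (Dl k) by rewrite /z /= NG.
have Qz k : Q (z k) = z k.
  have -> : z k = N (z k) + Q (Dl k) by rewrite -zN addrC subrK.
  by rewrite bopD QQ NE QQ.
have QDz k : Q (Dl (z k)) = Q (Dl k).
  by rewrite -(zN k) DlE bopB Qz NE Qz.
pose Th : bop K K' := bsum (index_enum 'I_n)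
  (fun i => bcomp (W' i) (bcomp Y (adj (W i)))).
have ThE k : Th k = \sum_i W' i (Y (adj (W i) k)) by [].
have JTh k : adj J' (Th k) = X (Q k).
  rewrite ThE QE !bop_sum; apply: eq_bigr => i _.
  by rewrite J'W' JY /= XW.
pose Y2 : bop K K' := badd (bcomp J' X)
  (bcomp (bsub (bid K') (bcomp J' (adj J'))) (bcomp Th z)).
have Y2E k : Y2 k = J' (X k) + (Th (z k) - J' (X (z k))).
  have -> : Y2 k = J' (X k) + bsub (bid K') (bcomp J' (adj J')) (Th (z k)) by [].
  rewrite bsubE; congr (_ + (_ - _)).
  by rewrite -[LHS]/(J' (adj J' (Th (z k)))) JTh Qz.
have JY2 k : adj J' (Y2 k) = X k.
  by rewrite Y2E bopD bopB /= !J'iso JTh Qz subrr addr0.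
exists Y2; split=> //; last first.
  move=> i k.
  have zW : z (W i k) = W i k.
    have -> : z (W i k) = G (Q (Dl (W i k))) by [].
    by rewrite -[RHS](GN (W i k)) DlE bopB NE !QW.
  rewrite Y2E zW addrC subrK ThE (bigD1 i)//= big1 ?addr0 => [|j ji].
    by rewrite Wiso eqxx scale1r.
  by rewrite Wiso (negbTE ji) scale0r !bop0.
move=> k; rewrite mul1r -(@ler_pXn2r _ 2) ?nnegrE ?rnorm_ge0//.
have Jn x : rnorm (J' x) ^+ 2 = rnorm x ^+ 2.
  by rewrite rnorm2E adjP J'iso -rnorm2E.
set a := X k; set b := X (z k); set t := Th (z k).
have tz : rnorm t ^+ 2 <= rnorm (z k) ^+ 2.
  rewrite /t ThE row_isometry_rnorm// -[in leRHS](Qz k) QE row_isometry_rnorm//.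
  apply: ler_sum => i _; rewrite ler_pXn2r ?nnegrE ?rnorm_ge0//.
  by rewrite -[leRHS]mul1r.
have jt : adj J' t = b by rewrite JTh Qz.
have Y2n : rnorm (Y2 k) ^+ 2 = rnorm a ^+ 2 + rnorm t ^+ 2 - rnorm b ^+ 2.
  have -> : Y2 k = J' a - (J' b - t) by rewrite Y2E opprB.
  rewrite rnorm_sub_sqr rnorm_sub_sqr !Jn !(adjP J') bopB J'iso jt subrr linear0r.
  by rewrite -rnorm2E /=; ring.
have Dk u v : complex.Re (hdot (Dl u) v) =
    complex.Re (hdot u v) - complex.Re (hdot (X u) (X v)).
  by rewrite DlE linearBl raddfB /= adjPr.
have kz : complex.Re (hdot k (z k)) - complex.Re (hdot a b) =
    rnorm (z k) ^+ 2 - rnorm b ^+ 2.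
  by rewrite -Dk -[in LHS](Qz k) -Qadj -QDz Qadj Qz Dk !rnorm2E.
have := Xc (k - z k); rewrite bopB /= -/a -/b => d.
have {}d : rnorm (a - b) ^+ 2 <= rnorm (k - z k) ^+ 2.
  rewrite ler_pXn2r ?nnegrE ?rnorm_ge0// (le_trans d)//.
  by rewrite ler_piMl ?rnorm_ge0// ltW.
move: d; rewrite !rnorm_sub_sqr Y2n; lra.
Qed.

(** Iterating the step gives [Y_(m+1) W = W' Y_m]. The operators [Y_m] need not
    converge, but their Cesaro means intertwine up to a telescoping error. *)
Lemma approximate_lifting_strict X (c : R) : 0 <= c < 1 -> bounded_by c X ->
  (forall i x, X (W i x) = A' i (X x)) ->
  forall N, exists Y : bop K K', [/\ bounded_by 1 Y, forall k, adj J' (Y k) = X k &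
    forall i k, rnorm (Y (W i k) - W' i (Y k)) <= 2 / N.+1%:R * rnorm k].
Proof.
move=> c01 Xc XW N.
pose P Y := bounded_by 1 Y /\ forall k, adj J' (Y k) = X k.
have /choice[S SP] (Y : bop K K') : exists Y1 : bop K K',
    P Y -> P Y1 /\ forall i k, Y1 (W i k) = W' i (Y k).
  have [[Y1 JY]|nP] := pselect (P Y); last by exists Y.
  by have [Y2 [? ? ?]] := lifting_step c01 Xc XW Y1 JY; exists Y2.
have Jn x : rnorm (J' x) = rnorm x.
  by apply/eqP; rewrite -(@eqrXn2 _ 2) ?rnorm_ge0// rnorm2E adjP J'iso -rnorm2E.
pose Y0 : bop K K' := bcomp J' X.
have PY0 : P Y0.
  have /andP[c0 c1] := c01.
  split=> k /=; last exact: J'iso.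
  by rewrite Jn (le_trans (Xc k))// ler_wpM2r ?rnorm_ge0// ltW.
pose Y m := iter m S Y0.
have PY m : P (Y m) by elim: m => // m IH; apply: (SP _ IH).1.
have YW m i k : Y m.+1 (W i k) = W' i (Y m k) by apply: (SP _ (PY m)).2.
have N0 : 0 < N.+1%:R^-1 :> R by rewrite invr_gt0 ltr0n.
have NC : (N.+1%:R^-1 : R)%:C * N.+1%:R = 1.
  by rewrite -(rmorph_nat (real_complex R)) -rmorphM mulVf ?rmorph1// pnatr_eq0.
exists (bscale (N.+1%:R^-1)%:C (bsum (index_iota 0 N.+1) Y)); split.
- move=> k; rewrite /= rnormZr gtr0_norm// mul1r.
  rewrite mulrC ler_pdivrMr ?ltr0n//.
  rewrite (le_trans (rnorm_sum _ _ _))//.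
  rewrite -[X in _ <= _ * X%:R](subn0 N.+1) mulr_natr -sumr_const_nat.
  by apply: ler_sum => m _; have := (PY m).1 k; rewrite mul1r.
- move=> k; rewrite /= bopZ bop_sum /=.
  under eq_bigr do rewrite (PY _).2.
  by rewrite sumr_const_nat subn0 -[X k *+ _]scaler_nat scalerA NC scale1r.
move=> i k; rewrite /= bopZ -scalerBr rnormZr gtr0_norm// mulrC.
rewrite mulrAC ler_pM2r// bop_sum big_nat_recl// big_nat_recr//=.
under eq_bigr do rewrite YW.
rewrite opprD addrA addrK (le_trans (rnormB _ _))// mulr_natl mulr2n.
have Yn m x : rnorm (Y m x) <= rnorm x by have := (PY m).1 x; rewrite mul1r.
by rewrite lerD// ?(row_isometry1 _ _ W'iso)// (le_trans (Yn 0 _))// row_isometry1.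
Qed.

(** The completion step requires a strict contraction, which is obtained on
    dividing [X] by a number above its bound [a]; the excess tends to 0. *)
Lemma approximate_lifting X (a : R) : 0 <= a -> bounded_by a X ->
  (forall i x, X (W i x) = A' i (X x)) ->
  forall N, exists Y : bop K K',
    [/\ bounded_by (a + N.+1%:R^-1) Y, forall k, adj J' (Y k) = X k &
    forall i k, rnorm (Y (W i k) - W' i (Y k)) <=
      (a + 1) * (2 / N.+1%:R) * rnorm k].
Proof.
move=> a0 Xa XW N; set M := a + N.+1%:R^-1.
have N0 : 0 < N.+1%:R^-1 :> R by rewrite invr_gt0 ltr0n.
have M0 : 0 < M by rewrite ltr_wpDl.
have N1 : N.+1%:R^-1 <= 1 :> R by rewrite invf_le1 ?ltr0n// ler1n.
pose X1 := bscale (M^-1)%:C X.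
have X1c : bounded_by (a / M) X1.
  move=> x; rewrite /= rnormZr gtr0_norm ?invr_gt0// mulrAC mulrC.
  by rewrite ler_wpM2r ?invr_ge0 ?(ltW M0)// Xa.
have c01 : 0 <= a / M < 1.
  by rewrite divr_ge0 ?(ltW M0)//= ltr_pdivrMr// mul1r ltrDl.
have X1W i x : X1 (W i x) = A' i (X1 x) by rewrite /= XW bopZ.
have [Y [Y1 JY YW]] := approximate_lifting_strict c01 X1c X1W N.
have MC : M%:C * (M^-1)%:C = 1 by rewrite -rmorphM mulfV ?gt_eqF.
exists (bscale M%:C Y); split.
- by move=> k; rewrite /= rnormZr gtr0_norm// ler_pM2l// -[leRHS]mul1r Y1.
- by move=> k; rewrite [X in adj J' X]/= bopZ JY /= scalerA MC scale1r.
move=> i k; rewrite /= bopZ -scalerBr rnormZr gtr0_norm// -mulrA.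
rewrite ler_pM ?rnorm_ge0 ?(ltW M0)// ?YW// /M lerD2l//.
Qed.

(** The norm constraint, the compression to [H'] and the intertwining relation
    are all stable under weak limits, so that they hold in the limit with the
    exact norm and without error. *)
Theorem commutant_lifting X (a : R) : 0 <= a -> bounded_by a X ->
  (forall i x, X (W i x) = A' i (X x)) ->
  exists Y : bop K K', [/\ bounded_by a Y, forall k, adj J' (Y k) = X k &
    forall i k, Y (W i k) = W' i (Y k)].
Proof.
move=> a0 Xa XW.
have /choice[Z ZP] := approximate_lifting a0 Xa XW.
have N1 N : N.+1%:R^-1 <= 1 :> R by rewrite invf_le1 ?ltr0n// ler1n.
have ZM N : bounded_by (a + 1) (Z N).
  move=> x; have [Za _ _] := ZP N.
  by rewrite (le_trans (Za x))// ler_wpM2r ?rnorm_ge0// lerD2l.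
have [G [GU Goo]] := ultraFilterLemma (eventually_filter : ProperFilter \oo).
have [Y YP] := weak_ultralimit GU ZM.
have lim (u : nat -> R) (l l' : R) : u @ G --> l -> u @ \oo --> l' -> l = l'.
  move=> ul ul'; have ul'G : u @ G --> l' by move=> V nV; apply: Goo; exact: ul'.
  exact: (cvg_unique _ ul ul'G).
have harm (c e : R) : 0 <= c -> 0 < e -> \forall N \near \oo, c / N.+1%:R <= e.
  move=> c0 e0; have c1 : 0 < c + 1 by rewrite ltr_wpDl.
  apply: filterS (near_infty_natSinv_lt (PosNum (divr_gt0 e0 c1))) => N /=.
  rewrite ltr_pdivlMr// => lt; have := ltW lt; apply: le_trans.
  by rewrite mulrC ler_wpM2l// lerDl.
exists Y; split.
- move=> x; have [y0|y0] := eqVneq (rnorm (Y x)) 0.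
    by rewrite y0 mulr_ge0 ?rnorm_ge0.
  have {}y0 : 0 < rnorm (Y x) by rewrite lt_neqAle eq_sym y0 rnorm_ge0.
  rewrite -(ler_pM2l y0) -expr2 rnorm2E.
  apply/ler_addgt0Pr => e e0; have e2 : 0 < e / 2 by rewrite divr_gt0.
  pose t (N : nat) : R := rnorm (Y x) * rnorm x / N.+1%:R.
  have c0 : 0 <= rnorm (Y x) * rnorm x by rewrite mulr_ge0 ?rnorm_ge0.
  have h1 : G [set N | `|complex.Re (hdot (Y x) (Y x)) -
      complex.Re (hdot (Y x) (Z N x))| < e / 2].
    exact: (cvgrPdist_lt _ _).1 (YP x (Y x)) _ e2.
  have h2 : G [set N | t N <= e / 2].
    exact: Goo _ (harm _ _ c0 e2).
  have [N [/= u1 u2]] := @filter_ex _ G _ _ (filterI h1 h2 : G _).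
  have [Za _ _] := ZP N.
  have := le_trans (Re_hdot_le (Y x) (Z N x)) (ler_wpM2l (rnorm_ge0 _) (Za x)).
  have := le_lt_trans (ler_norm _) u1; rewrite mulrDl mulrDr.
  have -> : rnorm (Y x) * (N.+1%:R^-1 * rnorm x) = t N.
    by rewrite /t -mulrA [_^-1 * _]mulrC.
  have {}u2 : t N <= e / 2 := u2.
  by move: u2; lra.
- move=> k; apply: hdot_Re_inj => y; rewrite -adjP.
  apply: (lim _ _ _ (YP k (J' y))).
  have JZ N : complex.Re (hdot (J' y) (Z N k)) = complex.Re (hdot y (X k)).
    by have [_ JZ _] := ZP N; rewrite adjP JZ.
  by under eq_fun do rewrite JZ; exact: cvg_cst.
move=> i k; apply: hdot_Re_inj => y; rewrite -(adjPr (W' i)).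
apply/eqP; rewrite -subr_eq0; apply/eqP.
apply: (lim _ _ _ (cvgB (YP (W i k) y) (YP k (adj (W' i) y)))).
apply/cvgrPdist_le => e e0.
have c0 : 0 <= rnorm y * (a + 1) * 2 * rnorm k.
  by rewrite !mulr_ge0 ?rnorm_ge0// addr_ge0.
apply: filterS (harm _ _ c0 e0) => N /=; apply: le_trans.
rewrite sub0r normrN -[X in `|X|]/(complex.Re (hdot y (Z N (W i k))) -
  complex.Re (hdot (adj (W' i) y) (Z N k))) (adjPr (W' i)) -raddfB -linearBr.
have [_ _ /(_ i k) ZW] := ZP N.
have -> : rnorm y * (a + 1) * 2 * rnorm k / N.+1%:R =
    rnorm y * ((a + 1) * (2 / N.+1%:R) * rnorm k) by ring.
have le v : complex.Re (hdot v (Z N (W i k) - W' i (Z N k))) <=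
    rnorm v * ((a + 1) * (2 / N.+1%:R) * rnorm k).
  by rewrite (le_trans (Re_hdot_le _ _))// ler_wpM2l ?rnorm_ge0.
rewrite ler_norml le andbT lerNl -(rnormN y); apply: le_trans (le _).
by rewrite linearNl raddfN.
Qed.

End Lifting.

(** * Sums over words *)

Section Words.
Context {n : nat}.

Lemma sum_tupleS (V : nmodType) k (F : word n -> V) :
  \sum_(w : k.+1.-tuple 'I_n) F w = \sum_i \sum_(w : k.-tuple 'I_n) F (i :: w).
Proof.
rewrite pair_big /= (reindex (fun p : 'I_n * k.-tuple 'I_n => [tuple of p.1 :: p.2])) //=.
exists (fun w => (thead w, [tuple of behead w])) => [[i w] _|w _] /=.
  by congr (_, _); apply: val_inj.
by rewrite -tuple_eta.
Qed.

Lemma wsum0 (V : nmodType) (F : word n -> V) : wsum 0 F = 0.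
Proof. by rewrite /wsum big_ord0. Qed.

Lemma wsumSr (V : nmodType) N (F : word n -> V) :
  wsum N.+1 F = wsum N F + \sum_(w : N.-tuple 'I_n) F w.
Proof. by rewrite /wsum big_ord_recr. Qed.

Lemma wsumS (V : nmodType) N (F : word n -> V) :
  wsum N.+1 F = F [::] + \sum_i wsum N (fun w => F (i :: w)).
Proof.
rewrite /wsum big_ord_recl; congr (_ + _).
  by rewrite (big_pred1 [tuple]) // => w; apply/esym/eqP; exact: tuple0.
rewrite exchange_big; apply: eq_bigr => k _; exact: sum_tupleS.
Qed.

Lemma eq_wsum (V : nmodType) N (F G : word n -> V) :
  (forall w, (size w < N)%N -> F w = G w) -> wsum N F = wsum N G.
Proof.
move=> FG; apply: eq_bigr => k _; apply: eq_bigr => w _.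
by apply: FG; rewrite size_tuple.
Qed.

Lemma wsum_eq0 (V : nmodType) N (F : word n -> V) :
  (forall w, (size w < N)%N -> F w = 0) -> wsum N F = 0.
Proof.
move=> F0; rewrite (eq_wsum F0) /wsum big1 // => k _; exact: big1.
Qed.

Lemma wsum_stable (V : nmodType) N M (F : word n -> V) :
  (forall w, (N <= size w)%N -> F w = 0) -> (N <= M)%N -> wsum M F = wsum N F.
Proof.
move=> F0 /subnKC <-; elim: (M - N)%N => [|k IH]; first by rewrite addn0.
rewrite addnS wsumSr IH big1 ?addr0 // => w _.
by rewrite F0// size_tuple leq_addr.
Qed.

Lemma wsumD (V : nmodType) N (F G : word n -> V) :
  wsum N (fun w => F w + G w) = wsum N F + wsum N G.
Proof. by rewrite /wsum -big_split; apply: eq_bigr => k _; rewrite big_split. Qed.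

Lemma wsumB (V : zmodType) N (F G : word n -> V) :
  wsum N (fun w => F w - G w) = wsum N F - wsum N G.
Proof. by rewrite /wsum -sumrB; apply: eq_bigr => k _; rewrite sumrB. Qed.

Lemma raddf_wsum (V W : nmodType) (h : V -> W) N (F : word n -> V) :
  h 0 = 0 -> {morph h : x y / x + y} ->
  h (wsum N F) = wsum N (fun w => h (F w)).
Proof.
move=> h0 hD; rewrite /wsum (big_morph h hD h0); apply: eq_bigr => k _.
exact: (big_morph h hD h0).
Qed.

Lemma wsum_rcons (V : nmodType) N (F : word n -> V) :
  wsum N.+1 F = F [::] + \sum_j wsum N (fun w => F (rcons w j)).
Proof.
elim: N F => [|N IH] F; first by rewrite wsumS; under eq_bigr do rewrite wsum0;
  under [in RHS]eq_bigr do rewrite wsum0.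
rewrite wsumS; under eq_bigr do rewrite IH.
under [in RHS]eq_bigr do rewrite wsumS.
by rewrite !big_split /= exchange_big.
Qed.

End Words.

(** * Formal power series *)

Section PowerSeries.
Context {R : realType} {n : nat}.
Implicit Types (a b c d p q s : fps R n) (f : 'I_n -> fps R n) (u v w z : word n).

Definition pdelta w : fps R n := fun u => (u == w)%:R.

Definition pshift (i : 'I_n) a : fps R n := fun w => a (i :: w).

Lemma pmul_nil a b : pmul a b [::] = a [::] * b [::].
Proof. by rewrite /pmul big_ord_recl big_ord0 addr0. Qed.

Lemma pmul_cons a b i w :
  pmul a b (i :: w) = a [::] * b (i :: w) + pmul (pshift i a) b w.
Proof. by rewrite /pmul big_ord_recl. Qed.

Lemma eq_pmul a a' b b' z :
  (forall w, (size w <= size z)%N -> a w = a' w) ->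
  (forall w, (size w <= size z)%N -> b w = b' w) -> pmul a b z = pmul a' b' z.
Proof.
move=> aa' bb'; apply: eq_bigr => i _; rewrite aa' ?bb'//.
  by rewrite size_drop leq_subr.
by rewrite size_take_min geq_minr.
Qed.

Lemma pmul_suml (I : Type) (s : seq I) (F : I -> fps R n) b z :
  pmul (fun w => \sum_(i <- s) F i w) b z = \sum_(i <- s) pmul (F i) b z.
Proof.
rewrite /pmul exchange_big; apply: eq_bigr => k _; by rewrite mulr_suml.
Qed.

Lemma pmul_sumr (I : Type) (s : seq I) (F : I -> fps R n) b z :
  pmul b (fun w => \sum_(i <- s) F i w) z = \sum_(i <- s) pmul b (F i) z.
Proof.
rewrite /pmul exchange_big; apply: eq_bigr => k _; by rewrite mulr_sumr.
Qed.

Lemma pmulDl a b c z : pmul (fun w => a w + b w) c z = pmul a c z + pmul b c z.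
Proof. by rewrite /pmul -big_split; apply: eq_bigr => i _; rewrite mulrDl. Qed.

Lemma pmulZl (x : R[i]) a b z : pmul (fun w => x * a w) b z = x * pmul a b z.
Proof. by rewrite /pmul mulr_sumr; apply: eq_bigr => i _; rewrite mulrA. Qed.

Lemma pmulZr (x : R[i]) a b z : pmul a (fun w => x * b w) z = x * pmul a b z.
Proof. by rewrite /pmul mulr_sumr; apply: eq_bigr => i _; rewrite mulrCA. Qed.

Lemma pmul1l b : pmul pone b = b.
Proof.
apply/funext; case=> [|i w]; first by rewrite pmul_nil /pone eqxx mul1r.
rewrite pmul_cons /pone eqxx mul1r -[RHS]addr0; congr (_ + _).
by rewrite /pmul big1// => k _; rewrite /pshift /= mul0r.
Qed.

Lemma pmul1r a : pmul a pone = a.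
Proof.
apply/funext => w; elim: w a => [|i w IH] a.
  by rewrite pmul_nil /pone eqxx mulr1.
by rewrite pmul_cons IH /pone mulr0 add0r.
Qed.

Lemma pmulA a b c : pmul a (pmul b c) = pmul (pmul a b) c.
Proof.
apply/funext => w; elim: w a b => [|i w IH] a b; first by rewrite !pmul_nil mulrA.
rewrite !pmul_cons IH pmul_nil mulrDr !mulrA -addrA; congr (_ + _).
have -> : pshift i (pmul a b) =
    fun w => a [::] * pshift i b w + pmul (pshift i a) b w.
  by apply/funext => u; rewrite /pshift pmul_cons.
by rewrite pmulDl pmulZl.
Qed.

Lemma pmul_var_nil i b : pmul (pvar i) b [::] = 0.
Proof. by rewrite pmul_nil mul0r. Qed.

Lemma pmul_var_cons i b j w : pmul (pvar i) b (j :: w) = (j == i)%:R * b w.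
Proof.
rewrite pmul_cons mul0r add0r.
have -> : pshift j (pvar i) = fun u => (j == i)%:R * pone u.
  by apply/funext => u; rewrite /pshift /pvar /pone eqseq_cons; do 2 case: eqP;
    rewrite ?mul0r ?mul1r ?mulr0.
by rewrite pmulZl pmul1l.
Qed.

Lemma pmul_var_delta i w : pmul (pvar i) (pdelta w) = pdelta (i :: w).
Proof.
apply/funext; case=> [|j u]; first by rewrite pmul_var_nil.
by rewrite pmul_var_cons /pdelta eqseq_cons; case: eqP; rewrite ?mul0r ?mul1r.
Qed.

Lemma pword_var w : pword pvar w = pdelta w :> fps R n.
Proof. by elim: w => //= i w ->; rewrite pmul_var_delta. Qed.

Lemma pdelta_cat u v : pmul (pdelta u) (pdelta v) = pdelta (u ++ v).
Proof.
elim: u => [|i u IH]; first exact: pmul1l.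
by rewrite -pmul_var_delta -pmulA IH pmul_var_delta.
Qed.

Lemma pword_cat f u v : pword f (u ++ v) = pmul (pword f u) (pword f v).
Proof. by elim: u => [|i u IH] /=; rewrite ?pmul1l// IH pmulA. Qed.

Lemma pmul_wsuml N (F : word n -> fps R n) b z :
  pmul (fun w => wsum N (fun v => F v w)) b z = wsum N (fun v => pmul (F v) b z).
Proof.
rewrite /wsum pmul_suml; apply: eq_bigr => k _; exact: pmul_suml.
Qed.

Lemma wsum_delta (V : lmodType R[i]) N w (F : word n -> V) :
  (size w < N)%N -> wsum N (fun u => pdelta w u *: F u) = F w.
Proof.
elim: w N F => [|i w IH] [//|N] F lt; rewrite wsumS {1}/pdelta.
  rewrite eqxx scale1r big1 ?addr0// => j _; apply: wsum_eq0 => u _.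
  by rewrite /pdelta scale0r.
rewrite scale0r add0r (bigD1 i)//= big1 ?addr0 => [|j ji].
  rewrite -[RHS](IH N (fun u => F (i :: u)))//; apply: eq_wsum => u _.
  by rewrite /pdelta eqseq_cons eqxx.
by apply: wsum_eq0 => u _; rewrite /pdelta eqseq_cons (negbTE ji) scale0r.
Qed.

(** Right multiplication by the monomial [w] moves the coefficient at [u] to
    the word [u ++ w]. *)
Lemma wsum_pmul_delta (V : lmodType R[i]) N w c (F : word n -> V) :
  wsum (N + size w) (fun u => pmul c (pdelta w) u *: F u) =
  wsum N (fun u => c u *: F (u ++ w)).
Proof.
elim: N c F => [|N IH] c F.
  rewrite wsum0 add0n; apply: wsum_eq0 => u uw.
  rewrite /pmul big1 ?scale0r// => k _; rewrite /pdelta.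
  case: eqP => [dw|_]; last by rewrite mulr0.
  by move: uw; rewrite -dw size_drop ltnNge leq_subr.
rewrite addSn wsumS [RHS]wsumS.
under [in LHS]eq_bigr => i _.
  under eq_wsum => u _ do rewrite pmul_cons scalerDl.
  rewrite wsumD (IH (pshift i c) (fun u => F (i :: u))).
over.
rewrite big_split addrA; congr (_ + _).
have lt : (size w < (N + size w).+1)%N by rewrite ltnS leq_addl.
have := wsum_delta F lt; rewrite wsumS => <-.
rewrite scalerDr scaler_sumr pmul_nil scalerA; congr (_ + _).
apply: eq_bigr => i _; rewrite raddf_wsum ?scaler0//; last first.
  by move=> x y; rewrite scalerDr.
by apply: eq_wsum => u _; rewrite scalerA.
Qed.

Lemma formal_sumP f c s : formal_sum f c s <->
  exists N : word n -> nat, forall z M, (N z <= M)%N ->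
    wsum M (fun u => c u * pword f u z) = s z.
Proof.
split=> [h|[N NP] z]; last by exists (N z) => // M /=; exact: NP.
have /choice[N NP] (z : word n) : exists N, forall M, (N <= M)%N ->
    wsum M (fun u => c u * pword f u z) = s z.
  by have [N _ NP] := h z; exists N => M NM; exact: NP.
by exists N.
Qed.

Lemma formal_sum_delta f w : formal_sum f (pdelta w) (pword f w).
Proof.
apply/formal_sumP; exists (fun=> (size w).+1) => z M wM.
exact: (wsum_delta (V := R[i]^o) (fun u => pword f u z) wM).
Qed.

Lemma formal_sum_unique f c s s' : formal_sum f c s -> formal_sum f c s' -> s = s'.
Proof.
move=> /formal_sumP[N h] /formal_sumP[N' h']; apply/funext => z.
by rewrite -(h z (maxn (N z) (N' z))) ?leq_maxl// h'// leq_maxr.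
Qed.

Lemma formal_sum_mulr f c s w : formal_sum f c s ->
  formal_sum f (pmul c (pdelta w)) (pmul s (pword f w)).
Proof.
move=> /formal_sumP[N h]; apply/formal_sumP.
exists (fun z => (\max_(i < (size z).+1) N (take i z) + size w)%N) => z M BM.
rewrite -(subnK (leq_trans (leq_addl _ _) BM)).
set M' := (M - size w)%N.
have BM' : (\max_(i < (size z).+1) N (take i z) <= M')%N.
  by rewrite leq_subRL ?(leq_trans (leq_addl _ _) BM)// addnC.
rewrite (wsum_pmul_delta (V := R[i]^o) M' w c (fun u => pword f u z)).
under eq_wsum do rewrite pword_cat.
transitivity (pmul (fun y => wsum M' (fun u => c u * pword f u y)) (pword f w) z).
  rewrite (pmul_wsuml _ (fun u y => c u * pword f u y)).
  by apply: eq_wsum => u _; rewrite pmulZl.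
apply: eq_bigr => i _; congr (_ * _); apply: h.
exact: leq_trans (leq_bigmax i) BM'.
Qed.

Section LeadingTerms.
Variable f : 'I_n -> fps R n.
Hypotheses (f0 : forall i, f i [::] = 0) (fJ : \det (jacobian0 f) != 0).

Lemma pword_low v z : (size z < size v)%N -> pword f v z = 0.
Proof.
elim: v z => [//|i v IH] z zv; rewrite /= /pmul big1// => k _.
have [k0|k0] := posnP k; first by rewrite k0 take0 f0 mul0r.
rewrite IH ?mulr0// size_drop.
have kz : (k <= size z)%N by rewrite -ltnS ltn_ord.
by rewrite (@leq_trans (size z))// ltn_subrL k0 (leq_trans k0 kz).
Qed.

Lemma pword_leading i v j z : size z = size v ->
  pword f (i :: v) (j :: z) = f i [:: j] * pword f v z.
Proof.
move=> zv; rewrite /= pmul_cons f0 mul0r add0r.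
rewrite /pmul big_ord_recl /= drop0 take0 big1 ?addr0// => k _.
rewrite [pword f v _]pword_low ?mulr0// size_drop /= -zv.
by rewrite ltn_subrL /= (leq_ltn_trans _ (ltn_ord k)).
Qed.

(** The leading homogeneous part of [sum_v d_v f_v] is obtained from that of [d]
    by the linear substitution [J_f(0)], applied one letter at a time. *)
Lemma leading_inj k d :
  (forall z, size z = k -> \sum_(v : k.-tuple 'I_n) d v * pword f v z = 0) ->
  forall v, size v = k -> d v = 0.
Proof.
elim: k d => [|k IH] d d0 v vk.
  have := d0 [::] erefl; rewrite (big_pred1 [tuple]); last first.
    by move=> w; apply/esym/eqP; exact: tuple0.
  by move: vk => /size0nil ->; rewrite /= /pone eqxx mulr1.
case: v vk => // l v [vk]; apply: (IH (pshift l d)) => // z zk.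
pose T i := \sum_(v : k.-tuple 'I_n) d (i :: v) * pword f v z.
have JT j : \sum_i jacobian0 f i j * T i = 0.
  rewrite -[RHS](d0 (j :: z)) /= ?zk//.
  rewrite (sum_tupleS k (fun v => d v * pword f v (j :: z))); apply: eq_bigr => i _.
  rewrite mxE mulr_sumr; apply: eq_bigr => w _.
  by rewrite pword_leading ?size_tuple// mulrCA.
have Junit : jacobian0 f \in unitmx by rewrite unitmxE unitfE.
have : \row_i T i = 0.
  rewrite -[LHS]mulmx1 -(mulmxV Junit) mulmxA.
  have -> : \row_i T i *m jacobian0 f = 0.
    apply/rowP => j; rewrite !mxE -[RHS](JT j); apply: eq_bigr => i _.
    by rewrite mxE mulrC.
  by rewrite mul0mx.
by move=> /rowP/(_ l); rewrite !mxE.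
Qed.

(** By induction on the length of words: the lowest homogeneous part of the
    difference of [c] and [c'] has leading part [0] after substitution. *)
Lemma formal_inj c c' s : formal_sum f c s -> formal_sum f c' s -> c = c'.
Proof.
move=> /formal_sumP[N h] /formal_sumP[N' h']; pose d v := c v - c' v.
have d_eq0 z : exists2 M, (size z < M)%N & wsum M (fun v => d v * pword f v z) = 0.
  exists (maxn (size z).+1 (maxn (N z) (N' z))); first by rewrite leq_maxl.
  under eq_wsum do rewrite mulrBl.
  rewrite wsumB h ?h' ?subrr//; first by rewrite !leq_max leqnn !orbT.
  by rewrite !leq_max leqnn !orbT.
suff d0 k v : size v = k -> d v = 0.
  by apply/funext => v; apply/eqP; rewrite -subr_eq0; apply/eqP/(d0 (size v)).
have [m km] := ubnP k; elim: m k km v => // m IH k; rewrite ltnS => km.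
apply: leading_inj => z zk; have [M zM MP] := d_eq0 z.
have kM : (k < M)%N by rewrite -zk.
rewrite -[RHS]MP /wsum (bigD1 (Ordinal kM))//= [X in _ + X]big1 ?addr0// => j jk.
apply: big1 => w _; have := size_tuple w; have [jk'|kj|e] := ltngtP j k.
- by move=> wj; rewrite (IH j (leq_trans jk' km))// mul0r.
- by move=> wj; rewrite pword_low ?mulr0// wj zk.
- by case/negP: jk; apply/eqP/val_inj.
Qed.

End LeadingTerms.

End PowerSeries.

(** * Substitution in polynomials *)

Section PolynomialEvaluation.
Context {R : realType} {n : nat} {E : hilbertType R}.
Implicit Types (a b c p : fps R n) (X : 'I_n -> bop E E).

Lemma psumS a X N x : psum a X N.+1 x =
  a [::] *: x + \sum_i X i (psum (pshift i a) X N x).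
Proof.
rewrite /psum wsumS; congr (_ + _); apply: eq_bigr => i _.
rewrite [RHS]raddf_wsum ?bop0//; last exact: bopD.
by apply: eq_wsum => w _; rewrite bopZ.
Qed.

Lemma psum_stable a X N M x : (forall w, (N <= size w)%N -> a w = 0) ->
  (N <= M)%N -> psum a X M x = psum a X N x.
Proof. by move=> aN; apply: wsum_stable => w /aN ->; rewrite scale0r. Qed.

Lemma psumD a b X N x : psum (fun w => a w + b w) X N x = psum a X N x + psum b X N x.
Proof. by rewrite -wsumD; apply: eq_wsum => w _; rewrite scalerDl. Qed.

Lemma psumZ (t : R[i]) a X N x : psum (fun w => t * a w) X N x = t *: psum a X N x.
Proof.
rewrite [RHS]raddf_wsum ?scaler0//; last by move=> y z; rewrite scalerDr.
by apply: eq_wsum => w _; rewrite scalerA.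
Qed.

(** Both factors are polynomials, and the truncation order reaches the sum of the
    degrees, so that no term of the product is lost. *)
Lemma psum_pmul A B a b X M x : (forall w, (A <= size w)%N -> a w = 0) ->
  (forall w, (B <= size w)%N -> b w = 0) -> (A + B <= M)%N ->
  psum (pmul a b) X M x = psum a X A (psum b X B x).
Proof.
move=> + bB; elim: A a M => [|A IH] a M aA.
  move=> _; rewrite [RHS]/psum wsum0 /psum wsum_eq0// => w _.
  by rewrite /pmul big1 ?scale0r// => k _; rewrite aA ?mul0r.
case: M => [//|M]; rewrite addSn ltnS => ABM.
have BM : (B <= M.+1)%N by rewrite (leq_trans (leq_addl A B))// leqW.
rewrite !psumS pmul_nil -[in RHS](psum_stable X _ bB BM) psumS scalerDr scalerA.
rewrite -addrA; congr (_ + _); rewrite scaler_sumr -big_split; apply: eq_bigr => i _.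
have -> : pshift i (pmul a b) =
    fun w => a [::] * pshift i b w + pmul (pshift i a) b w.
  by apply/funext => u; rewrite /pshift pmul_cons.
rewrite psumD psumZ bopD bopZ; congr (_ + X i _).
rewrite IH// => [|w wA]; last exact: aA.
by rewrite -psumS (psum_stable X _ bB BM).
Qed.

Lemma pmul_support A B a b : (forall w, (A <= size w)%N -> a w = 0) ->
  (forall w, (B <= size w)%N -> b w = 0) ->
  forall w, (A + B <= size w)%N -> pmul a b w = 0.
Proof.
move=> aA bB w ABw.
rewrite /pmul big1// => k _; have [Ak|kA] := leqP A k.
  by rewrite aA ?mul0r// size_takel// -ltnS ltn_ord.
have kB : (k + B <= size w)%N by rewrite (leq_trans _ ABw)// leq_add2r ltnW.
by rewrite bB ?mulr0// size_drop leq_subRL// (leq_trans (leq_addr B k)).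
Qed.

Lemma is_poly_pmul a b : is_poly a -> is_poly b -> is_poly (pmul a b).
Proof. by move=> [A aA] [B bB]; exists (A + B)%N; exact: pmul_support. Qed.

Lemma is_poly_delta w : is_poly (pdelta w : fps R n).
Proof.
exists (size w).+1 => u; rewrite /pdelta; case: eqP => // ->.
by rewrite ltnn.
Qed.

(** A finite sum, so that the value exists for every [X] and composition can be
    computed exactly, before any limit is taken. *)
Definition poly_eval a X (F : E -> E) := exists N,
  (forall w, (N <= size w)%N -> a w = 0) /\ forall x, psum a X N x = F x.

Lemma poly_eval_mul a b X F G :
  poly_eval a X F -> poly_eval b X G -> poly_eval (pmul a b) X (F \o G).
Proof.
move=> [A [aA FE]] [B [bB GE]]; exists (A + B)%N; split=> [|x].
  exact: pmul_support.
by rewrite (psum_pmul _ _ aA bB)// /= GE FE.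
Qed.

Lemma poly_eval_add a b X F G : poly_eval a X F -> poly_eval b X G ->
  poly_eval (fun w => a w + b w) X (fun x => F x + G x).
Proof.
move=> [A [aA FE]] [B [bB GE]]; exists (maxn A B); split=> [w|x].
  by rewrite geq_max => /andP[Aw Bw]; rewrite aA// bB// addr0.
by rewrite psumD (psum_stable _ _ aA (leq_maxl _ _)) (psum_stable _ _ bB (leq_maxr _ _)) FE GE.
Qed.

Lemma poly_eval_scale (t : R[i]) a X F : poly_eval a X F ->
  poly_eval (fun w => t * a w) X (fun x => t *: F x).
Proof.
move=> [A [aA FE]]; exists A; split=> [w Aw|x]; first by rewrite aA ?mulr0.
by rewrite psumZ FE.
Qed.

Lemma poly_eval_sum (I : Type) (s : seq I) (a : I -> fps R n) X F :
  (forall i, poly_eval (a i) X (F i)) ->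
  poly_eval (fun w => \sum_(i <- s) a i w) X (fun x => \sum_(i <- s) F i x).
Proof.
move=> aF; elim: s => [|i s IH].
  exists 0%N; split=> [w _|x]; first by rewrite big_nil.
  by rewrite big_nil /psum wsum0.
under eq_fun do rewrite big_cons.
under [X in poly_eval _ _ X]eq_fun do rewrite big_cons.
exact: poly_eval_add.
Qed.

Lemma poly_eval_word f X (F : 'I_n -> bop E E) v :
  (forall i, poly_eval (f i) X (F i)) -> poly_eval (pword f v) X (opword F v).
Proof.
move=> fF; elim: v => [|i v IH]; last exact: (poly_eval_mul (fF i) IH).
exists 1%N; split=> [[|i w]//|x].
by rewrite psumS big1 ?addr0 => [|i _]; rewrite ?/pone ?eqxx ?scale1r// /psum wsum0 bop0.
Qed.

(** Evaluation at operators turns composition of polynomials into composition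
    of the values. *)
Lemma poly_eval_comp f c p X (F : 'I_n -> bop E E) A :
  (forall i, poly_eval (f i) X (F i)) -> (forall w, (A <= size w)%N -> c w = 0) ->
  formal_sum f c p -> poly_eval p X (psum c F A).
Proof.
move=> fF cA /formal_sumP[N h].
have -> : p = fun z => wsum A (fun u => c u * pword f u z).
  apply/funext => z; rewrite -(h z (maxn (N z) A)) ?leq_maxl//.
  by apply: wsum_stable (leq_maxr _ _) => w /cA ->; rewrite mul0r.
rewrite /psum /wsum; apply: poly_eval_sum => k; apply: poly_eval_sum => w.
exact/poly_eval_scale/poly_eval_word.
Qed.

Lemma poly_eval_norm a X (F : bop E E) : poly_eval a X F -> norm_eval a X F.
Proof.
move=> [N [aN FE]]; apply/norm_evalP => e e0; exists N => // M /= NM x.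
rewrite (psum_stable _ _ aN NM) FE subrr rnorm0 mulr_ge0 ?rnorm_ge0//.
exact: ltW.
Qed.

Lemma poly_eval_unique a X F G : poly_eval a X F -> poly_eval a X G -> F =1 G.
Proof.
move=> [A [aA FE]] [B [bB GE]] x; rewrite -FE -GE.
by rewrite -(psum_stable _ _ aA (leq_maxl A B)) -(psum_stable _ _ bB (leq_maxr A B)).
Qed.

Lemma poly_eval_delta w X : poly_eval (pdelta w) X (opword X w).
Proof.
exists (size w).+1; split=> [u|x]; last exact: (wsum_delta (fun u => opword X u x)).
by rewrite /pdelta; case: eqP => // ->; rewrite ltnn.
Qed.

Lemma poly_eval_var i X : poly_eval (pvar i) X (X i).
Proof. exact: (poly_eval_delta [:: i]). Qed.

Lemma is_poly_eval a X : is_poly a -> exists F : bop E E, poly_eval a X F.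
Proof. by move=> [N aN]; exists (bpsum a X N), N. Qed.

End PolynomialEvaluation.

(** * Orthonormal bases indexed by words *)

Section Basis.
Context {R : realType} {n : nat} {E : hilbertType R} (e : word n -> E).
Hypothesis eB : orthonormal_basis e.
Implicit Types (a c : fps R n) (u v w z : word n).

Lemma hdot_wsuml N (F : word n -> E) y :
  hdot (wsum N F) y = wsum N (fun w => hdot (F w) y).
Proof.
by rewrite (raddf_wsum (h := fun x => hdot x y)) ?linear0l// => x x'; rewrite linearDl.
Qed.

Lemma coord_basis w : coord e (e w) = pdelta w.
Proof. by apply/funext => u; rewrite /coord eB.1 eq_sym. Qed.

Lemma coordD x y w : coord e (x + y) w = coord e x w + coord e y w.
Proof. by rewrite /coord linearDl. Qed.

Lemma coordZ (a : R[i]) x w : coord e (a *: x) w = a * coord e x w.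
Proof. by rewrite /coord linearZl_LR. Qed.

Lemma wsum_indicator (V : lmodType R[i]) N z (F : word n -> V) :
  wsum N (fun w => (w == z)%:R *: F w) = if (size z < N)%N then F z else 0.
Proof.
case: ifP => zN; first exact: (wsum_delta F zN).
apply: wsum_eq0 => w wN; case: eqP => [wz|]; last by rewrite scale0r.
by rewrite wz zN in wN.
Qed.

Lemma coord_wsum N c z :
  hdot (wsum N (fun w => c w *: e w)) (e z) = if (size z < N)%N then c z else 0.
Proof.
rewrite hdot_wsuml -(wsum_indicator (V := R[i]^o)); apply: eq_wsum => w _.
by rewrite linearZl_LR /= eB.1 mulrC.
Qed.

Lemma rnorm_wsum N c : rnorm (wsum N (fun w => c w *: e w)) ^+ 2 =
  wsum N (fun w => complex.Re `|c w| ^+ 2).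
Proof.
rewrite rnorm2E hdot_wsuml (raddf_wsum (h := @complex.Re R))//; last exact: raddfD.
apply: eq_wsum => w wN; rewrite linearZl_LR /= hdotC coord_wsum wN -normCK.
have /RRe_real {1}<- : `|c w| \is Num.real by rewrite normr_real.
by rewrite -rmorphXn.
Qed.

Lemma bessel N x : rnorm (wsum N (fun w => coord e x w *: e w)) <= rnorm x.
Proof.
set y := wsum _ _; have [->|y0] := eqVneq (rnorm y) 0; first exact: rnorm_ge0.
have {}y0 : 0 < rnorm y by rewrite lt_neqAle eq_sym y0 rnorm_ge0.
rewrite -(ler_pM2l y0) -expr2 rnorm2E.
suff -> : hdot y y = hdot y x by exact: Re_hdot_le.
rewrite /y !hdot_wsuml; apply: eq_wsum => w wN; rewrite !linearZl_LR /=.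
by rewrite [in LHS]hdotC coord_wsum wN [in RHS]hdotC.
Qed.

Lemma coord_square_summable x : square_summable (coord e x).
Proof.
exists (rnorm x ^+ 2) => N.
rewrite -[leLHS]/(wsum N (fun w => complex.Re `|coord e x w| ^+ 2)) -rnorm_wsum.
by rewrite ler_pXn2r ?nnegrE ?rnorm_ge0// bessel.
Qed.

Lemma coord_inj x y : coord e x = coord e y -> x = y.
Proof.
move=> xy; apply: rcvg_unique (eB.2 x) _.
under eq_fun do (under eq_wsum => w _ do rewrite -[hdot x _]/(coord e x w) xy).
exact: eB.2.
Qed.

Lemma bop_wsum (K : hilbertType R) (A : bop E K) N (F : word n -> E) :
  A (wsum N F) = wsum N (fun w => A (F w)).
Proof. by rewrite (raddf_wsum (h := A)) ?bop0//; exact: bopD. Qed.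

Lemma bop_basis_eq (K : hilbertType R) (A B : bop E K) :
  (forall w, A (e w) = B (e w)) -> A = B.
Proof.
move=> AB; apply: bop_ext => x.
apply: rcvg_unique (bop_cvg A (eB.2 x)) _.
have AwB N : A (wsum N (fun w => hdot x (e w) *: e w)) =
    B (wsum N (fun w => hdot x (e w) *: e w)).
  by rewrite !bop_wsum; apply: eq_wsum => w _; rewrite !bopZ AB.
under eq_fun do rewrite AwB.
exact: bop_cvg (eB.2 x).
Qed.

Lemma rnorm_basis w : rnorm (e w) = 1.
Proof.
apply/eqP; rewrite -(@eqrXn2 _ 2) ?rnorm_ge0//.
by rewrite rnorm2E eB.1 eqxx expr1n.
Qed.

Lemma coord_lim (u : nat -> E) y z (t : R[i]) :
  u @ \oo --> y -> (\forall M \near \oo, coord e (u M) z = t) -> coord e y z = t.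
Proof.
move=> /rcvgP uy ut; apply/eqP; rewrite -subr_eq0; apply/eqP.
apply: (@rnorm_small _ R[i]^o) => eps e0.
have [M [uM <-]] := @filter_ex _ \oo _ _ (filterI (uy eps e0) ut).
rewrite /coord -linearBl -lecR -rnormE.
apply: le_trans (cauchy_schwarz _ _) _.
by rewrite !rnormE rnorm_basis mulr1 lecR ltW.
Qed.

(** In coordinates, [A] is left multiplication by the series [a]. A coefficient
    of a product only depends on coefficients at words that are not longer, which
    gives the notion a meaning up to length [N]; nilpotent operators satisfy it in this
    truncated form only. *)
Definition sym_upto N (A : E -> E) a :=
  forall x z, (size z <= N)%N -> coord e (A x) z = pmul a (coord e x) z.

Lemma sym_word N (Y : 'I_n -> bop E E) (a : 'I_n -> fps R n) w :
  (forall i, sym_upto N (Y i) (a i)) -> sym_upto N (opword Y w) (pword a w).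
Proof.
move=> Ya; elim: w => [|i w IH] x z zN /=; first by rewrite pmul1l.
rewrite Ya// -pmulA; apply: eq_pmul => // v vz.
by rewrite IH// (leq_trans vz zN).
Qed.

Lemma sym_psum N (Y : 'I_n -> bop E E) (a : 'I_n -> fps R n) c M :
  (forall i, sym_upto N (Y i) (a i)) ->
  sym_upto N (psum c Y M) (fun z => wsum M (fun v => c v * pword a v z)).
Proof.
move=> Ya x z zN; rewrite (pmul_wsuml _ (fun v z => c v * pword a v z)).
rewrite /coord hdot_wsuml; apply: eq_wsum => v _.
by rewrite linearZl_LR /= pmulZl -(sym_word _ Ya).
Qed.

Lemma sym_lim N (Y : 'I_n -> bop E E) (a : 'I_n -> fps R n) c (B : bop E E) s :
  (forall i, sym_upto N (Y i) (a i)) -> sot_eval c Y B ->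
  (forall z, (size z <= N)%N ->
     exists M0, forall M, (M0 <= M)%N -> wsum M (fun v => c v * pword a v z) = s z) ->
  sym_upto N B s.
Proof.
move=> Ya YB cs x z zN; apply: (coord_lim (YB x)).
have /choice[M0 M0P] (v : word n) : exists M0, (size v <= N)%N ->
    forall M, (M0 <= M)%N -> wsum M (fun u => c u * pword a u v) = s v.
  have [vN|_] := boolP (size v <= N)%N; last by exists 0%N.
  by have [M0 M0P] := cs v vN; exists M0.
exists (\max_(i < (size z).+1) M0 (take i z)) => // M /= MM.
rewrite (sym_psum c M Ya x zN); apply: eq_bigr => i _; congr (_ * _).
rewrite M0P//; last exact: leq_trans (leq_bigmax i) MM.
by rewrite (leq_trans _ zN)// size_take_min geq_minr.
Qed.

(** Truncated left creation operators. Being nilpotent, they can be substituted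
    in any power series, and they detect its coefficients up to degree [N]. *)
Definition trunc_shift N (i : 'I_n) : E -> E :=
  fun x => wsum N (fun w => hdot x (e w) *: e (i :: w)).

Lemma trunc_shift_linear N i : linear (trunc_shift N i).
Proof.
move=> a x y; rewrite /trunc_shift.
rewrite (raddf_wsum (h := fun x => a *: x)) ?scaler0//; last first.
  by move=> x' y'; rewrite scalerDr.
rewrite -wsumD.
by apply: eq_wsum => w _; rewrite linearDl linearZl_LR scalerDl scalerA.
Qed.

Lemma trunc_shift_bounded N i :
  exists M : R, forall x, rnorm (trunc_shift N i x) <= M * rnorm x.
Proof.
exists (\sum_(k < N) \sum_(w : k.-tuple 'I_n) 1) => x; rewrite mulr_suml.
rewrite (le_trans (rnorm_sum _ _ _))//; apply: ler_sum => k _; rewrite mulr_suml.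
rewrite (le_trans (rnorm_sum _ _ _))//; apply: ler_sum => w _; rewrite mul1r.
rewrite rnormZ rnorm_basis mulr1 -lecR RRe_real ?normr_real//.
by rewrite (le_trans (cauchy_schwarz _ _))// !rnormE rnorm_basis mulr1.
Qed.

Definition btrunc_shift N i : bop E E :=
  Bop (trunc_shift_linear N i) (trunc_shift_bounded N i).

Lemma btrunc_shift_sym N i : sym_upto N (btrunc_shift N i) (pvar i).
Proof.
move=> x [|j z] zN; rewrite /coord hdot_wsuml.
  rewrite pmul_var_nil; apply: wsum_eq0 => w _.
  by rewrite linearZl_LR /= eB.1 mulr0.
rewrite pmul_var_cons.
transitivity (wsum N (fun w =>
    (w == z)%:R *: ((j == i)%:R * hdot x (e w) : R[i]^o))).
  apply: eq_wsum => w _; rewrite linearZl_LR /= eB.1 eqseq_cons mulrC eq_sym.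
  by case: (j == i); rewrite ?mul0r ?scaler0 ?mul1r.
by rewrite wsum_indicator zN.
Qed.

(** A family of [m + 1] basis vectors in the span of [m] vectors would be
    linearly dependent. *)
Lemma basis_infinite_dim : (0 < n)%N -> infinite_dim E.
Proof.
case: n e eB => // n' e' e'B _ m v; apply/not_existsP => /= h.
pose g (k : nat) := e' (nseq k ord0).
have /choice[c cP] (k : 'I_m.+1) : exists c : 'I_m -> R[i], g k = \sum_j c j *: v j.
  by have /existsNP[c /contrapT gk] := h (g k); exists c.
pose A : 'M[R[i]]_(m.+1, m) := \matrix_(k, j) c k j.
have : ~~ row_free A.
  by rewrite /row_free neq_ltn (leq_ltn_trans (rank_leq_col A)).
rewrite -kermx_eq0 => /rowV0Pn[a /sub_kermxP aA].
move=> /eqP; apply; apply/rowP => l; rewrite mxE.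
have g0 : \sum_k a 0 k *: g k = 0.
  under eq_bigr do rewrite cP scaler_sumr.
  rewrite exchange_big big1// => j _.
  have := congr1 (fun M : 'rV_m => M 0 j) aA; rewrite !mxE => aA0.
  under eq_bigr do rewrite scalerA.
  have ac0 : \sum_k a 0 k * c k j = 0.
    by rewrite -[RHS]aA0; apply: eq_bigr => k _; rewrite mxE.
  by rewrite -scaler_suml ac0 scale0r.
have : hdot (\sum_k a 0 k *: g k) (g l) = 0 by rewrite g0 linear0l.
rewrite linear_sumlz (bigD1 l)//= big1 ?addr0 => [|k kl].
  by rewrite linearZl_LR /= e'B.1 eqxx mulr1.
rewrite linearZl_LR /= e'B.1; case: eqP => [/(congr1 size)|_]; last by rewrite mulr0.
by rewrite !size_nseq => /val_inj kl'; rewrite kl' eqxx in kl.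
Qed.

Lemma opball_scale (gamma : R) (S : 'I_n -> bop E E) : 0 < gamma ->
  exists2 t : R, 0 < t & opball gamma (scale_tuple t S).
Proof.
move=> g0; pose C := \sum_i opnorm (S i).
have C0 : 0 <= C by apply: sumr_ge0 => i _; exact: bop_opnorm_ge0.
have SC i : bounded_by C (S i).
  move=> x; rewrite (le_trans (bop_opnorm (S i) x))// ler_wpM2r ?rnorm_ge0//.
  by rewrite /C (bigD1 i)//= lerDl sumr_ge0// => j _; exact: bop_opnorm_ge0.
(* The summand 1 keeps [D] positive when [C = 0]. *)
pose D := n%:R * C ^+ 2 + 1.
have D1 : 1 <= D by rewrite lerDr mulr_ge0 ?sqr_ge0.
have D0 : 0 < D := lt_le_trans ltr01 D1.
pose t := gamma / (2 * D).
have t0 : 0 < t by rewrite divr_gt0 ?mulr_gt0.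
exists t => //; rewrite /opball.
have tC0 : 0 <= t * C by rewrite mulr_ge0 ?(ltW t0).
have tC i : bounded_by (t * C) (scale_tuple t S i).
  by move=> x; rewrite /= rnormZr gtr0_norm// -mulrA ler_pM2l// SC.
have le : opnorm (fun x => \sum_i scale_tuple t S i (adj (scale_tuple t S i) x)) <=
    n%:R * (t * C) ^+ 2.
  apply: opnorm_le; first by rewrite mulr_ge0 ?sqr_ge0.
  move=> x; rewrite (le_trans (rnorm_sum _ _ _))// -mulrA -[n in n%:R]card_ord.
  rewrite mulr_natl -sumr_const; apply: ler_sum => i _.
  apply: le_trans (tC i _) _; rewrite expr2 -[leRHS]mulrA ler_wpM2l//.
  exact: (adj_bounded tC0 (tC i)).
apply: (@le_lt_trans _ _ (Num.sqrt (n%:R * (t * C) ^+ 2))).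
  by rewrite ler_sqrt// mulr_ge0 ?sqr_ge0.
rewrite -[ltRHS]ger0_norm ?(ltW g0)// -sqrtr_sqr ltr_sqrt ?exprn_gt0//.
have -> : n%:R * (t * C) ^+ 2 = gamma ^+ 2 * ((D - 1) / (4 * D ^+ 2)).
  by rewrite /t /D; field; rewrite -/D gt_eqF.
rewrite gtr_pMr ?exprn_gt0// ltr_pdivrMr ?mulr_gt0 ?exprn_gt0// mul1r.
by nra.
Qed.

End Basis.

(** * Unitary equivalence of orthonormal bases *)

Section Unitary.
Context {R : realType} {n : nat} {E1 E2 : hilbertType R}.
Variables (e1 : word n -> E1) (e2 : word n -> E2).
Hypotheses (e1B : orthonormal_basis e1) (e2B : orthonormal_basis e2).

Lemma wsum_tail (V : zmodType) (F : word n -> V) m k : (k <= m)%N ->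
  wsum m F - wsum k F = wsum m (fun w => if (size w < k)%N then 0 else F w).
Proof.
move=> km.
have -> : wsum k F = wsum m (fun w => if (size w < k)%N then F w else 0).
  rewrite (wsum_stable _ km) => [|w kw]; last by rewrite ltnNge kw.
  by apply: eq_wsum => w ->.
by rewrite -wsumB; apply: eq_wsum => w _; case: ifP; rewrite ?subrr ?subr0.
Qed.

(** Partial sums of orthogonal expansions with the same coefficients are at the
    same distance in both spaces, so one is Cauchy when the other is. *)
Lemma onb_unitary : exists U : bop E1 E2,
  [/\ forall w, U (e1 w) = e2 w, forall x, adj U (U x) = x &
      forall y, U (adj U y) = y].
Proof.
pose y1 x N := wsum N (fun w => coord e1 x w *: e1 w).
pose y2 x N := wsum N (fun w => coord e1 x w *: e2 w).
have dist x m k : rnorm (y2 x m - y2 x k) = rnorm (y1 x m - y1 x k).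
  wlog km : m k / (k <= m)%N.
    move=> h; have [|/ltnW mk] := leqP k m; first exact: h.
    by rewrite rnorm_dist [RHS]rnorm_dist h.
  apply/eqP; rewrite -(@eqrXn2 _ 2) ?rnorm_ge0//.
  pose c w := if (size w < k)%N then 0 else coord e1 x w.
  have tailE (E : hilbertType R) (e : word n -> E) :
      wsum m (fun w => coord e1 x w *: e w) - wsum k (fun w => coord e1 x w *: e w) =
      wsum m (fun w => c w *: e w).
    rewrite wsum_tail//; apply: eq_wsum => w _; rewrite /c.
    by case: ifP; rewrite ?scale0r.
  by rewrite /y1 /y2 !tailE (rnorm_wsum e1B) (rnorm_wsum e2B).
have y1x x : y1 x @ \oo --> x by exact: e1B.2.
have /choice[U UP] (x : E1) : exists y : E2, y2 x @ \oo --> y.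
  apply: cauchy_rcvg => eps e0; have e2' : 0 < eps / 2 by rewrite divr_gt0.
  have [N _ NP] := (rcvgP _ _).1 (y1x x) _ e2'.
  exists N => m k Nm Nk; rewrite dist.
  have := rnorm_triangle x (y1 x m) (y1 x k); rewrite (rnorm_dist _ x).
  by have := NP m Nm; have := NP k Nk; rewrite /=; lra.
have Ulin : linear U.
  move=> a x y; apply: rcvg_unique (UP _) _.
  have y2P N : y2 (a *: x + y) N = a *: y2 x N + y2 y N.
    rewrite /y2 (raddf_wsum (h := fun x => a *: x)) ?scaler0//; last first.
      by move=> x' y'; rewrite scalerDr.
    rewrite -wsumD.
    by apply: eq_wsum => w _; rewrite coordD coordZ scalerDl scalerA.
  rewrite (funext y2P : y2 (a *: x + y) = fun N => a *: y2 x N + y2 y N).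
  by apply: cvgD (UP y); apply: cvgZl_tmp (UP x).
have Ubnd : exists M : R, forall x, rnorm (U x) <= M * rnorm x.
  exists 1 => x; rewrite mul1r; apply: (rnorm_cvg_le (UP x)).
  apply: nearW => N; rewrite -[y2 x N]subr0.
  have -> : 0 = y2 x 0 by rewrite /y2 wsum0.
  by rewrite dist /y1 wsum0 subr0 (bessel e1B).
pose Ub := Bop Ulin Ubnd.
have Ue w : Ub (e1 w) = e2 w.
  apply: rcvg_unique (UP (e1 w)) _; apply: (@cvg_near_cst); exists (size w).+1 => // N /= wN.
  by rewrite /y2 (coord_basis e1B) (wsum_delta e2 wN).
have U'e w : adj Ub (e2 w) = e1 w.
  apply: (coord_inj e1B); apply/funext => u.
  by rewrite /coord adjPr Ue e1B.1 e2B.1.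
exists Ub; split=> // [x|y].
  suff h : bid E1 = bcomp (adj Ub) Ub.
    exact: (congr1 (fun B : bop E1 E1 => B x) (esym h)).
  by apply: (bop_basis_eq e1B) => w; rewrite -[RHS]/(adj Ub (Ub (e1 w))) Ue U'e.
suff h : bid E2 = bcomp Ub (adj Ub).
  exact: (congr1 (fun B : bop E2 E2 => B y) (esym h)).
by apply: (bop_basis_eq e2B) => w; rewrite -[RHS]/(Ub (adj Ub (e2 w))) U'e Ue.
Qed.

End Unitary.

(** * Square summable coefficients *)

Section SquareSummable.
Context {R : realType} {n : nat}.
Implicit Types (a c : fps R n).

Lemma sqnorm_ge0 a k : 0 <= sqnorm a k.
Proof. by apply: sumr_ge0 => w _; exact: sqr_ge0. Qed.

Lemma is_poly_square_summable a : is_poly a -> square_summable a.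
Proof.
move=> [A aA]; pose F (w : word n) := complex.Re `|a w| ^+ 2.
exists (wsum A F) => N; rewrite -[leLHS]/(wsum N F).
have F0 w : (A <= size w)%N -> F w = 0 by move=> /aA; rewrite /F => ->; rewrite normr0 expr0n.
rewrite -(wsum_stable F0 (leq_addl N A)) /wsum big_split_ord /= lerDl.
by apply: sumr_ge0 => k _; apply: sumr_ge0 => w _; exact: sqr_ge0.
Qed.

Lemma square_summableB a c : square_summable a -> square_summable c ->
  square_summable (fun w => a w - c w).
Proof.
have aux (x y z : R) : 0 <= z -> z <= x + y -> z ^+ 2 <= 2 * x ^+ 2 + 2 * y ^+ 2.
  move=> z0 zxy; have : z ^+ 2 <= (x + y) ^+ 2.
    by rewrite ler_pXn2r ?nnegrE// (le_trans z0).
  by have := sqr_ge0 (x - y); rewrite !expr2; lra.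
move=> [A aA] [C cC]; exists (2 * A + 2 * C) => N.
have := lerD (ler_wpM2l (ler0n R 2) (aA N)) (ler_wpM2l (ler0n R 2) (cC N)).
apply: le_trans; rewrite !mulr_sumr -big_split; apply: ler_sum => k _.
rewrite /sqnorm !mulr_sumr -big_split; apply: ler_sum => w _.
change (complex.Re `|a w - c w| ^+ 2 <=
  2 * complex.Re `|a w| ^+ 2 + 2 * complex.Re `|c w| ^+ 2).
apply: aux; first exact: (@rnorm_ge0 R R[i]^o).
exact: (@rnormB R R[i]^o).
Qed.

Lemma bernoulli (x : R) m : 0 <= x -> 1 + m%:R * x <= (1 + x) ^+ m.
Proof.
move=> x0; elim: m => [|m IH]; first by rewrite mul0r addr0 expr0.
rewrite exprS -natr1.
have := ler_wpM2l (addr_ge0 ler01 x0) IH; apply: le_trans.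
have : 0 <= m%:R * x * x by rewrite !mulr_ge0.
lra.
Qed.

(** If the norms [sqnorm a k] are bounded, the upper limit of their roots of order
    [2 k] is at most 1. *)
Lemma square_summable_holo a : square_summable a -> free_holomorphic 1 a.
Proof.
move=> [M0 aM0]; pose M := Num.max M0 1.
have M1 : 1 <= M by rewrite le_max lexx orbT.
have aM k : sqnorm a k <= M.
  rewrite le_max; apply/orP; left; apply: le_trans (aM0 k.+1).
  by rewrite big_ord_recr /= lerDr sumr_ge0// => j _; exact: sqnorm_ge0.
rewrite /free_holomorphic /inv_radius invr1; apply/lee_addgt0Pr => e e0.
have [m me] : exists m : nat, M <= 1 + m%:R * e.
  exists (Num.bound (M / e)); rewrite -lerBlDl.
  have := archi_boundP (divr_ge0 (le_trans ler01 M1) (ltW e0)).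
  by rewrite ltr_pdivrMr// => h; lra.
pose u (k : nat) : \bar R := (sqnorm a k `^ ((2 * k)%:R^-1))%:E.
apply: (@le_trans _ _ (ereal_sup (u @` [set k | (m.+1 <= k)%N]))).
  by apply: ereal_inf_lbound; exists [set k | (m.+1 <= k)%N] => //; exists m.+1.
apply: ge_ereal_sup => _ [k /= mk <-]; rewrite /u -EFinD lee_fin.
have k0 : (2 * k)%:R != 0 :> R by rewrite pnatr_eq0 muln_eq0 /= -lt0n (leq_ltn_trans _ mk).
have e1 : 0 <= 1 + e by rewrite addr_ge0// ltW.
have le : sqnorm a k <= (1 + e) ^+ (2 * k).
  apply: le_trans (aM k) _; apply: le_trans me _.
  apply: le_trans (bernoulli _ (ltW e0)); rewrite lerD2l ler_wpM2r ?(ltW e0)//.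
  by rewrite ler_nat (leq_trans (ltnW mk))// leq_pmull.
have -> : 1 + e = ((1 + e) ^+ (2 * k)) `^ ((2 * k)%:R^-1).
  by rewrite -powR_mulrn// -powRrM mulfV// powRr1.
by rewrite ge0_ler_powR ?invr_ge0 ?nnegrE ?sqnorm_ge0// exprn_ge0.
Qed.

Lemma pmul_var_rcons a (j : 'I_n) u i :
  pmul a (pvar j) (rcons u i) = (i == j)%:R * a u.
Proof.
elim: u a => [|k u IH] a /=.
  rewrite pmul_cons pmul_nil mulr0 addr0 mulrC; congr (_ * _).
  by rewrite /pvar eqseq_cons andbT.
by rewrite pmul_cons IH /pvar eqseq_cons; case: u IH => [|? ?] _ /=; rewrite andbF mulr0 add0r.
Qed.

(** Multiplying by one letter on the right moves the coefficients without changing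
    the sum of their squares. *)
Lemma square_summable_pmul_delta a w :
  square_summable a -> square_summable (pmul a (pdelta w)).
Proof.
move=> aS; elim/last_ind: w => [|w j [M IH]]; first by rewrite pmul1r.
rewrite -cats1 -pdelta_cat pmulA; set h := pmul a _ in IH *.
exists M => -[|N]; first by rewrite big_ord0; have := IH 0%N; rewrite big_ord0.
pose F (b : fps R n) (u : word n) := complex.Re `|b u| ^+ 2.
rewrite -[leLHS]/(wsum N.+1 (F (pmul h (pvar j)))) wsum_rcons.
rewrite {1}/F pmul_nil mulr0 normr0 expr0n add0r (bigD1 j)//= big1 ?addr0 => [|i ij].
  have := IH N; rewrite -[leLHS]/(wsum N (F h)); apply: le_trans.
  by under eq_wsum do rewrite /F pmul_var_rcons eqxx mul1r.
by apply: wsum_eq0 => u _; rewrite /F pmul_var_rcons (negbTE ij) mul0r normr0 expr0n.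
Qed.

End SquareSummable.

Section NormEvaluation.
Context {R : realType} {n : nat} {E : hilbertType R}.
Implicit Types (a c : fps R n) (Y : 'I_n -> bop E E).

Lemma norm_evalB a c Y B : norm_eval a Y B -> norm_eval c Y B ->
  norm_eval (fun w => a w - c w) Y (bzero E E).
Proof.
move=> /norm_evalP aB /norm_evalP cB; apply/norm_evalP => e e0.
have e2 : 0 < e / 2 by rewrite divr_gt0.
apply: filterS2 (aB _ e2) (cB _ e2) => N aN cN x /=.
have -> : psum (fun w => a w - c w) Y N x = psum a Y N x - psum c Y N x.
  by rewrite -wsumB; apply: eq_wsum => w _; rewrite scalerBl.
rewrite subr0; have := rnorm_triangle (B x) (psum a Y N x) (psum c Y N x).
have := aN x; have := cN x; rewrite (rnorm_dist (psum c Y N x)).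
by move: (rnorm x) => r; nra.
Qed.

Lemma norm_eval_pmul_delta c Y B w : norm_eval c Y B ->
  norm_eval (pmul c (pdelta w)) Y (bcomp B (bopword Y w)).
Proof.
move=> /norm_evalP cB; apply/norm_evalP => e e0.
set b := opnorm (bopword Y w); have b0 : 0 <= b := bop_opnorm_ge0 _.
have b1 : 0 < b + 1 by rewrite ltr_wpDl.
have [N0 _ NP] := cB _ (divr_gt0 e0 b1).
exists (N0 + size w)%N => // M /= NM x.
rewrite -(subnK (leq_trans (leq_addl _ _) NM)); set N := (M - size w)%N.
have -> : psum (pmul c (pdelta w)) Y (N + size w) x = psum c Y N (opword Y w x).
  rewrite /psum (wsum_pmul_delta N w c (fun u => opword Y u x)).
  by apply: eq_wsum => u _; rewrite opword_cat.
have N0N : (N0 <= N)%N by rewrite leq_subRL ?(leq_trans (leq_addl _ _) NM)// addnC.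
apply: le_trans (NP N N0N (opword Y w x)) _.
rewrite mulrAC ler_pdivrMr// -mulrA ler_pM2l// mulrC.
apply: le_trans (bop_opnorm (bopword Y w) x) _.
by rewrite ler_wpM2r ?rnorm_ge0// lerDl.
Qed.

End NormEvaluation.

(** * Uniqueness of the inverse series *)

Section Uniqueness.
Context {R : realType} {n : nat}.
Implicit Types (f g : 'I_n -> fps R n) (c p s : fps R n).

(** The difference of [c] and [c'] is a free holomorphic function on the unit ball
    whose composition with [f] vanishes. *)
Lemma holo_inj gamma f c c' : admissible (Holo gamma) f ->
  square_summable c -> square_summable c' ->
  (forall (E : hilbertType R) (X W : 'I_n -> bop E E), infinite_dim E ->
     opball gamma X -> (forall i, norm_eval (f i) X (W i)) ->
     exists2 B, norm_eval c W B & norm_eval c' W B) ->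
  c = c'.
Proof.
move=> [_ _ _ inj] cS c'S cc'; apply/funext => w; apply/eqP; rewrite -subr_eq0.
apply/eqP; apply: (inj (fun w => c w - c' w)).
  exact/square_summable_holo/square_summableB.
by move=> E X W Einf Xb fW; have [B cB c'B] := cc' E X W Einf Xb fW; exact: norm_evalB cB c'B.
Qed.

Section WithBasis.
Context {E : hilbertType R} (e : word n -> E).
Hypotheses (eB : orthonormal_basis e) (n_gt0 : (0 < n)%N).

(** Substituting the values of the inverse polynomials at truncated shifts turns
    [sum_v c_v f_v] into [sum_v c_v S_v], from which [c] can be read off. *)
Lemma poly_inj f c c' s : admissible PolyAut f -> is_poly c -> is_poly c' ->
  formal_sum f c s -> formal_sum f c' s -> c = c'.
Proof.
move=> [fP [q [qP fq]]] [A cA] [A' c'A'] cs c's.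
pose B := maxn A A'; pose d (w : word n) := c w - c' w.
have dB w : (B <= size w)%N -> d w = 0.
  by rewrite geq_max => /andP[Aw A'w]; rewrite /d cA// c'A'// subrr.
have d0 : formal_sum f d (fun=> 0).
  have [[N h] [N' h']] := ((formal_sumP _ _ _).1 cs, (formal_sumP _ _ _).1 c's).
  apply/formal_sumP; exists (fun z => maxn (N z) (N' z)) => z M.
  rewrite geq_max => /andP[NM N'M]; rewrite /d.
  by under eq_wsum do rewrite mulrBl; rewrite wsumB h// h'// subrr.
pose S := btrunc_shift eB B.
have /choice[Y YP] i := is_poly_eval S (qP i).
have fY i : poly_eval (f i) Y (S i).
  have [Af fA] := fP i; exists Af; split=> // x.
  have := poly_eval_comp YP fA (fq i).1; move=> /(poly_eval_unique (poly_eval_var i S)).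
  by move=> ->.
have := poly_eval_comp fY dB d0.
have zero : poly_eval (fun=> 0) Y (fun=> 0).
  by exists 0%N; split=> // x; rewrite /psum wsum0.
move=> /(poly_eval_unique zero)/(_ (e [::])) => dS.
apply/funext => w; apply/eqP; rewrite -subr_eq0 -/(d w); apply/eqP.
have [/dB//|wB] := leqP B (size w).
have := sym_psum d B (btrunc_shift_sym eB (N := B)) (e [::]) (ltnW wB).
rewrite -dS /Defs.coord linear0l -/(coord e _) (coord_basis eB) pmul1r.
move=> /esym <-; rewrite -(wsum_delta (V := R[i]^o) d wB); apply: eq_wsum => v _.
by rewrite pword_var /pdelta mulrC eq_sym.
Qed.

(** When [f] vanishes at [0], a composition identity between functions on a ball
    is an identity between formal power series: evaluate it at small truncated
    shifts, which are nilpotent. *)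
Lemma holo_formal_sum gamma f c p : admissible (Holo gamma) f ->
  (forall i, f i [::] = 0) -> H2_sum (Holo gamma) f c p -> formal_sum f c p.
Proof.
move=> [g0 _ fball _] f0 [_ cp] z.
exists (size z).+1 => // M /= zM; set N := size z.
have [t t0 tb] := opball_scale (btrunc_shift eB N) g0.
set X := scale_tuple t _ in tb.
have Einf := basis_infinite_dim eB n_gt0.
have [W fW _] := fball E X Einf tb.
have [P pP cP] := cp E X W Einf tb fW.
(* [gr a] is [a] with every [Z_i] replaced by [t Z_i]. *)
pose gr (a : fps R n) : fps R n := fun u => t%:C ^+ size u * a u.
have gr_pmul a b : pmul (gr a) (gr b) = gr (pmul a b).
  apply/funext => u; rewrite /gr /pmul mulr_sumr; apply: eq_bigr => k _.
  rewrite mulrACA -exprD -size_cat cat_take_drop; ring.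
have gr_pword h v : pword (fun i => gr (h i)) v = gr (pword h v).
  elim: v => [|i v IH]; last by rewrite /= IH gr_pmul.
  by apply/funext => -[|j u]; rewrite /gr /pone /= ?expr0 ?mul1r ?mulr0.
have symX i : sym_upto e N (X i) (gr (pvar i)).
  move=> x u uN; rewrite [X i x]/(_ *: _) /X /= coordZ (btrunc_shift_sym eB)//.
  rewrite -pmulZl; apply: eq_pmul => // v _; rewrite /gr /pvar.
  by case: eqP => [->|_]; rewrite ?mulr0// expr1.
have sym_gr a B : norm_eval a X B -> sym_upto e N B (gr a).
  move=> /norm_eval_sot aB; apply: (sym_lim eB symX aB) => u uN.
  exists (size u).+1 => M' uM; rewrite -(wsum_delta (V := R[i]^o) (gr a) uM).
  apply: eq_wsum => v _; rewrite gr_pword pword_var /gr /pdelta.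
  rewrite eq_sym; case: eqP => [->|_]; rewrite ?mulr0 ?scale0r// ?mul1r.
    by rewrite mulr1 mulrC -[RHS]/(1 * _) mul1r.
have low (u v : word n) : ((size u).+1 <= size v)%N -> c v * pword f v u = 0.
  by move=> uv; rewrite (pword_low f0 uv) mulr0.
have := sym_gr p P pP (e [::]) z (leqnn _).
pose s (u : word n) := t%:C ^+ size u *
  wsum (size u).+1 (fun v => c v * pword f v u).
have symP : sym_upto e N P s.
  apply: (sym_lim eB (fun i => sym_gr _ _ (fW i)) (norm_eval_sot cP)) => u uN.
  exists (size u).+1 => M' uM.
  rewrite /s -(wsum_stable (low u) uM).
  rewrite (raddf_wsum (h := fun x => t%:C ^+ size u * x)) ?mulr0//; last exact: mulrDr.
  by apply: eq_wsum => v _; rewrite gr_pword /gr mulrCA.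
rewrite (symP (e [::]) z (leqnn _)) (coord_basis eB) !pmul1r /s /gr.
have tz : t%:C ^+ size z != 0.
  by rewrite expf_neq0//; apply/eqP => /(congr1 (@complex.Re R))/eqP; rewrite /= gt_eqF.
by rewrite -(wsum_stable (low z) zM) => /(mulfI tz).
Qed.

(** Evaluating the polynomial identity on the ball turns it into an identity
    between functions there. *)
Lemma holo_poly gamma f c c' i : admissible (Holo gamma) f ->
  admissible PolyAut f -> H2_sum (Holo gamma) f c (pvar i) ->
  H2_sum PolyAut f c' (pvar i) -> c = c'.
Proof.
move=> fH [fP _] [cS cp] [c'P c's].
apply: (holo_inj fH cS (is_poly_square_summable c'P)) => F X W Finf Xb fW.
have [P iP cP] := cp F X W Finf Xb fW.
have PX : P = X i by apply: norm_eval_unique iP (poly_eval_norm (poly_eval_var i X)).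
exists P => //; rewrite PX.
have /choice[Y YP] j := is_poly_eval X (fP j).
have WY j : W j = Y j by apply: norm_eval_unique (fW j) (poly_eval_norm (YP j)).
have [A c'A] := c'P; have := poly_eval_comp YP c'A c's.
move=> /(poly_eval_unique (poly_eval_var i X)) h.
rewrite (funext WY : W = Y); apply: poly_eval_norm; by exists A; split=> // x; rewrite h.
Qed.

(** The inverse series is the same under all three conditions that [f] happens to
    satisfy: two of the spaces H^2(f) are compared through formal power series,
    or through functions on a ball when one of them is defined in this way. *)
Lemma inverse_series_unique f g g' :
  inverse_series f g -> inverse_series f g' -> g = g'.
Proof.
move=> [k fk gk] [k' fk' gk']; apply/funext => i; move: (gk i) (gk' i).
have formal k0 c p : admissible k0 f -> (forall i, f i [::] = 0) ->
    H2_sum k0 f c p -> formal_sum f c p.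
  case: k0 => [||gamma] fk0 f0; [by case|by case|exact: holo_formal_sum].
case: k k' fk fk' gk gk' => [||gamma] [||gamma'] fk fk' _ _.
- by move=> [? ?] [? ?]; exact: (poly_inj fk).
- move=> h h'; have [f0 _ fJ] := fk'.
  exact: formal_inj f0 fJ _ _ _ (formal _ _ _ fk f0 h) (formal _ _ _ fk' f0 h').
- by move=> h h'; apply/esym; exact: holo_poly fk' fk h' h.
- move=> h h'; have [f0 _ fJ] := fk.
  exact: formal_inj f0 fJ _ _ _ (formal _ _ _ fk f0 h) (formal _ _ _ fk' f0 h').
- move=> h h'; have [f0 _ fJ] := fk.
  exact: formal_inj f0 fJ _ _ _ (formal _ _ _ fk f0 h) (formal _ _ _ fk' f0 h').
- move=> h h'; have [f0 _ fJ] := fk.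
  exact: formal_inj f0 fJ _ _ _ (formal _ _ _ fk f0 h) (formal _ _ _ fk' f0 h').
- by move=> h h'; exact: holo_poly fk fk' h h'.
- move=> h h'; have [f0 _ fJ] := fk'.
  exact: formal_inj f0 fJ _ _ _ (formal _ _ _ fk f0 h) (formal _ _ _ fk' f0 h').
move=> [cS cP] [c'S c'P].
(* Both identities hold on the smaller ball. *)
wlog gg : gamma gamma' g g' fk fk' cS cP c'S c'P / gamma <= gamma'.
  move=> H; have [|/ltW] := leP gamma gamma'.
    exact: (H gamma gamma' g g').
  by move=> h; apply/esym; exact: (H gamma' gamma g' g).
apply: (holo_inj fk cS c'S) => F X W Finf Xb fW.
have [P iP gP] := cP F X W Finf Xb fW.
have [P' iP' gP'] := c'P F X W Finf (lt_le_trans Xb gg) fW.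
by exists P => //; rewrite (norm_eval_unique iP iP').
Qed.

End WithBasis.
End Uniqueness.

(** * Universal models *)

Section Models.
Context {R : realType} {n : nat}.
Hypothesis n_gt0 : (0 < n)%N.
Implicit Types (f g : 'I_n -> fps R n) (c : fps R n) (E K : hilbertType R).

(** Since [Z_i f_w] is the sum of the [g_i(v) f_(v w)], the operator [M_(Z_i)] is
    left multiplication by [g_i] in coordinates. *)
Lemma model_inverse E f (e : word n -> E) (MZ : 'I_n -> bop E E) :
  universal_model f e MZ ->
  exists2 g, inverse_series f g &
    forall i w, coord e (MZ i (e w)) = pmul (g i) (pdelta w).
Proof.
move=> [eB [[||gamma] [fk MZk]]] /=.
- move=> _.
  have H2 i w := MZk i (e w) (eq_ind_r is_poly (is_poly_delta w) (coord_basis eB w)).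
  pose g i := coord e (MZ i (e [::])).
  have prod i w : is_poly (coord e (MZ i (e w))) /\
      formal_sum f (coord e (MZ i (e w))) (pmul (pvar i) (pword f w)).
    have [s [_ ws] [dP ds]] := H2 i w; split=> //.
    rewrite (coord_basis eB) in ws.
    by rewrite (formal_sum_unique (formal_sum_delta f w) ws).
  have gP i : is_poly (g i) /\ formal_sum f (g i) (pvar i).
    by have [gp gs] := prod i [::]; split=> //; rewrite pmul1r in gs.
  exists g; first by exists PolyAut.
  move=> i w; have [dp ds] := prod i w; have [gp gs] := gP i.
  exact: (poly_inj eB fk dp (is_poly_pmul gp (is_poly_delta w)) ds (formal_sum_mulr w gs)).
- move=> [[g gP] _]; exists g; first by exists Formal.
  move=> i w; have [s [_ ws] [_ ds]] := MZk i (e w) I.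
  rewrite (coord_basis eB) in ws; have [f0 _ fJ] := fk.
  rewrite -(formal_sum_unique (formal_sum_delta f w) ws) in ds.
  exact: (formal_inj f0 fJ ds (formal_sum_mulr w (gP i).2)).
move=> [[g gP] _]; exists g; first by exists (Holo gamma).
move=> i w; apply: (holo_inj fk).
- exact: coord_square_summable.
- exact: square_summable_pmul_delta (gP i).1.
move=> F X W Finf Xb fW.
have [P [B [iP wB dB]]] := MZk i (e w) I F X W Finf Xb fW.
have [P' iP' gP'] := (gP i).2 F X W Finf Xb fW.
rewrite (coord_basis eB) in wB.
have BE : B = bopword W w.
  exact: norm_eval_unique wB (poly_eval_norm (F := bopword W w) (poly_eval_delta w W)).
exists (bcomp P B) => //.
by rewrite BE (norm_eval_unique iP iP'); exact: norm_eval_pmul_delta.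
Qed.

(** Each coordinate of [A x] is continuous in [x] and is determined by finitely
    many coordinates of [x], so that it can be computed on the basis. *)
Lemma basis_symbol E (e : word n -> E) (A : bop E E) c :
  orthonormal_basis e -> (forall w, coord e (A (e w)) = pmul c (pdelta w)) ->
  forall N, sym_upto e N A c.
Proof.
move=> eB Ac N x z zN; apply: (coord_lim eB (bop_cvg A (eB.2 x))).
exists (size z).+1 => // M /= zM.
rewrite bop_wsum /Defs.coord hdot_wsuml.
transitivity (wsum M (fun w => coord e x w * pmul c (pdelta w) z)).
  by apply: eq_wsum => w _; rewrite bopZ linearZl_LR /= -Ac.
transitivity (pmul c (fun u => wsum M (fun w => coord e x w * pdelta w u)) z).
  rewrite /wsum pmul_sumr; apply: eq_bigr => k _; rewrite pmul_sumr.
  by apply: eq_bigr => w _; rewrite pmulZr.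
apply: eq_pmul => // u uz.
have uM : (size u < M)%N by apply: leq_ltn_trans zM.
rewrite -[RHS](wsum_delta (V := R[i]^o) (coord e x) uM).
by apply: eq_wsum => w _; rewrite /pdelta mulrC eq_sym.
Qed.

(** In coordinates [f_j(M_Z)] is left multiplication by [f_j] composed with [g],
    that is, by [Z_j]: it is a left creation operator. *)
Lemma model_shift E f (e : word n -> E) (MZ W : 'I_n -> bop E E) :
  universal_model f e MZ -> tuple_eval f MZ W ->
  forall j w, W j (e w) = e (j :: w).
Proof.
move=> fM fW j w; have [eB [k [fk MZk kP]]] := fM.
apply: (coord_inj eB); rewrite (coord_basis eB).
case: k fk MZk kP => [||gamma] fk _ kP.
- have [fP [q [qP fq]]] := fk.
  have [g fg MZg] := model_inverse fM.
  have gq : g = q.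
    apply: (inverse_series_unique eB n_gt0 fg); exists PolyAut => // i.
    by split=> //; exact: (fq i).2.
  have [F FP] := is_poly_eval MZ (fP j).
  have FW : F = W j.
    by apply: abel_unique (tuple_eval_abel fW j); apply/sot_abel/norm_eval_sot/poly_eval_norm.
  have symZ N i : sym_upto e N (MZ i) (q i).
    by rewrite -gq; apply: basis_symbol.
  apply/funext => z; rewrite -pmul_var_delta -(coord_basis eB).
  apply: (sym_lim (N := size z) eB (symZ _) (norm_eval_sot _)) => //.
    by rewrite -FW; exact: poly_eval_norm FP.
  move=> u _; have [N NP] := (formal_sumP _ _ _).1 (fq j).1.
  by exists (N u) => M; exact: NP.
- have [_ [W1 fW1 W1P]] := kP; have [f0 _ fJ] := fk.
  have -> : W j = W1 j by apply: abel_unique (tuple_eval_abel fW j) (tuple_eval_abel fW1 j).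
  have [s [_ ws] [_ ds]] := W1P j (e w) I.
  rewrite (coord_basis eB) in ws.
  rewrite -(formal_sum_unique (formal_sum_delta f w) ws) in ds.
  exact: (formal_inj f0 fJ ds (formal_sum_delta f (j :: w))).
have [_ [W1 fW1 W1P]] := kP.
have -> : W j = W1 j by apply: abel_unique (tuple_eval_abel fW j) (tuple_eval_abel fW1 j).
apply: (holo_inj fk).
- exact: coord_square_summable.
- exact/is_poly_square_summable/is_poly_delta.
move=> F X Y Finf Xb fY.
have [P [B [jP wB dB]]] := W1P j (e w) I F X Y Finf Xb fY.
rewrite (coord_basis eB) in wB.
have BE : B = bopword Y w.
  exact: norm_eval_unique wB (poly_eval_norm (F := bopword Y w) (poly_eval_delta w Y)).
exists (bcomp P B) => //; rewrite BE (norm_eval_unique jP (fY j)).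
have -> : bcomp (Y j) (bopword Y w) = bopword Y (j :: w) by apply: bop_ext.
exact: (poly_eval_norm (F := bopword Y (j :: w)) (poly_eval_delta (j :: w) Y)).
Qed.

Lemma shift_adj E (e : word n -> E) (W : 'I_n -> bop E E) :
  orthonormal_basis e -> (forall j w, W j (e w) = e (j :: w)) ->
  forall i j, bcomp (adj (W i)) (W j) = bscale (i == j)%:R (bid E).
Proof.
move=> eB We i j; apply: (bop_basis_eq eB) => w; apply: (coord_inj eB).
apply/funext => u; rewrite /Defs.coord /= linearZl_LR /= adjPr !We !eB.1 eqseq_cons.
by rewrite eq_sym; case: (i == j); rewrite ?mul0r ?mul1r.
Qed.

(** All universal models of [f] are unitarily equivalent, so a representation
    of the C*-algebra of one yields a representation for any other. *)
Lemma model_rep_transfer E0 E1 K f (e0 : word n -> E0) (e1 : word n -> E1)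
    (M0 : 'I_n -> bop E0 E0) (M1 : 'I_n -> bop E1 E1) (pi : bop E1 E1 -> bop K K) :
  universal_model f e0 M0 -> universal_model f e1 M1 ->
  unital_star_rep (cstar_generated M1) pi ->
  exists2 pi0 : bop E0 E0 -> bop K K,
    unital_star_rep (cstar_generated M0) pi0 & forall i, pi0 (M0 i) = pi (M1 i).
Proof.
move=> f0 f1 piP; have [e0B _] := f0; have [e1B _] := f1.
have [g0 fg0 M0g] := model_inverse f0; have [g1 fg1 M1g] := model_inverse f1.
have gg := inverse_series_unique e0B n_gt0 fg0 fg1.
have [U [Ue U'U UU']] := onb_unitary e0B e1B.
pose conj (B : bop E0 E0) : bop E1 E1 := bcomp U (bcomp B (adj U)).
have conjE B y : conj B y = U (B (adj U y)) by [].
have conjM i : conj (M0 i) = M1 i.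
  apply: (bop_basis_eq e1B) => w; rewrite conjE -Ue U'U.
  apply: (coord_inj e1B); rewrite Ue M1g -gg -M0g; apply/funext => u.
  by rewrite /Defs.coord -Ue -adjPr U'U.
have conj_id : conj (bid E0) = bid E1 by apply: bop_ext => y; rewrite conjE /= UU'.
have conj_add A B : conj (badd A B) = badd (conj A) (conj B).
  by apply: bop_ext => y; rewrite conjE /= bopD.
have conj_scale z A : conj (bscale z A) = bscale z (conj A).
  by apply: bop_ext => y; rewrite conjE /= bopZ.
have conj_comp A B : conj (bcomp A B) = bcomp (conj A) (conj B).
  by apply: bop_ext => y; rewrite conjE /= U'U.
have conj_adj A : conj (adj A) = adj (conj A).
  apply/esym/adj_unique => x y; rewrite !conjE adjP -(adjPr U).
  by rewrite adjP.
have conj_C A : cstar_generated M0 A -> cstar_generated M1 (conj A).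
  elim=> [i||B D _ IB _ ID|z B _ IB|B D _ IB _ ID|B _ IB|u B _ Iu uB].
  - by rewrite conjM; exact: Cstar_gen.
  - by rewrite conj_id; exact: Cstar_id.
  - by rewrite conj_add; exact: Cstar_add.
  - by rewrite conj_scale; exact: Cstar_scale.
  - by rewrite conj_comp; exact: Cstar_comp.
  - by rewrite conj_adj; exact: Cstar_adj.
  apply: (Cstar_lim Iu); apply/opnorm_cvgP => d d0.
  have Un x : rnorm (U x) = rnorm x.
    by apply/eqP; rewrite -(@eqrXn2 _ 2) ?rnorm_ge0// !rnorm2E adjP U'U.
  have U'n y : rnorm (adj U y) = rnorm y by rewrite -Un UU'.
  apply: filterS ((opnorm_cvgP _ _).1 uB d d0) => k ukB y.
  by rewrite !conjE -bopB Un -[in leRHS]U'n; exact: ukB.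
exists (pi \o conj) => [|i]; last by rewrite /= conjM.
split=> /= [|A B CA CB|z A CA|A B CA CB|A CA].
- by rewrite conj_id (rep_id piP).
- by rewrite conj_add (rep_add piP)//; exact: conj_C.
- by rewrite conj_scale (rep_scale piP)//; exact: conj_C.
- by rewrite conj_comp (rep_comp piP)//; exact: conj_C.
- by rewrite conj_adj (rep_adj piP)//; exact: conj_C.
Qed.

End Models.

(** * Dilations *)

Section RepresentedEvaluation.
Context {R : realType} {n : nat} {E K : hilbertType R}.
Variables (MZ : 'I_n -> bop E E) (pi : bop E E -> bop K K).
Local Notation C := (cstar_generated MZ).
Hypothesis piP : unital_star_rep C pi.
Implicit Types (a : fps R n) (Y : 'I_n -> bop E E).

Lemma cstar_bopword Y w : (forall i, C (Y i)) -> C (bopword Y w).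
Proof.
move=> CY; elim: w => [|i w IH].
  have -> : bopword Y [::] = bid E by apply: bop_ext.
  exact: Cstar_id.
have -> : bopword Y (i :: w) = bcomp (Y i) (bopword Y w) by apply: bop_ext.
exact: Cstar_comp.
Qed.

Lemma cstar_bpsum a Y N : (forall i, C (Y i)) -> C (bpsum a Y N).
Proof.
move=> CY; apply: cstar_sum => k; apply: cstar_sum => w; apply: Cstar_scale.
exact: cstar_bopword.
Qed.

Lemma rep_bopword Y w : (forall i, C (Y i)) ->
  pi (bopword Y w) = bopword (fun i => pi (Y i)) w.
Proof.
move=> CY; elim: w => [|i w IH].
  have -> : bopword Y [::] = bid E by apply: bop_ext.
  by rewrite (rep_id piP); apply: bop_ext.
have -> : bopword Y (i :: w) = bcomp (Y i) (bopword Y w) by apply: bop_ext.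
rewrite (rep_comp piP)//; last exact: cstar_bopword.
by rewrite IH; apply: bop_ext.
Qed.

Lemma rep_bpsum a Y N : (forall i, C (Y i)) ->
  pi (bpsum a Y N) = bpsum a (fun i => pi (Y i)) N.
Proof.
move=> CY; have Cw w : C (bscale (a w) (bopword Y w)).
  by apply: Cstar_scale; exact: cstar_bopword.
rewrite (rep_sum piP) => [|k]; last by apply: cstar_sum => w.
apply: bop_ext => x; apply: eq_bigr => k _.
rewrite (rep_sum piP) => [|w]; last exact: Cw.
apply: eq_bigr => w _; rewrite (rep_scale piP); last exact: cstar_bopword.
by rewrite rep_bopword.
Qed.

Lemma cstar_norm_eval a Y B : (forall i, C (Y i)) -> norm_eval a Y B -> C B.
Proof.
move=> CY aB; apply: (@Cstar_lim _ _ _ _ (bpsum a Y)); last exact: aB.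
by move=> k; exact: cstar_bpsum.
Qed.

Lemma rep_norm_eval a Y B : (forall i, C (Y i)) -> norm_eval a Y B ->
  norm_eval a (fun i => pi (Y i)) (pi B).
Proof.
move=> CY aB; have CB := cstar_norm_eval CY aB.
apply/norm_evalP => d d0; apply: filterS ((norm_evalP _ _ _).1 aB d d0) => N aN x.
have := star_rep_dist piP (ltW d0) (cstar_bpsum a N CY) CB aN x.
by rewrite rep_bpsum.
Qed.

(** Norm convergence of [f(M_Z)], directly or through its radial means, is what
    allows the representation to be applied term by term. *)
Lemma rep_tuple_eval (f : 'I_n -> fps R n) (W : 'I_n -> bop E E) :
  (forall i, norm_eval (f i) MZ (W i)) \/
  (exists (delta : R) (P : 'I_n -> R -> bop E E), [/\ 0 < delta < 1,
     forall i r, delta < r < 1 -> norm_eval (f i) (scale_tuple r MZ) (P i r) &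
     forall i, opnorm (fun x => P i r x - W i x) @[r --> (1 : R)^'-] --> (0 : R)]) ->
  forall i, C (W i) /\ abel_eval (f i) (fun i => pi (MZ i)) (pi (W i)).
Proof.
have CM i : C (MZ i) by exact: Cstar_gen.
have CrM r i : C (scale_tuple r MZ i) by exact: Cstar_scale.
case=> [fW i|[delta [P [/andP[d0 d1] fP PW]]] i].
  split; first exact: cstar_norm_eval (fW i).
  exact/sot_abel/norm_eval_sot/rep_norm_eval.
have CP r : delta < r < 1 -> C (P i r) by move=> rd; apply: cstar_norm_eval (fP i r rd).
have {}PW (d : R) : 0 < d -> \forall r \near (1 : R)^'-,
    bounded_by d (fun x => P i r x - W i x).
  exact: (opnorm_cvgP _ _).1 (PW i) d.
have near1 : \forall r \near (1 : R)^'-, delta < r < 1.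
  near=> r; apply/andP; split; near: r; [exact: nbhs_left_gt|exact: nbhs_left_lt].
have CW : C (W i).
  have /choice[r rP] (k : nat) : exists r, delta < r < 1 /\
      bounded_by k.+1%:R^-1 (fun x => P i r x - W i x).
    have k0 : 0 < k.+1%:R^-1 :> R by rewrite invr_gt0 ltr0n.
    exact: (@filter_ex _ (1 : R)^'- _ _ (filterI near1 (PW _ k0))).
  apply: (@Cstar_lim _ _ _ _ (fun k => P i (r k))) => [k|].
    by apply: CP; case: (rP k).
  apply/opnorm_cvgP => d dpos.
  apply: filterS (near_infty_natSinv_lt (PosNum dpos)) => k /= kd x.
  apply: le_trans ((rP k).2 x) _; rewrite ler_wpM2r ?rnorm_ge0//.
  exact: ltW.
split=> //; exists delta, (fun r => pi (P i r)); split=> [//|r rd x|x].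
  have <- : (fun i => pi (scale_tuple r MZ i)) = scale_tuple r (fun i => pi (MZ i)).
    by apply/funext => j; rewrite /scale_tuple (rep_scale piP).
  by apply: norm_eval_sot; exact: rep_norm_eval (CrM r) (fP i r rd).
apply/rcvgP => d dpos; have x1 : 0 < rnorm x + 1 by rewrite ltr_wpDl ?rnorm_ge0.
apply: filterS2 near1 (PW _ (divr_gt0 dpos x1)) => r rd PWr.
have := star_rep_dist piP (ltW (divr_gt0 dpos x1)) (CP r rd) CW PWr x.
rewrite rnorm_dist => /le_lt_trans; apply.
by rewrite mulrAC ltr_pdivrMr// ltr_pM2l// ltrDl.
Unshelve. all: by end_near.
Qed.

End RepresentedEvaluation.

(** The representation preserves the relations [S_i^* S_j = delta_ij] of the left
    creation operators [S = f(M_Z)]. Its value at [S] agrees, by uniqueness of Abel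
    means, with the value [f(V)] from which the domain condition recovers [V]. *)
Lemma dilation_row_isometry (R : realType) (n : nat) (n_gt0 : (0 < n)%N)
    (f : 'I_n -> fps R n) (H K : hilbertType R) (J : bop H K)
    (T : 'I_n -> bop H H) (V : 'I_n -> bop K K) :
  norm_model_property f -> is_dilation f J T V ->
  exists g W, [/\ inverse_series f g, row_isometry W,
    forall i, abel_eval (f i) V (W i) & forall i, abel_eval (g i) W (V i)].
Proof.
move=> [E [e [MZ [W0 [fM fW0 fnorm]]]]] [_ [g [W [fg VW _ WV]]] rep _].
have [E1 [e1 [MZ1 [pi1 [fM1 pi1P pi1V]]]]] := rep.
have [pi piP piM] := model_rep_transfer n_gt0 fM fM1 pi1P.
have CW := rep_tuple_eval piP fnorm.
have piV : (fun i => pi (MZ i)) = V by apply/funext => i; rewrite piM pi1V.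
have WE i : W i = pi (W0 i).
  apply: abel_unique (tuple_eval_abel VW i) _.
  by have := (CW i).2; rewrite piV.
exists g, W; split=> // [i j x|i|i].
- have shift := shift_adj fM.1 (model_shift n_gt0 fM fW0) i j.
  have := congr1 pi shift.
  have [[CWi _] [CWj _]] := (CW i, CW j).
  rewrite (rep_comp piP)//; last exact: Cstar_adj.
  rewrite (rep_adj piP)// (rep_scale piP); last exact: Cstar_id.
  by rewrite (rep_id piP) -!WE => /(congr1 (fun B : bop K K => B x)).
- exact: tuple_eval_abel.
exact: tuple_eval_abel.
Qed.

Theorem theorem3p8 (R : realType) (n : nat) (n_gt0 : (0 < n)%N)
  (f : 'I_n -> fps R n)
  (f_rad : radial_approximation f) (f_norm : norm_model_property f)
  (H H' K K' : hilbertType R)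
  (T : 'I_n -> bop H H) (T' : 'I_n -> bop H' H')
  (V : 'I_n -> bop K K) (V' : 'I_n -> bop K' K')
  (J : bop H K) (J' : bop H' K')
  (T_dom : in_domain f T) (T'_dom : in_domain f T')
  (V_dil : is_dilation f J T V) (V'_dil : is_dilation f J' T' V')
  (X : bop H H') (XT : forall i x, X (T i x) = T' i (X x)) :
  exists Y : bop K K',
    (forall i y, Y (V i y) = V' i (Y y)) /\
    ((forall x, adj Y (J' x) = J (adj X x)) /\ opnorm X = opnorm Y).
Proof.
have [g [W [fg Wiso VW WV]]] := dilation_row_isometry n_gt0 f_norm V_dil.
have [g' [W' [fg' W'iso V'W' W'V']]] := dilation_row_isometry n_gt0 f_norm V'_dil.
have gg' : g = g'.
  have [E [e [MZ [_ [[eB _] _ _]]]]] := f_norm.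
  exact: (inverse_series_unique eB n_gt0 fg fg').
have [_ [A [_ TA _ _]]] := T_dom.
have [_ [A' [_ T'A' _ _]]] := T'_dom.
have Jiso := isometryP (dilation_incl V_dil).
have J'iso := isometryP (dilation_incl V'_dil).
have coinv (L M : hilbertType R) (I : bop L M) (S : 'I_n -> bop L L)
    (U : 'I_n -> bop M M) (i : 'I_n) k :
    is_dilation f I S U -> adj I (U i k) = S i (adj I k).
  move=> ISU; apply: hdot_injl => x.
  by rewrite adjPr adjP (dilation_adj ISU) -adjPr -adjP.
have JW i k : adj J (W i k) = A i (adj J k).
  exact: (abel_intertwine (fun j x => coinv _ _ _ _ _ j x V_dil) (VW i)
    (tuple_eval_abel TA i)).
have J'W' i k : adj J' (W' i k) = A' i (adj J' k).
  exact: (abel_intertwine (fun j x => coinv _ _ _ _ _ j x V'_dil) (V'W' i)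
    (tuple_eval_abel T'A' i)).
have XA i x : X (A i x) = A' i (X x).
  exact: (abel_intertwine XT (tuple_eval_abel TA i) (tuple_eval_abel T'A' i)).
pose X0 : bop K H' := bcomp X (adj J).
have Jn x : rnorm (J x) = rnorm x by rewrite /rnorm (dilation_incl V_dil).
have X0bnd : bounded_by (opnorm X) X0.
  move=> k; apply: le_trans (bop_opnorm X _) _; rewrite ler_wpM2l ?bop_opnorm_ge0//.
  have J1 : bounded_by 1 J by move=> x; rewrite mul1r Jn.
  by have := adj_bounded ler01 J1 k; rewrite mul1r.
have X0W i k : X0 (W i k) = A' i (X0 k) by rewrite /= JW XA.
have [Y [Ybnd JY YW]] :=
  commutant_lifting Wiso W'iso J'iso J'W' (bop_opnorm_ge0 X) X0bnd X0W.
exists Y; split.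
  move=> i; apply: (abel_intertwine YW (WV i)).
  by rewrite gg'; exact: W'V'.
split.
  move=> x; apply: hdot_inj => k.
  by rewrite -adjP -(adjPr J') JY /= (adjP X) adjPr.
apply/le_anti; rewrite (opnorm_le (bop_opnorm_ge0 X) Ybnd) andbT.
apply: opnorm_le; first exact: bop_opnorm_ge0.
move=> h; have -> : X h = adj J' (Y (J h)) by rewrite JY /= Jiso.
have J'1 : bounded_by 1 J'.
  by move=> x; rewrite mul1r /rnorm (dilation_incl V'_dil).
apply: le_trans (adj_bounded ler01 J'1 _) _; rewrite mul1r.
by apply: le_trans (bop_opnorm Y _) _; rewrite Jn.
Qed.
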